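(* For every $n\ge 1$, each of the following groups has a real-time combing which is boundedly asynchronous and whose length function is bounded by a polynomial of the indicated degree: (i) the group $U_n(\mathbf Z)$ of $n\times n$ unipotent upper-triangular matrices over $\mathbf Z$, with degree $n-1$; (ii) the $(2n+1)$-dimensional Heisenberg group $H_{2n+1}$, with degree $2$; (iii) the free nilpotent group of class 2 on $n$ generators, $Fr_n/\gamma_3(Fr_n)$, with degree $2$.
   Context: The Heisenberg group is $H_{2n+1}=\langle x_1,\dots,x_n,y_1,\dots,y_n,z \mid z \text{ central},\ [x_i,y_i]=z\ \forall i,\ [x_i,x_j]=[y_i,y_j]=[x_i,y_j]=1\ \forall i\ne j\rangle$. $Fr_n$ is the free group on $n$ generators, and $\gamma_1(G)=G$, $\gamma_{i+1}(G)=[\gamma_i(G),G]$ is the lower central series. Let $G$ be a group with a finite inverse-closed generating set $X$. A word is an element of the free monoid $X^*$; $l(w)$ is the length of $w$, $w=_G v$ means that $w,v$ represent the same element of $G$, and the geodesic length $l_G(w)$ is the length of a shortest word in $X^*$ representing the same element as $w$. Let $\Gamma$ be the Cayley graph (vertices $g\in G$, an edge labelled $x$ from $g$ to $gx$ for each $x\in X$), and let $d_{G,X}$ be the path metric on its 1-skeleton. A word $w$ is identified with the path from $1$ labelled by $w$, parameterised by $t\in[0,\infty)$ with unit speed for $t<l(w)$ and constant, $w(t)=w(l(w))$, for $t\ge l(w)$. Words $v,w$ asynchronously $K$-fellow-travel if there is a differentiable function $h:\mathbf R\to\mathbf R$ (the relative-speed function), mapping $[0,l(v)+1]$ onto $[0,l(w)+1]$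 and strictly increasing on $[0,l(v)+1]$, such that $d_{G,X}(v(t),w(h(t)))\le K$ for all $t>0$; they boundedly asynchronously fellow-travel with bound $M$ if moreover $1/M\le h'(t)\le M$ for all $t$. A language $L\subseteq X^*$ containing at least one representative of each element of $G$ is an (asynchronous) combing for $G$ over $X$ if for some $K$ all pairs $v,w\in L$ with $w=_G vx$ for some $x\in X\cup\{1\}$ asynchronously $K$-fellow-travel; it is a boundedly asynchronous combing if there is also a global $M$ such that all these pairs boundedly asynchronously fellow-travel with bound $M$. The length function of $L$ is $f:\mathbf N\to\mathbf N$, $f(n)$ = the maximum length of a word in $L$ of geodesic length at most $n$. A real-time language is a language accepted by a deterministic real-time Turing machine: it has a fixed number of tapes, one of which is the input tape containing just the input string; at each transition it reads one input symbol and moves to the next input symbol, and on each of the other (two-way infinite) tapes it may write a symbol or blank and then stay still or move one place left or right; it halts on reaching the end of the input. A real-time combing is an asynchronous combing that is a real-time language. *)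

(* Defs.v *)
From HB Require Import structures.
From mathcomp Require Import all_boot all_order all_algebra.
From mathcomp Require Import finmap.
From mathcomp Require Import all_classical all_reals all_analysis.
Import Order.TTheory GRing.Theory Num.Theory.
Import numFieldNormedType.Exports.

Set Implicit Arguments.
Unset Strict Implicit.
Unset Printing Implicit Defensive.

Local Open Scope classical_set_scope.

Section Subgroups.
Local Open Scope group_scope.
Variable G : groupType.
Implicit Types (H A B : set G).

Definition is_subgroup H : Prop :=
  [/\ H 1, (forall x y, H x -> H y -> H (x * y)) & (forall x, H x -> H x^-1)].

Definition is_normal H : Prop :=
  is_subgroup H /\ (forall x y, H x -> H (x ^ y)).

Definition generated A : set G := smallest is_subgroup A.

Definition normal_closure A : set G := smallest is_normal A.

Definition commutator_subgroup A B : set G :=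
  generated [set [~ a, b] | a in A & b in B].

(* [lower_central i] is gamma_i, so gamma_1 = G; the index 0 is junk. *)
Definition lower_central (i : nat) : set G :=
  iter i.-1 (fun H => commutator_subgroup H [set: G]) [set: G].

Lemma generated_subgroup A : is_subgroup (generated A).
Proof.
split=> [H [[H1 _ _] _]|x y Ax Ay H HA|x Ax H HA] //.
- by have [[_ HM _] _] := HA; apply: HM; [apply: Ax|apply: Ay].
- by have [[_ _ HV] _] := HA; apply: HV; apply: Ax.
Qed.

Lemma normal_closure_normal A : is_normal (normal_closure A).
Proof.
split; first split=> [H [[[H1 _ _] _] _]|x y Ax Ay H HA|x Ax H HA] //.
- by have [[[_ HM _] _] _] := HA; apply: HM; [apply: Ax|apply: Ay].
- by have [[[_ _ HV] _] _] := HA; apply: HV; apply: Ax.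
- by move=> x y Ax H HA; have [[_ HJ] _] := HA; apply: HJ; apply: Ax.
Qed.

Lemma generated_normal A :
  (forall x y, A x -> A (x ^ y)) -> is_normal (generated A).
Proof.
move=> AJ; split; first exact: generated_subgroup.
move=> x y Ax; suff: [set z | generated A (z ^ y)] x by [].
apply: Ax; split; last first.
  by move=> z Az /= H [_ AH]; apply: AH; apply: AJ.
have [g1 gM gV] := generated_subgroup A; split=> /= [|u v gu gv|u gu].
- by rewrite conj1g.
- by rewrite conjMg; apply: gM.
- by rewrite conjVg; apply: gV.
Qed.

Lemma lower_central_normal i : is_normal (lower_central i).
Proof.
rewrite /lower_central; elim: (i.-1) => [|j [_ IH]] //=.
apply: generated_normal => _ y [a Ha [b _ <-]].
by exists (a ^ y); [exact: IH|exists (b ^ y) => //; rewrite conjRg].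
Qed.

End Subgroups.

Record normal_subgroup (G : groupType) := NormalSubgroup {
  normal_set :> G -> Prop;
  normal_setP : is_normal normal_set }.

Section Quotient.
Local Open Scope group_scope.
Local Open Scope quotient_scope.
Variables (G : groupType) (N : normal_subgroup G).

Definition coset_rel : rel G := fun x y => `[< N (x^-1 * y) >].

Lemma coset_rel_refl : reflexive coset_rel.
Proof.
by move=> x; apply/asboolP; rewrite mulVg; case: (normal_setP N) => -[].
Qed.

Lemma coset_rel_sym : symmetric coset_rel.
Proof.
have [[_ _ NV] _] := normal_setP N.
suff sub x y : coset_rel x y -> coset_rel y x.
  by move=> x y; apply/idP/idP; exact: sub.
by move=> /asboolP Nxy; apply/asboolP; have := NV _ Nxy; rewrite invgM invgK.
Qed.

Lemma coset_rel_trans : transitive coset_rel.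
Proof.
have [[_ NM _] _] := normal_setP N.
move=> y x z /asboolP Nxy /asboolP Nyz; apply/asboolP.
by have := NM _ _ Nxy Nyz; rewrite -mulgA mulVKg.
Qed.

Canonical coset_equiv :=
  EquivRel coset_rel coset_rel_refl coset_rel_sym coset_rel_trans.

Definition quotient_group : Type := {eq_quot coset_equiv}.
HB.instance Definition _ := Choice.on quotient_group.
HB.instance Definition _ := EqQuotient.on quotient_group.

Definition quo_class (x : G) : quotient_group := \pi_quotient_group x.
Definition quo_one : quotient_group := quo_class 1.
Definition quo_mul (a b : quotient_group) := quo_class (repr a * repr b).
Definition quo_inv (a : quotient_group) := quo_class (repr a)^-1.

Lemma quo_classP x y : N (x^-1 * y) -> quo_class x = quo_class y.
Proof. by move=> Nxy; apply/eqmodP/asboolP. Qed.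

Lemma quo_repr x : N ((repr (quo_class x))^-1 * x).
Proof. by apply/asboolP; apply/(@eqmodP _ coset_equiv); rewrite reprK. Qed.

Lemma quo_classM x y : quo_mul (quo_class x) (quo_class y) = quo_class (x * y).
Proof.
have [[_ NM _] NJ] := normal_setP N.
apply: quo_classP; set a := repr _; set b := repr _.
have -> : (a * b)^-1 * (x * y) = (b^-1 * y) * (a^-1 * x) ^ y.
  by rewrite /conjg invgM -!mulgA mulVKg.
by apply: NM; [exact: quo_repr|apply: NJ; exact: quo_repr].
Qed.

Lemma quo_classV x : quo_inv (quo_class x) = quo_class x^-1.
Proof.
have [[_ _ NV] NJ] := normal_setP N.
apply: quo_classP; set a := repr _; rewrite invgK.
have -> : a * x^-1 = ((a^-1 * x)^-1) ^ a^-1.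
  by rewrite /conjg !invgM !invgK -!mulgA mulgV mulg1.
by apply: NJ; apply: NV; exact: quo_repr.
Qed.

Lemma quo_classK a : quo_class (repr a) = a.
Proof. exact: reprK. Qed.

Lemma quo_mulA : associative quo_mul.
Proof.
move=> a b c; rewrite -[a]quo_classK -[b]quo_classK -[c]quo_classK.
by rewrite !quo_classM mulgA.
Qed.
Lemma quo_mul1 : left_id quo_one quo_mul.
Proof. by move=> a; rewrite -[a]quo_classK quo_classM mul1g. Qed.
Lemma quo_1mul : right_id quo_one quo_mul.
Proof. by move=> a; rewrite -[a]quo_classK quo_classM mulg1. Qed.
Lemma quo_mulV : left_inverse quo_one quo_inv quo_mul.
Proof. by move=> a; rewrite -[a]quo_classK quo_classV quo_classM mulVg. Qed.
Lemma quo_Vmul : right_inverse quo_one quo_inv quo_mul.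
Proof. by move=> a; rewrite -[a]quo_classK quo_classV quo_classM mulgV. Qed.

HB.instance Definition _ := isGroup.Build quotient_group
  quo_mulA quo_mul1 quo_1mul quo_mulV quo_Vmul.

End Quotient.

Section FreeGroup.
Variable I : choiceType.

(* The letter [(i, false)] is the generator i, [(i, true)] its inverse. *)
Definition letter : Type := (I * bool)%type.
HB.instance Definition _ := Choice.on letter.

Definition linv (a : letter) : letter := (a.1, ~~ a.2).

Definition reduced (s : seq letter) : bool :=
  sorted (fun a b => b != linv a) s.

Definition free_cons (a : letter) (s : seq letter) : seq letter :=
  if s is b :: s' then (if b == linv a then s' else a :: s) else [:: a].

(* The elements of the free group are the reduced words. *)
Record free_group := FreeGroup {
  free_word : seq letter;
  free_wordP : reduced free_word }.

HB.instance Definition _ := [isSub for free_word].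
HB.instance Definition _ := [Choice of free_group by <:].

Lemma linvK : involutive linv.
Proof. by case=> i b; rewrite /linv /= negbK. Qed.

Lemma reduced_behead a s : reduced (a :: s) -> reduced s.
Proof. by case: s => //= b s /andP[]. Qed.

Lemma reduced_cons a s : reduced s -> reduced (free_cons a s).
Proof.
case: s => // b s; rewrite /free_cons; case: ifPn => [_|ba red_bs].
  exact: reduced_behead.
by rewrite /reduced /= ba.
Qed.

Lemma reduced_foldr u v : reduced v -> reduced (foldr free_cons v u).
Proof. by move=> rv; elim: u => //= a u /(reduced_cons a). Qed.

Lemma free_consK a s : reduced s -> free_cons (linv a) (free_cons a s) = s.
Proof.
case: s => [|b s]; rewrite /free_cons; first by rewrite linvK eqxx.
case: eqVneq => [-> {b}|_ _]; last by rewrite linvK eqxx.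
by case: s => [|c s] //= /andP[/negPf ->].
Qed.

Lemma foldr_free_cons a u s : reduced s -> reduced u ->
  foldr free_cons s (free_cons a u) = free_cons a (foldr free_cons s u).
Proof.
move=> rs; case: u => // b u ru; rewrite [free_cons a (b :: u)]/free_cons.
case: eqVneq => // ->.
by have := free_consK (linv a) (reduced_foldr u rs); rewrite linvK /=.
Qed.

Definition free_mul (u v : free_group) : free_group :=
  FreeGroup (reduced_foldr (free_word u) (free_wordP v)).

Definition free_one : free_group := @FreeGroup [::] isT.

Lemma reduced_inv s : reduced s -> reduced (rev (map linv s)).
Proof.
rewrite /reduced rev_sorted sorted_map; apply: sub_sorted => a b /=.
by rewrite linvK eq_sym (can2_eq linvK linvK).
Qed.

Definition free_inv (u : free_group) : free_group :=
  FreeGroup (reduced_inv (free_wordP u)).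

Definition free_gen (i : I) : free_group := @FreeGroup [:: (i, false)] isT.

Lemma foldr_free_id s : reduced s -> foldr free_cons [::] s = s.
Proof.
elim: s => //= a s IH ras; rewrite IH ?(reduced_behead ras) //.
by case: s ras {IH} => //= b s /andP[/negPf ->].
Qed.

Lemma free_mulA : associative free_mul.
Proof.
move=> u v w; apply: val_inj => /=.
case: u v w => [u ru] [v rv] [w rw] /=.
elim: u {ru} => //= a u ->.
by rewrite foldr_free_cons // reduced_foldr.
Qed.

Lemma free_mul1 : left_id free_one free_mul.
Proof. by move=> u; apply: val_inj. Qed.

Lemma free_1mul : right_id free_one free_mul.
Proof. by move=> [u ru]; apply: val_inj => /=; exact: foldr_free_id. Qed.

Lemma free_mulV : left_inverse free_one free_inv free_mul.
Proof.
move=> [u ru]; apply: val_inj => /=.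
elim: u ru => //= a u IH ru; rewrite rev_cons -cats1 foldr_cat /=.
rewrite linvK eqxx; apply: IH; exact: reduced_behead ru.
Qed.

Lemma free_invK : involutive free_inv.
Proof.
move=> [u ru]; apply: val_inj => /=.
by rewrite map_rev revK -map_comp -[RHS]map_id; apply: eq_map => a /=; rewrite linvK.
Qed.

Lemma free_Vmul : right_inverse free_one free_inv free_mul.
Proof. by move=> u; rewrite -{1}(free_invK u) free_mulV. Qed.

HB.instance Definition _ := isGroup.Build free_group
  free_mulA free_mul1 free_1mul free_mulV free_Vmul.

End FreeGroup.

Definition presented (I : choiceType) (rels : set (free_group I)) : groupType :=
  quotient_group (NormalSubgroup (normal_closure_normal rels)).

Section Unitriangular.
Local Open Scope ring_scope.
Variable n : nat.

Definition unitriangular (A : 'M[int]_n) : bool :=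
  [forall i : 'I_n, forall j : 'I_n, (j <= i)%N ==> (A i j == (i == j)%:R)].

Record UT := MkUT { ut_mx :> 'M[int]_n; utP : unitriangular ut_mx }.
HB.instance Definition _ := [isSub for ut_mx].
HB.instance Definition _ := [Choice of UT by <:].

Lemma unitriangularP (A : 'M[int]_n) :
  reflect (forall i j : 'I_n, (j <= i)%N -> A i j = (i == j)%:R) (unitriangular A).
Proof.
apply: (iffP forallP) => [h i j ji|h i].
  by have /forallP/(_ j)/implyP/(_ ji)/eqP := h i.
by apply/forallP => j; apply/implyP => /h ->.
Qed.

Lemma unitriangular1 : unitriangular 1%:M.
Proof. by apply/unitriangularP => i j _; rewrite mxE. Qed.

Lemma unitriangularM A B :
  unitriangular A -> unitriangular B -> unitriangular (A *m B).
Proof.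
move=> /unitriangularP uA /unitriangularP uB; apply/unitriangularP => i j ji.
rewrite mxE (bigD1 i) //= uA // eqxx mul1r uB // big1 ?addr0 // => k ki.
have [ik|ik] := leqP k i; first by rewrite uA // eq_sym (negPf ki) mul0r.
rewrite uB; last exact/ltnW/(leq_ltn_trans ji).
by rewrite -val_eqE /= gtn_eqF ?mulr0 // (leq_ltn_trans ji).
Qed.

Lemma unitriangular_unit A : unitriangular A -> A \in unitmx.
Proof.
move=> /unitriangularP uA; rewrite unitmxE -det_tr det_trig.
  by rewrite big1 ?unitr1 // => i _; rewrite mxE uA // eqxx.
apply/is_trig_mxP => i j ij; rewrite mxE uA; last exact: ltnW.
by rewrite -val_eqE /= gtn_eqF.
Qed.

Lemma unitriangularV A : unitriangular A -> unitriangular (invmx A).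
Proof.
move=> uA; have AV := mulmxV (unitriangular_unit uA).
move/unitriangularP: uA => uA; apply/unitriangularP.
suff h m : forall i j : 'I_n, (n - i <= m)%N -> (j <= i)%N ->
    invmx A i j = (i == j)%:R by move=> i j; exact: (h n _ _ (leq_subr _ _)).
elim: m => [|m IH] i j; first by rewrite leqn0 subn_eq0 leqNgt ltn_ord.
move=> nim ji; have := congr1 (fun M : 'M[int]_n => M i j) AV.
rewrite !mxE (bigD1 i) //= uA // eqxx mul1r big1 ?addr0 // => k ki.
have [ik|ik] := leqP k i; first by rewrite uA // eq_sym (negPf ki) mul0r.
rewrite IH; last exact/ltnW/(leq_ltn_trans ji).
  by rewrite -val_eqE /= gtn_eqF ?mulr0 // (leq_ltn_trans ji).
by rewrite -ltnS (leq_trans _ nim) // ltn_sub2l.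
Qed.

Definition ut_one := MkUT unitriangular1.
Definition ut_mul (A B : UT) := MkUT (unitriangularM (utP A) (utP B)).
Definition ut_inv (A : UT) := MkUT (unitriangularV (utP A)).

Lemma ut_mulA : associative ut_mul.
Proof. by move=> A B C; apply: val_inj; exact: mulmxA. Qed.
Lemma ut_mul1 : left_id ut_one ut_mul.
Proof. by move=> A; apply: val_inj; exact: mul1mx. Qed.
Lemma ut_1mul : right_id ut_one ut_mul.
Proof. by move=> A; apply: val_inj; exact: mulmx1. Qed.
Lemma ut_mulV : left_inverse ut_one ut_inv ut_mul.
Proof.
by move=> A; apply: val_inj; apply: mulVmx; exact/unitriangular_unit/utP.
Qed.
Lemma ut_Vmul : right_inverse ut_one ut_inv ut_mul.
Proof.
by move=> A; apply: val_inj; apply: mulmxV; exact/unitriangular_unit/utP.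
Qed.

HB.instance Definition _ :=
  isGroup.Build UT ut_mulA ut_mul1 ut_1mul ut_mulV ut_Vmul.

End Unitriangular.

Section Heisenberg.
Local Open Scope group_scope.
Variable n : nat.

Definition heis_index : choiceType := ('I_n + 'I_n + unit)%type.

Definition heis_x (i : 'I_n) : free_group heis_index := free_gen (inl (inl i)).
Definition heis_y (i : 'I_n) : free_group heis_index := free_gen (inl (inr i)).
Definition heis_z : free_group heis_index := free_gen (inr tt).

Inductive heis_rel : set (free_group heis_index) :=
| heis_zx i : heis_rel [~ heis_z, heis_x i]
| heis_zy i : heis_rel [~ heis_z, heis_y i]
| heis_xy i : heis_rel ([~ heis_x i, heis_y i] * heis_z^-1)
| heis_xx (i j : 'I_n) : i != j -> heis_rel [~ heis_x i, heis_x j]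
| heis_yy (i j : 'I_n) : i != j -> heis_rel [~ heis_y i, heis_y j]
| heis_xy' (i j : 'I_n) : i != j -> heis_rel [~ heis_x i, heis_y j].

Definition Heisenberg : groupType := presented heis_rel.

End Heisenberg.

Definition free_nilpotent2 (n : nat) : groupType :=
  quotient_group
    (NormalSubgroup (@lower_central_normal (free_group 'I_n) 3)).

Section RealTime.
Local Open Scope ring_scope.

Variant move := MoveLeft | Stay | MoveRight.

Definition shift (m : move) : int :=
  match m with MoveLeft => -1 | Stay => 0 | MoveRight => 1 end.

(* [None] is the blank symbol.  The read-once input tape is the input word
   itself; [rt_tapes] counts the other tapes. *)
Record rt_machine (A : finType) := RTMachine {
  rt_state : finType;
  rt_tapes : nat;
  rt_symbol : finType;
  rt_start : rt_state;
  rt_accepting : pred rt_state;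
  rt_delta : rt_state -> A -> {ffun 'I_rt_tapes -> option rt_symbol} ->
             rt_state * {ffun 'I_rt_tapes -> option rt_symbol * move} }.

Variables (A : finType) (T : rt_machine A).

Record rt_config := RTConfig {
  cfg_state : rt_state T;
  cfg_tape : 'I_(rt_tapes T) -> int -> option (rt_symbol T);
  cfg_head : 'I_(rt_tapes T) -> int }.

Definition rt_init : rt_config :=
  RTConfig (rt_start T) (fun _ _ => None) (fun _ => 0).

Definition rt_step (c : rt_config) (a : A) : rt_config :=
  let r := rt_delta (cfg_state c) a [ffun i => cfg_tape c i (cfg_head c i)] in
  RTConfig r.1
    (fun i p => if p == cfg_head c i then (r.2 i).1 else cfg_tape c i p)
    (fun i => cfg_head c i + shift (r.2 i).2).

Definition rt_accepts (w : seq A) : bool :=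
  rt_accepting (cfg_state (foldl rt_step rt_init w)).

End RealTime.

Definition real_time_language (A : finType) (L : set (seq A)) : Prop :=
  exists T : rt_machine A, L = [set w | rt_accepts T w].

Section Words.
Local Open Scope group_scope.
Variables (G : groupType) (X : {fset G}).

Definition inverse_closed_generating : Prop :=
  (forall x, x \in X -> x^-1 \in X) /\ generated [set` X] = [set: G].

Definition word_eval (w : seq X) : G := \prod_(x <- w) fsval x.

Lemma geodesic_length_ex (w : seq X) :
  exists n, `[< exists2 v : seq X, word_eval v = word_eval w & size v = n >].
Proof. by exists (size w); apply/asboolP; exists w. Qed.

Definition geodesic_length (w : seq X) : nat := ex_minn (geodesic_length_ex w).

Definition is_length_function (L : set (seq X)) (f : nat -> nat) : Prop :=
  forall n,
    (exists w, [/\ L w, (geodesic_length w <= n)%N & size w = f n]) /\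
    (forall w, L w -> (geodesic_length w <= n)%N -> (size w <= f n)%N).

End Words.

Section Combings.
Local Open Scope ring_scope.
Variables (R : realType) (G : groupType) (X : {fset G}).

(* [OnEdge g x s] with 0 <= s <= 1 is the point at distance s from g along the
   edge labelled x from g to gx. *)
Variant cayley_point := Vertex of G | OnEdge of G & X & R.

(* [joined p q r]: there is a path of length r from p to q. *)
Inductive joined : cayley_point -> cayley_point -> R -> Prop :=
| joined_edge g x (s s' : R) : 0 <= s <= 1 -> 0 <= s' <= 1 ->
    joined (OnEdge g x s) (OnEdge g x s') `|s - s'|
| joined_vertex g : joined (Vertex g) (Vertex g) 0
| joined_source g x : joined (Vertex g) (OnEdge g x 0) 0
| joined_target (g : G) (x : X) : joined (Vertex (g * fsval x)%g) (OnEdge g x 1) 0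
| joined_sym p q r : joined p q r -> joined q p r
| joined_trans p q u r r' :
    joined p q r -> joined q u r' -> joined p u (r + r').

Definition cayley_dist (p q : cayley_point) : R := inf [set r | joined p q r].

(* The path from 1 labelled by w, for t >= 0; it is only used for such t. *)
Definition word_path (w : seq X) (t : R) : cayley_point :=
  let i := Num.truncn t in
  if drop i w is x :: _ then OnEdge (word_eval (take i w)) x (t - i%:R)
  else Vertex (word_eval w).

(* [0 <= h t] makes explicit that w(h(t)) has to be defined. *)
Definition fellow_travel_via (h : R -> R) (K : R) (v w : seq X) : Prop :=
  [/\ forall t : R, derivable h t 1,
      h @` `[0, (size v)%:R + 1] = `[0, (size w)%:R + 1]%classic,
      {in `[0, (size v)%:R + 1] &, {homo h : s t / s < t}} &
      forall t : R, 0 < t ->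
        0 <= h t /\ cayley_dist (word_path v t) (word_path w (h t)) <= K].

Definition async_fellow_travel (K : R) (v w : seq X) : Prop :=
  exists h, fellow_travel_via h K v w.

Definition bounded_async_fellow_travel (K M : R) (v w : seq X) : Prop :=
  exists h, fellow_travel_via h K v w /\ (forall t : R, M^-1 <= derive1 h t <= M).

Definition represents_all (L : set (seq X)) : Prop :=
  forall g, exists2 w, L w & word_eval w = g.

Definition combing_pair (L : set (seq X)) (v w : seq X) : Prop :=
  [/\ L v, L w & exists2 x : G, x \in X \/ x = 1%g &
                                word_eval w = (word_eval v * x)%g].

Definition async_combing (L : set (seq X)) : Prop :=
  represents_all L /\
  exists K : R, forall v w, combing_pair L v w -> async_fellow_travel K v w.

Definition bounded_async_combing (L : set (seq X)) : Prop :=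
  represents_all L /\
  exists K M : R, 0 < M /\
    forall v w, combing_pair L v w -> bounded_async_fellow_travel K M v w.

Definition real_time_combing (L : set (seq X)) : Prop :=
  async_combing L /\ real_time_language L.

End Combings.

Definition bounded_by_polynomial (R : realType) (f : nat -> nat) (d : nat) : Prop :=
  exists p : {poly R}, size p = d.+1 /\
    (forall n, ((f n)%:R <= p.[n%:R])%R).

Definition has_bounded_real_time_combing_of_degree (R : realType) (G : groupType) (d : nat) : Prop :=
  exists (X : {fset G}) (L : set (seq X)),
    [/\ inverse_closed_generating X,
        real_time_combing R L,
        bounded_async_combing R L &
        exists2 f, is_length_function L f & bounded_by_polynomial R f d].

(* Main.v *)
(* Each of the groups is a product A_0 ... A_k of free abelian subgroups with
   unique coordinates, on which the earlier factors act unipotently on the later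
   ones.  In a free abelian group, an element is reached along a nearly straight
   line of 2^J blocks, one for each increment of a binary counter; the cells of
   the counter also hold the digits of the direction of the line and of an
   accumulated rounding error, and the letters of a block are emitted while the
   head of a Turing machine runs to the end of the carry and back.  A real-time
   machine with one such tape for each factor therefore recognizes the language
   of the concatenated lines.  Increments have constant amortized cost, so the
   length of a word is linear in the coordinates, which are bounded by a
   polynomial in the geodesic length.

   Multiplication by a letter of A_j adds to the j-th coordinate and moves the
   letter across the later factors, where the action maps the line to v onto the
   line to its image, at bounded distance.  The numbers of blocks of the two
   lines then differ by a bounded power of 2, say 2^r, and block n of the shorter
   line travels along the blocks 2^r n, ..., 2^r (n + 1) - 1 of the longer one:
   their sizes are comparable because a block is long exactly when its index plus
   one is divisible by a high power of 2. *)
Require Import Defs.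
From HB Require Import structures.
From mathcomp Require Import all_boot all_order all_algebra.
From mathcomp Require Import finmap.
From mathcomp Require Import all_classical all_reals all_analysis.
From mathcomp Require Import zify ring lra.
Import Order.TTheory GRing.Theory Num.Theory.
Import numFieldNormedType.Exports.

Set Implicit Arguments.
Unset Strict Implicit.
Unset Printing Implicit Defensive.

(** * Relative speed functions *)

(** The obstacle is that a machine reading each letter once does not know the end of a line in
    advance. The direction is therefore written in base 4, with odd digits between -3 and 3 in every
    live coordinate, and a digit is revealed only when the counter grows a new cell: the letter read
    at that moment is the digit itself. Odd digits are nonzero, so the line of a later factor starts
    with a nontrivial letter, whereas a finished line can only go on with a trivial one; this tells
    where one factor ends and the next begins.

    A line stops only when the counter is a power of 2, and if it has more than one block, its first
    digit is 3 or -3 in some live coordinate. The slope there is at least 1/2 in absolute value, so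
    the endpoint determines the number of blocks up to a constant factor. Two lines are compared
    through their straightness and this number, never digit by digit.

    Uniqueness of coordinates in the Heisenberg and free nilpotent groups cannot be read off their
    definition as quotients; it comes from a homomorphism to an explicit central extension. *)

Section RelativeSpeed.
Local Open Scope ring_scope.
Local Open Scope classical_set_scope.
Variable R : realType.
Implicit Types (x y s t l : R).

(** A Taylor remainder: the derivative [2 * |x|] is Lipschitz with constant 2. *)
Lemma mul_abs_remainder x y :
  `|(x + y) * `|x + y| - x * `|x| - 2 * `|x| * y| <= y ^+ 2.
Proof.
rewrite ler_norml.
have [hx|hx] := lerP 0 x; have [hxy|hxy] := lerP 0 (x + y);
  rewrite ?(ger0_norm hx) ?(ltr0_norm hx) ?(ger0_norm hxy) ?(ltr0_norm hxy);
  apply/andP; split; nra.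
Qed.

Lemma is_derive_mul_abs x : is_derive x 1 (fun y => y * `|y|) (2 * `|x|).
Proof.
have lim : (fun h : R => h^-1 *: ((fun y => y * `|y|) (h *: 1 + x) -
    x * `|x|)) @ 0^' --> (2 * `|x| : R).
  apply/cvgrPdist_le => e e0; near=> h.
  have h0 : h != 0 by near: h; exact: nbhs_dnbhs_neq.
  have he : `|h| <= e.
    near: h; apply: nbhs_dnbhs; apply/nbhs_normP; exists e => //= h /=.
    by rewrite /ball_ /= sub0r normrN => /ltW.
  apply: le_trans he; rewrite -[h *: 1]/(h * 1) mulr1 -[_ *: _]/(h^-1 * _).
  rewrite distrC -(@ler_pM2l _ `|h|) ?normr_gt0 //.
  rewrite -normrM.
  have -> : h * (h^-1 * ((h + x) * `|h + x| - x * `|x|) - 2 * `|x|) =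
    (x + h) * `|x + h| - x * `|x| - 2 * `|x| * h by rewrite (addrC h); field.
  by rewrite -normrM -expr2 (ger0_norm (sqr_ge0 h)); exact: mul_abs_remainder.
apply: DeriveDef; first by apply/cvg_ex; exists (2 * `|x|).
exact: cvg_lim.
Unshelve. all: by end_near.
Qed.

(** The triangle of height 1 over [0, 1], written without case distinction. Its area is 1/2, whence
    the factor 2 in [speed_bump']. *)
Definition hat s : R := `|s| + `|s - 1| - 2 * `|s - 2^-1|.

(* The functions [x * |x|] with derivative [2 * |x|] combine to a differentiable
   step from 0 to 1 with derivative [2 * hat]. *)
Definition smoothstep s : R :=
  s * `|s| + (s - 1) * `|s - 1| - 2 * ((s - 2^-1) * `|s - 2^-1|) + 2^-1.

Lemma hat_itv s : 0 <= hat s <= 1.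
Proof.
rewrite /hat; have [h0|h0] := lerP 0 s; have [h1|h1] := lerP 0 (s - 1);
 have [h2|h2] := lerP 0 (s - 2^-1);
 rewrite ?(ger0_norm h0) ?(ltr0_norm h0) ?(ger0_norm h1) ?(ltr0_norm h1)
  ?(ger0_norm h2) ?(ltr0_norm h2); lra.
Qed.

Lemma hat_out s : (s <= 0) || (1 <= s) -> hat s = 0.
Proof.
rewrite /hat => /orP[]h.
  by rewrite !ler0_norm; lra.
by rewrite !ger0_norm; lra.
Qed.

Lemma smoothstep_le0 s : s <= 0 -> smoothstep s = 0.
Proof. by rewrite /smoothstep => h; rewrite !ler0_norm; lra. Qed.

Lemma smoothstep_ge1 s : 1 <= s -> smoothstep s = 1.
Proof. by rewrite /smoothstep => h; rewrite !ger0_norm; lra. Qed.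

Lemma is_derive_smoothstep s : is_derive s 1 smoothstep (2 * hat s).
Proof.
have sh c : is_derive s 1 (fun x => (x - c) * `|x - c|) (2 * `|s - c|).
  have := @is_derive1_comp R (fun y => y * `|y|) (fun x => x - c) s _ _
    (is_derive_mul_abs _)
    (@is_deriveB _ _ _ id (cst c) s 1 _ _ (is_derive_id _ _) (is_derive_cst _ _ _)).
  by rewrite subr0 mulr1.
have h0 := is_derive_mul_abs s.
have -> : smoothstep = (fun y : R => y * `|y|) + (fun x : R => (x - 1) * `|x - 1|) -
    (2 : R) \*: (fun x : R => (x - 2^-1) * `|x - 2^-1|) + cst (2^-1 : R).
  by apply/funext.
apply: is_derive_eq.
rewrite /hat -[(2 : R) *: _]/(2 * _); lra.
Qed.

(** A pair [z] holds the lengths of two matched segments. Its bump adds what the base speed [l]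
    misses: the distance [l * z.1] becomes [z.2]. A bump is constant outside its own segment. *)
Fixpoint speed_bump l (zs : seq (nat * nat)) t : R :=
  if zs is z :: r then
    (z.2%:R - l * z.1%:R) * smoothstep (t / z.1%:R) + speed_bump l r (t - z.1%:R)
  else 0.

Fixpoint speed_bump' l (zs : seq (nat * nat)) t : R :=
  if zs is z :: r then
    (z.2%:R / z.1%:R - l) * (2 * hat (t / z.1%:R)) + speed_bump' l r (t - z.1%:R)
  else 0.

Definition rel_speed l (zs : seq (nat * nat)) t : R := l * t + speed_bump l zs t.

(** The mean speed [z.2 / z.1] lies between 1/C and C, so over the base speed 1/C all bumps are
    nonnegative. *)
Definition comparable_sizes (C : nat) (z : nat * nat) : bool :=
  [&& 0 < z.1, z.2 <= C * z.1 & z.1 <= C * z.2]%N.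

Lemma is_derive_speed_bump C l zs t : all (comparable_sizes C) zs ->
  is_derive t 1 (speed_bump l zs) (speed_bump' l zs t).
Proof.
elim: zs t => [|z r IH] t /=; first by move=> _; exact: is_derive_cst.
case/andP=> /and3P[z0 _ _] /IH{}IH; have z1 : 0 < z.1%:R :> R by rewrite ltr0n.
have d1 : is_derive t 1 (fun x : R => x / z.1%:R) (z.1%:R^-1).
  have -> : (fun x : R => x / z.1%:R) = (z.1%:R^-1 : R) \*: id.
    by apply/funext => x /=; rewrite mulrC.
  apply: is_derive_eq; exact: mulr1.
have d2 := @is_derive1_comp R smoothstep _ t _ _ (is_derive_smoothstep _) d1.
have d3 := @is_derive1_comp R (speed_bump l r) (fun x => x - z.1%:R) t _ _ (IH _)
   (@is_deriveB _ _ _ id (cst (z.1%:R : R)) t 1 _ _ (is_derive_id _ _) (is_derive_cst _ _ _)).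
have -> : (fun x => (z.2%:R - l * z.1%:R) * smoothstep (x / z.1%:R) +
    speed_bump l r (x - z.1%:R)) = (z.2%:R - l * z.1%:R) \*: (smoothstep \o
    (fun x : R => x / z.1%:R)) + (speed_bump l r \o (fun x => x - z.1%:R)).
  by apply/funext.
apply: is_derive_eq.
rewrite subr0 mulr1; congr (_ + _); rewrite -[_ *: _]/(_ * _).
by field; rewrite gt_eqF.
Qed.

Section Bounds.
Variables (C : nat) (C0 : (0 < C)%N).
Let l : R := C%:R^-1.
Let C_gt0 : 0 < C%:R :> R. Proof. by rewrite ltr0n. Qed.
Let l_gt0 : 0 < l. Proof. by rewrite invr_gt0. Qed.

Lemma size_ratio_itv z : comparable_sizes C z -> 0 <= z.2%:R / z.1%:R - l <= C%:R.
Proof.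
case/and3P=> z0 h1 h2; have z1 : 0 < z.1%:R :> R by rewrite ltr0n.
rewrite subr_ge0 ler_pdivlMr // mulrC ler_pdivrMr // -natrM ler_nat mulnC h2 /=.
rewrite lerBlDl ler_pdivrMr // (@le_trans _ _ (C%:R * z.1%:R)) //.
  by rewrite -natrM ler_nat.
by rewrite ler_pM2r // lerDr ltW.
Qed.

Lemma speed_bump_le0 zs t : t <= 0 -> speed_bump l zs t = 0.
Proof.
elim: zs t => //= z r IH t t0; rewrite IH; last by rewrite subr_le0 (le_trans t0).
by rewrite smoothstep_le0 ?mulr0 ?addr0 // mulr_le0_ge0 // invr_ge0.
Qed.

Lemma speed_bump'_le0 zs t : t <= 0 -> speed_bump' l zs t = 0.
Proof.
elim: zs t => //= z r IH t t0; rewrite IH; last by rewrite subr_le0 (le_trans t0).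
by rewrite hat_out ?mulr0 ?addr0 // mulr_le0_ge0 // invr_ge0.
Qed.

(** At most one bump is active at any time, so the bound does not depend on the number of
    segments. *)
Lemma speed_bump'_itv zs t : all (comparable_sizes C) zs ->
  0 <= speed_bump' l zs t <= 2 * C%:R.
Proof.
elim: zs t => [|z r IH] t /=; first by rewrite lexx mulr_ge0 // ltW.
case/andP=> cz /(IH (t - z.1%:R))/andP[b1 b2].
have := size_ratio_itv cz; case/and3P: cz => z0 _ _.
have z1 : 0 < z.1%:R :> R by rewrite ltr0n.
move=> /andP[s1 s2].
have [tp|tp] := leP t z.1%:R.
  rewrite speed_bump'_le0 ?subr_le0 // addr0.
  have /andP[] := hat_itv (t / z.1%:R); nra.
rewrite hat_out; last by rewrite ler_pdivlMr // mul1r (ltW tp) orbT.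
by rewrite !mulr0 add0r b1.
Qed.

Lemma rel_speed_cons z r t : comparable_sizes C z -> z.1%:R <= t ->
  rel_speed l (z :: r) t = z.2%:R + rel_speed l r (t - z.1%:R).
Proof.
case/and3P=> z0 _ _ zt; have z1 : 0 < z.1%:R :> R by rewrite ltr0n.
by rewrite /rel_speed /= smoothstep_ge1 ?ler_pdivlMr ?mul1r //; lra.
Qed.

Lemma is_derive_rel_speed zs t : all (comparable_sizes C) zs ->
  is_derive t 1 (rel_speed l zs) (l + speed_bump' l zs t).
Proof.
move=> /(is_derive_speed_bump l t) d.
have -> : rel_speed l zs = l \*: id + speed_bump l zs by apply/funext.
apply: is_derive_eq; congr (_ + _); exact: mulr1.
Qed.

Lemma rel_speed_derive_itv zs t : all (comparable_sizes C) zs ->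
  (3 * C%:R)^-1 <= derive1 (rel_speed l zs) t <= 3 * C%:R.
Proof.
move=> h; rewrite derive1E.
have /@derive_val -> := is_derive_rel_speed t h.
have C1 : 1 <= C%:R :> R by rewrite ler1n.
have /andP[b1 b2] := speed_bump'_itv t h.
have l1 : l <= 1 by rewrite invf_le1.
apply/andP; split; last by lra.
rewrite -[leLHS]addr0 lerD // lef_pV2 ?posrE; lra.
Qed.

Lemma rel_speed_lt zs : all (comparable_sizes C) zs ->
  {homo rel_speed l zs : s t / s < t}.
Proof.
move=> h s t st; have dr x := is_derive_rel_speed x h.
have [|c _] := MVT st (fun x _ => dr x).
  apply: derivable_within_continuous => x _; exact: (@ex_derive _ _ _ _ _ _ _ (dr x)).
move=> e; rewrite -subr_gt0 e mulr_gt0 ?subr_gt0 //.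
by rewrite ltr_pwDl //; case/andP: (speed_bump'_itv c h).
Qed.

Lemma rel_speed0 zs : rel_speed l zs 0 = 0.
Proof. by rewrite /rel_speed speed_bump_le0 // mulr0 addr0. Qed.

Lemma rel_speed_ge0 zs t : all (comparable_sizes C) zs -> 0 <= t ->
  0 <= rel_speed l zs t.
Proof.
by move=> /rel_speed_lt/ltW_homo mono /mono; rewrite rel_speed0.
Qed.

Lemma rel_speed_sum zs : all (comparable_sizes C) zs ->
  rel_speed l zs (sumn (map fst zs))%:R = (sumn (map snd zs))%:R.
Proof.
elim: zs => [|z r IH] /=; first by rewrite rel_speed0.
case/andP=> cz cr; rewrite !natrD rel_speed_cons // ?lerDl //.
have -> : z.1%:R + (sumn (map fst r))%:R - z.1%:R = (sumn (map fst r))%:R :> R.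
  by lra.
by rewrite IH.
Qed.

Lemma rel_speed_onto zs : all (comparable_sizes C) zs ->
  rel_speed l zs @` `[0, (sumn (map fst zs))%:R] =
  `[0, (sumn (map snd zs))%:R]%classic.
Proof.
move=> h; set T := _%:R; have T0 : 0 <= T by exact: ler0n.
have mono := rel_speed_lt h; have mono_le := ltW_homo mono.
apply/seteqP; split=> [y /= [x]|y /=]; rewrite !in_itv /=.
  by move=> /andP[x0 xT] <-; rewrite -(rel_speed0 zs) -rel_speed_sum // !mono_le.
move=> yT; have [||c ct <-] := @IVT R (rel_speed l zs) 0 T y T0.
- apply: derivable_within_continuous => x _.
  exact: (@ex_derive _ _ _ _ _ _ _ (is_derive_rel_speed x h)).
- rewrite rel_speed0 rel_speed_sum // min_l ?max_r //; exact: ler0n.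
- by exists c.
Qed.

End Bounds.

End RelativeSpeed.

(** * Fellow travelling of segmented words *)

Section FellowTravelling.
Local Open Scope group_scope.
Variables (G : groupType) (X : {fset G}).
Implicit Types (g : G) (u v w : seq X) (zs : seq (seq X * seq X)) (K C : nat).

Lemma word_eval_nil : word_eval ([::] : seq X) = 1.
Proof. exact: big_nil. Qed.

Lemma word_eval_cons (x : X) w : word_eval (x :: w) = fsval x * word_eval w.
Proof. exact: big_cons. Qed.

Lemma word_eval_cat u v : word_eval (u ++ v) = word_eval u * word_eval v.
Proof. exact: big_cat. Qed.

Definition ball K g : Prop := exists2 u : seq X, (size u <= K)%N & word_eval u = g.

Lemma ball1 K : ball K 1.
Proof. by exists [::]; rewrite ?word_eval_nil. Qed.

Lemma ballM K K' g g' : ball K g -> ball K' g' -> ball (K + K') (g * g').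
Proof.
move=> [u su <-] [u' su' <-]; exists (u ++ u'); last exact: word_eval_cat.
by rewrite size_cat leq_add.
Qed.

Lemma ball_le K K' g : (K <= K')%N -> ball K g -> ball K' g.
Proof. by move=> KK [u su <-]; exists u => //; exact: leq_trans KK. Qed.

Lemma ball_letter (x : X) : ball 1 (fsval x).
Proof. by exists [:: x]; rewrite // word_eval_cons word_eval_nil mulg1. Qed.

Lemma ballV (XV : forall x, x \in X -> x^-1 \in X) K g : ball K g -> ball K g^-1.
Proof.
move=> [u su <-]; elim: u K su => [|x u IH] K /=.
  by rewrite word_eval_nil invg1 => _; exact: ball1.
case: K => // K; rewrite ltnS => /IH b.
rewrite word_eval_cons invgM -addn1; apply: ballM => //.
exact: (ball_letter [` XV _ (fsvalP x)]%fset).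
Qed.

(* [g] is the offset from the endpoint of the first path to that of the second
   before the segments [zs] are appended to them. *)
Fixpoint tracks K C zs g : Prop :=
  if zs is z :: r then
    [/\ comparable_sizes C (size z.1, size z.2),
        forall a b, (a <= size z.1)%N -> (b <= size z.2)%N ->
          ball K ((word_eval (take a z.1))^-1 * g * word_eval (take b z.2)) &
        tracks K C r ((word_eval z.1)^-1 * g * word_eval z.2)]
  else ball K g.

Definition fst_word zs := flatten (map fst zs).
Definition snd_word zs := flatten (map snd zs).
Definition seg_sizes zs := [seq (size z.1, size z.2) | z <- zs].

Lemma tracks_cat K C zs zs' g : tracks K C zs g ->
  tracks K C zs' ((word_eval (fst_word zs))^-1 * g * word_eval (snd_word zs)) ->
  tracks K C (zs ++ zs') g.
Proof.
elim: zs g => [|z r IH] g /=.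
  by rewrite /fst_word /snd_word /= !word_eval_nil invg1 mul1g mulg1.
case=> cz bz tr tz'; split=> //; apply: IH => //.
by move: tz'; rewrite !word_eval_cat invgM !mulgA.
Qed.

Lemma tracks_mono K C K' C' zs g : (K <= K')%N -> (C <= C')%N ->
  tracks K C zs g -> tracks K' C' zs g.
Proof.
move=> KK CC; elim: zs g => [|z r IH] g /=; first exact: ball_le.
case=> /and3P[z0 z1 z2] bz tr; split; last exact: IH.
  apply/and3P; split=> //=.
    by apply: leq_trans z1 _; rewrite leq_mul2r CC orbT.
  by apply: leq_trans z2 _; rewrite leq_mul2r CC orbT.
by move=> a b az bz'; apply: ball_le KK _; exact: bz.
Qed.

Lemma tracks_swap (XV : forall x, x \in X -> x^-1 \in X) K C zs g :
  tracks K C zs g -> tracks K C [seq (z.2, z.1) | z <- zs] g^-1.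
Proof.
elim: zs g => [|z r IH] g /=; first exact: ballV.
case=> /and3P[/= z0 z1 z2] bz /IH tr; split.
- rewrite /comparable_sizes /= z1 z2 !andbT.
  by move: z2; case: (size z.2) => //; rewrite muln0 leqNgt z0.
- move=> a b az bz'; have := ballV XV (bz b a bz' az).
  by rewrite !invgM invgK !mulgA.
- by move: tr; rewrite !invgM invgK !mulgA.
Qed.

Lemma fst_word_swap zs : fst_word [seq (z.2, z.1) | z <- zs] = snd_word zs.
Proof. by rewrite /fst_word -map_comp. Qed.

Lemma snd_word_swap zs : snd_word [seq (z.2, z.1) | z <- zs] = fst_word zs.
Proof. by rewrite /snd_word -map_comp. Qed.

Lemma tracks_sizes K C zs g : tracks K C zs g ->
  all (comparable_sizes C) (seg_sizes zs).
Proof. by elim: zs g => //= z r IH g [-> _ /IH]. Qed.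

Variable R : realType.
Local Open Scope ring_scope.

(** [tracks] controls all pairs of positions inside two matched segments, so it suffices that the
    speed function sends ends of segments to ends of segments. The added pair (1, 1) is the unit of
    time after the end of both words. *)
Lemma tracks_at K C zs g (t : R) : (0 < C)%N -> tracks K C zs g -> 0 <= t ->
  ball K ((word_eval (take (Num.truncn t) (fst_word zs)))^-1 * g *
    word_eval (take (Num.truncn
      (rel_speed C%:R^-1 (seg_sizes zs ++ [:: (1, 1)%N]) t)) (snd_word zs)))%g.
Proof.
move=> C0; have C1 : comparable_sizes C (1, 1)%N.
  by rewrite /comparable_sizes /= muln1 C0.
elim: zs g t => [|z r IH] g t.
  by rewrite /= !word_eval_nil invg1 mul1g mulg1.
move=> /[dup] /tracks_sizes cs [cz bz tr] t0.
have {}cs : all (comparable_sizes C) (seg_sizes (z :: r) ++ [:: (1, 1)%N]).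
  by rewrite all_cat cs /= C1.
have [tp|tp] := ltP t (size z.1)%:R.
  set h := rel_speed _ _ t.
  have h0 : 0 <= h := rel_speed_ge0 C0 cs t0.
  have hq : h < (size z.2)%:R.
    have -> : (size z.2)%:R =
        rel_speed C%:R^-1 (seg_sizes (z :: r) ++ [:: (1, 1)%N]) (size z.1)%:R :> R.
      by rewrite rel_speed_cons // subrr rel_speed0 // addr0.
    exact: rel_speed_lt.
  have it : (Num.truncn t < size z.1)%N by rewrite truncn_lt_nat.
  have ih : (Num.truncn h < size z.2)%N by rewrite truncn_lt_nat.
  by rewrite /fst_word /snd_word /= !take_cat it ih; apply: bz; exact: ltnW.
have tr0 : 0 <= t - (size z.1)%:R by lra.
rewrite rel_speed_cons //.
have TD (n : nat) (x : R) : 0 <= x -> Num.truncn (n%:R + x) = (n + Num.truncn x)%N.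
  by move=> x0; rewrite truncnD ?natrK.
have tE : Num.truncn t = (size z.1 + Num.truncn (t - (size z.1)%:R))%N.
  by rewrite -TD // addrC subrK.
rewrite TD.
- rewrite tE /fst_word /snd_word /= !take_cat !ltnNge !leq_addr /=.
  rewrite !addKn !word_eval_cat invgM.
  by have := IH _ _ tr tr0; rewrite !mulgA.
- by apply: (rel_speed_ge0 C0) => //; case/andP: cs.
Qed.

Lemma joined_ge0 p q (r : R) : @joined R G X p q r -> 0 <= r.
Proof. by elim=> // *; exact: addr_ge0. Qed.

Lemma cayley_dist_le p q (r : R) : @joined R G X p q r -> cayley_dist p q <= r.
Proof.
move=> pq; apply: ge_inf => //.
by exists 0 => s /= /joined_ge0.
Qed.

Lemma joined_word g u : @joined R G X (Vertex _ _ g) (Vertex _ _ (g * word_eval u)%g) (size u)%:R.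
Proof.
elim: u g => [|x u IH] g /=; first by rewrite word_eval_nil mulg1; constructor.
rewrite word_eval_cons mulgA.
have -> : (size u).+1%:R = 0 + (`|0 - 1| + (0 + (size u)%:R)) :> R.
  by rewrite sub0r normrN1 !add0r nat1r.
apply: joined_trans (joined_source _ _ _) _.
apply: joined_trans (joined_edge _ _ _ _) _; rewrite ?lexx ?ler01 //.
by apply: joined_trans (IH _); apply: joined_sym; exact: joined_target.
Qed.

Lemma word_path_near w (t : R) : 0 <= t -> exists2 r : R, r <= 1 &
  joined (word_path w t) (Vertex _ _ (word_eval (take (Num.truncn t) w))) r.
Proof.
move=> t0; rewrite /word_path; set i := Num.truncn t.
have /andP[i1 i2] := truncn_itv t0.
have t01 : 0 <= t - i%:R <= 1.
  by rewrite subr_ge0 i1 lerBlDl -natr1 in i2 *; apply/ltW.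
case E: (drop i w) => [|x s].
  exists 0; first exact: ler01.
  by rewrite take_oversize; [exact: joined_vertex|rewrite -subn_eq0 -size_drop E].
exists (`|t - i%:R - 0| + 0).
  by rewrite addr0 subr0 ger0_norm; case/andP: t01.
apply: joined_trans; first by apply: joined_edge => //; rewrite lexx ler01.
exact/joined_sym/joined_source.
Qed.

(** The summand 2 pays for moving from two points inside edges to the sources of these edges. The
    bound 3C covers a base speed of at most 1 and a bump of at most 2C. *)
Lemma tracks_fellow_travel K C zs : (0 < C)%N -> tracks K C zs 1%g ->
  bounded_async_fellow_travel (K%:R + 2 : R) (3 * C%:R)
    (fst_word zs) (snd_word zs).
Proof.
move=> C0 tr; set l := seg_sizes zs ++ [:: (1, 1)%N].
have cl : all (comparable_sizes C) l.
  by rewrite all_cat (tracks_sizes tr) /= /comparable_sizes /= muln1 C0.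
have s1 : (size (fst_word zs))%:R + 1 = (sumn (map fst l))%:R :> R.
  rewrite map_cat sumn_cat /= addn0 natrD; congr (_%:R + _).
  by rewrite size_flatten /shape -!map_comp.
have s2 : (size (snd_word zs))%:R + 1 = (sumn (map snd l))%:R :> R.
  rewrite map_cat sumn_cat /= addn0 natrD; congr (_%:R + _).
  by rewrite size_flatten /shape -!map_comp.
exists (rel_speed C%:R^-1 l); split; last by move=> t; exact: rel_speed_derive_itv.
split.
- by move=> t; have [] := is_derive_rel_speed t cl.
- by rewrite s1 s2; exact: rel_speed_onto.
- by move=> s t _ _; exact: rel_speed_lt.
move=> t t0; have h0 : 0 <= rel_speed C%:R^-1 l t.
  exact: (rel_speed_ge0 C0 cl (ltW t0)).
split=> //.
have [r r1 j1] := word_path_near (fst_word zs) (ltW t0).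
have [r' r1' j2] := word_path_near (snd_word zs) h0.
have [u su eu] := tracks_at C0 tr (ltW t0).
have j3 := joined_word (word_eval (take (Num.truncn t) (fst_word zs))) u.
rewrite eu mulg1 mulVKg in j3.
apply: (@le_trans _ _ (r + ((size u)%:R + r'))).
  by apply: cayley_dist_le; apply: joined_trans j1 (joined_trans j3 (joined_sym j2)).
have : (size u)%:R <= K%:R :> R by rewrite ler_nat.
lra.
Qed.

End FellowTravelling.

(** * Straight lines drawn by a binary counter *)

Section Counter.
Local Open Scope ring_scope.
Variable m : nat.
Implicit Types (v P : 'rV[int]_m).

(* Vectors with entries in [-5, 5] as a finite type. *)
Definition box : finType := {ffun 'I_m -> 'I_11}.

Definition bvec (b : box) : 'rV[int]_m := \row_j ((b j)%:Z - 5).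
Definition tobox v : box := [ffun j => inord `|(v 0 j + 5)%R|%N].

Definition small (r : nat) v : bool := [forall j, (`|(v 0 j)%R| <= r)%N].

Lemma smallP r v : reflect (forall j, (`|(v 0 j)%R| <= r)%N) (small r v).
Proof. exact: forallP. Qed.

Lemma bvec_small b : small 5 (bvec b).
Proof. by apply/smallP => j; rewrite mxE; have := ltn_ord (b j); lia. Qed.

Lemma toboxK v : small 5 v -> bvec (tobox v) = v.
Proof.
move=> /smallP sv; apply/rowP => j; rewrite mxE ffunE inordK; have := sv j; lia.
Qed.

(** Division with floor, so that the remainder [par] is 0 or 1 for negative entries too. *)
Definition half v : 'rV[int]_m := map_mx (fun z => (z %/ 2)%Z) v.
Definition par v : 'rV[int]_m := map_mx (fun z => (z %% 2)%Z) v.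

(* [mxE] leaves ring operations in a form that [lia] does not recognize. *)
Lemma rowD v P j : (v + P) 0 j = v 0 j + P 0 j. Proof. by rewrite mxE. Qed.
Lemma rowN v j : (- v) 0 j = - v 0 j. Proof. by rewrite mxE. Qed.
Lemma rowZ (a : int) v j : (a *: v) 0 j = a * v 0 j. Proof. by rewrite mxE. Qed.
Lemma row0 j : (0 : 'rV[int]_m) 0 j = 0. Proof. by rewrite mxE. Qed.
Lemma row_half v j : half v 0 j = (v 0%R j %/ 2)%Z. Proof. by rewrite mxE. Qed.
Lemma row_par v j : par v 0 j = (v 0%R j %% 2)%Z. Proof. by rewrite mxE. Qed.
Definition rowE := (rowD, rowN, rowZ, row0, row_half, row_par).

(** Adding [k] to the offset [c] of a cell: the quotient by 2 is the carry handed to the lower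
    cells, the remainder [addp] stays. *)
Definition addh (c k : box) : box := tobox (half (bvec c + bvec k)).
Definition addp (c k : box) : box := tobox (par (bvec c + bvec k)).

Lemma addhE c k : bvec (addh c k) = half (bvec c + bvec k).
Proof.
apply: toboxK; apply/smallP => j; rewrite !rowE.
have /smallP/(_ j) := bvec_small c; have /smallP/(_ j) := bvec_small k; lia.
Qed.

Lemma par_small v : small 5 (par v).
Proof. by apply/smallP => j; rewrite !rowE; lia. Qed.

Lemma addpE c k : bvec (addp c k) = par (bvec c + bvec k).
Proof. exact/toboxK/par_small. Qed.

Lemma bvec_tobox0 : bvec (tobox 0) = 0.
Proof. by apply: toboxK; apply/smallP => j; rewrite rowE. Qed.

(* Bit of the counter, digit of the direction, bit of the accumulated offset. *)
Definition cell : finType := (bool * box * box)%type.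
Definition ovec (u : option box) : 'rV[int]_m := oapp bvec 0 u.

Variable live : pred 'I_m.

Definition masked v : bool := [forall j, live j || (v 0 j == 0)].

Lemma maskedP v : reflect (forall j, ~~ live j -> v 0 j = 0) (masked v).
Proof.
apply: (iffP forallP) => h j; first by have := h j => /orP[->|/eqP].
by case: (boolP (live j)) => //= /h ->.
Qed.

(** Base 4 digits of a slope in [-1, 1]: the four intervals (d + [-1, 1]) / 4 tile it. *)
Definition digit (d : box) : bool :=
  [forall j, if live j then (bvec d 0 j \in [:: -3; -1; 1; 3])
             else bvec d 0 j == 0].
Definition big_digit (d : box) : bool :=
  [exists j, live j && (`|(bvec d 0 j)%R| == 3)%N].

Lemma digit_itv d j : digit d -> -3 <= bvec d 0 j <= 3.
Proof.
move/forallP/(_ j); case: ifP => _; last by move/eqP->.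
by rewrite !inE => /or4P[] /eqP ->.
Qed.

Lemma digit_masked d : digit d -> masked (bvec d).
Proof.
move=> /forallP h; apply/maskedP => j nj.
by have := h j; rewrite (negPf nj) => /eqP.
Qed.

(* [excursion s e s' k u]: incrementing the counter turns the tape [s] into
   [s'], while the path moves through the steps [e]; [k] is the carry out of
   the accumulated offset and [u] the digit of a newly created cell. *)
Inductive excursion :
  seq cell -> seq 'rV[int]_m -> seq cell -> box -> option box -> Prop :=
| excursion_new d : digit d ->
    excursion [::] [:: bvec d] [:: (true, d, addp (tobox 0) d)]
      (addh (tobox 0) d) (Some d)
| excursion_zero d c s :
    excursion ((false, d, c) :: s) [:: 0] ((true, d, addp c d) :: s)
      (addh c d) None
| excursion_one d c s e s' k u : excursion s e s' k u ->
    excursion ((true, d, c) :: s) (0 :: rcons e 0)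
      ((false, d, addp c k) :: s') (addh c k) u.

(** Tested before every increment. The empty tape has no digit yet; from the second block on, the
    first digit must be big. *)
Definition good_start (s : seq cell) : bool :=
  if s is x :: _ then big_digit x.1.2 else true.

(* [line a s bs]: the blocks [bs] complete a line from the tape [s]; it may only
   end when [a] holds, that is, when the counter is a power of 2. *)
Inductive line : bool -> seq cell -> seq (seq 'rV[int]_m) -> Prop :=
| line_nil s : line true s [::]
| line_cons a s e s' k u bs : good_start s -> excursion s e s' k u ->
    line (isSome u) s' bs -> line a s (rcons e (bvec k - ovec u) :: bs).

(* [counted s n P]: the counter on the tape [s] shows [n] and the path has come
   to [P]; the tapes of the higher digits are counters for half of [n] and [P]. *)
Fixpoint counted (s : seq cell) (n : nat) P : Prop :=
  if s is (b, d, c) :: s' then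
    exists n' P', [/\ counted s' n' P', n = (b + n'.*2)%N,
      (n' + b)%N%:Z *: bvec d + P' = P + P + bvec c &
      forall j, 0 <= bvec c 0 j <= 1]
  else n = 0%N /\ P = 0.

Definition digits (s : seq cell) := [seq x.1.2 | x <- s].

Lemma excursion_digits s e s' k u : excursion s e s' k u ->
  all digit (digits s) -> all digit (digits s').
Proof.
elim=> {s e s' k u} [d dd|d c s|d c s e s' k u _ IH] //=; first by rewrite dd.
by case/andP=> -> /IH.
Qed.

Lemma counted_masked s n P : counted s n P -> all digit (digits s) -> masked P.
Proof.
elim: s n P => [|[[b d] c] s IH] n P /=.
  by case=> _ -> _; apply/maskedP => j _; rewrite rowE.
case=> n' [P' [rs _ e cj]] /andP[dd ds]; have /maskedP mP := IH _ _ rs ds.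
have /maskedP md := digit_masked dd.
apply/maskedP => j nj; have := congr1 (fun w : 'rV_m => w 0 j) e.
have := cj j; move: (bvec c) (bvec d) md => C D md.
by rewrite !rowE mP // md // mulr0; lia.
Qed.

(** In [counted], P is the floor of half of (n' + b) d + P'. Raising the lowest bit adds d to this
    numerator; clearing it adds the carry out of the higher cells. *)
Lemma excursion_counted s e s' k u n P : excursion s e s' k u ->
  counted s n P -> counted s' n.+1 (P + bvec k).
Proof.
move=> ex; elim: ex n P => {s e s' k u} [d dd|d c s|d c s e s' k u _ IH] n P /=.
- case=> -> ->; exists 0%N, 0; split=> //.
    rewrite addhE addpE; move: (bvec d) => D; rewrite bvec_tobox0.
    by apply/rowP => j; rewrite !rowE /=; lia.
  by move=> j; rewrite addpE; move: (bvec _ + _) => D; rewrite !rowE; lia.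
- case=> n' [P' [rs -> e cj]]; exists n', P'; split=> //.
    rewrite addhE addpE; move: (bvec d) (bvec c) e => D C e.
    apply/rowP => j; have := congr1 (fun w : 'rV_m => w 0 j) e.
    by rewrite !rowE /= addn0 addn1 intS mulrDl mul1r; lia.
  by move=> j; rewrite addpE; move: (bvec _ + _) => D; rewrite !rowE; lia.
- case=> n' [P' [/IH rs -> ee cj]]; exists n'.+1, (P' + bvec k); split=> //.
  + rewrite addhE addpE; move: (bvec d) (bvec c) (bvec k) ee => D C K ee.
    apply/rowP => j; have := congr1 (fun w : 'rV_m => w 0 j) ee.
    by rewrite !rowE /= addn0 addn1; lia.
  + by move=> j; rewrite addpE; move: (bvec _ + _) => D; rewrite !rowE; lia.
Qed.

(** A carry is the floor of (c + x) / 2 with c in {0, 1} and x either a digit, at most 3, or a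
    higher carry, at most 2, in absolute value. *)
Lemma excursion_carry s e s' k u n P : excursion s e s' k u ->
  counted s n P -> all digit (digits s) -> small 2 (bvec k).
Proof.
move=> ex; elim: ex n P => {s e s' k u} [d dd|d c s|d c s e s' k u _ IH] n P /=.
- move=> _ _; apply/smallP => j; rewrite addhE; have := digit_itv j dd.
  by move: (bvec d) => D; rewrite bvec_tobox0 !rowE; lia.
- case=> n' [P' [rs _ e cj]] /andP[dd ds]; apply/smallP => j.
  rewrite addhE; have := digit_itv j dd; have := cj j.
  by move: (bvec d) (bvec c) => D C; rewrite !rowE; lia.
- case=> n' [P' [rs _ e' cj]] /andP[dd ds]; apply/smallP => j.
  have /smallP/(_ j) := IH _ _ rs ds; have := cj j; rewrite addhE.
  by move: (bvec k) (bvec c) => D C; rewrite !rowE; lia.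
Qed.

(** The head crosses the trailing ones of n, reads one more cell and returns; the number of trailing
    ones is the 2-adic valuation of n + 1. *)
Lemma excursion_size s e s' k u n P : excursion s e s' k u ->
  counted s n P -> size e = (logn 2 n.+1).*2.+1.
Proof.
move=> ex; elim: ex n P => {s e s' k u} [d dd|d c s|d c s e s' k u _ IH] n P /=.
- by case=> -> _; rewrite logn1.
- case=> n' [P' [_ -> _ _]]; by rewrite add0n lognE dvdn2 /= odd_double.
- case=> n' [P' [/IH rs -> _ _]]; rewrite size_rcons rs.
  have -> : (true + n'.*2).+1 = (n'.+1 * 2)%N by lia.
  by rewrite lognM // [logn 2 2]lognE /= addn1 doubleS.
Qed.

(** A new cell is reached only across a tape of ones. *)
Lemma excursion_pow2 s e s' k u n P : excursion s e s' k u ->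
  counted s n P -> isSome u -> exists J, n.+1 = (2 ^ J)%N.
Proof.
move=> ex; elim: ex n P => {s e s' k u} [d dd|d c s|d c s e s' k u _ IH] n P //=.
- by case=> -> _ _; exists 0%N.
- case=> n' [P' [/IH rs -> _ _]] /rs[J e']; exists J.+1.
  by rewrite expnS -e'; lia.
Qed.

Lemma excursion_newdigit s e s' k d : excursion s e s' k (Some d) -> digit d.
Proof.
move ou : (Some d) => u ex; elim: ex ou => // d' dd [->] //.
Qed.

Lemma excursion_sum s e s' k u : excursion s e s' k u ->
  \sum_(x <- e) x = ovec u.
Proof.
elim=> {s e s' k u} [d dd|d c s|d c s e s' k u _ IH]; rewrite ?big_seq1 //.
by rewrite big_cons -cats1 big_cat big_seq1 IH /= add0r addr0.
Qed.

Lemma excursion_prefix s e s' k u a : excursion s e s' k u ->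
  \sum_(x <- take a e) x = 0 \/ \sum_(x <- take a e) x = ovec u.
Proof.
move=> ex; elim: ex a => {s e s' k u} [d dd|d c s|d c s e s' k u ex IH] [|a];
  rewrite ?big_nil; try by left.
- by right; rewrite /= big_seq1.
- by left; rewrite /= big_seq1.
- rewrite /= big_cons add0r -cats1 take_cat; case: ifP => _; first exact: IH.
  right; rewrite big_cat /= (excursion_sum ex).
  by case: (a - size e)%N => [|n]; rewrite /= ?big_seq1 ?big_nil addr0.
Qed.

(* [slope s j al]: the [j]-th coordinate of the direction determined by the
   digits of [s] and some continuation of them is [al]. *)
Fixpoint slope (s : seq cell) (j : 'I_m) (al : rat) : Prop :=
  if s is x :: s' then
    exists2 be, slope s' j be & 4 * al = (bvec x.1.2 0 j)%:~R + be
  else `|al| <= 1.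

Lemma slope_ex s j : exists al, slope s j al.
Proof.
elim: s => [|x s [be h]] /=; first by exists 0; rewrite normr0.
by exists (((bvec x.1.2 0 j)%:~R + be) / 4), be => //; field.
Qed.

Lemma slope_itv s j al : all digit (digits s) -> slope s j al -> `|al| <= 1.
Proof.
elim: s al => //= x s IH al /andP[dx ds] [be /(IH _ ds)].
have := digit_itv j dx; move: (bvec _ 0 j) => d; rewrite -!(ler_int rat).
rewrite !ler_norml; lra.
Qed.

Lemma slope_excursion s e s' k u j al : excursion s e s' k u ->
  slope s' j al -> slope s j al.
Proof.
move=> ex; elim: ex al => {s e s' k u} [d dd|d c s|d c s e s' k u _ IH] al //=.
  (* [slope] looks only at the digits, so any bit and offset may fill the cell here. *)
  move=> sl; have /slope_itv : all digit (digits [:: (true, d, d)]) by rewrite /= dd.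
  by apply; exact: sl.
by case=> be /IH hb ee; exists be.
Qed.

Lemma slope_big b d c s j al : all digit (digits ((b, d, c) :: s)) ->
  slope ((b, d, c) :: s) j al -> (`|(bvec d 0 j)%R| = 3)%N -> 2^-1 <= `|al|.
Proof.
move=> /= /andP[_ ds] [be /(slope_itv ds)]; rewrite ler_norml => hb ee d3.
have [dE|dE] : bvec d 0 j = 3 \/ bvec d 0 j = -3 by lia.
  by rewrite dE in ee; rewrite ger0_norm; lra.
by rewrite dE in ee; rewrite ler0_norm; lra.
Qed.

(* Each level halves the error accumulated below it and adds at most 3/2. *)
Lemma counted_straight s n P j al : counted s n P -> all digit (digits s) ->
  slope s j al -> `|(P 0 j)%:~R - al * n%:R| <= 3.
Proof.
elim: s n P al => [|[[b d] c] s IH] n P al /=.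
  by case=> -> -> _ _; rewrite row0 mulr0 subr0 normr0.
case=> n' [P' [rs -> e cj]] /andP[dd ds] [be sb ee].
have := IH _ _ _ rs ds sb; have := slope_itv ds sb; have := digit_itv j dd.
have := cj j; have := congr1 (fun w : 'rV_m => w 0 j) e.
clear IH rs e ds sb dd cj.
rewrite !rowE; move: (bvec d 0 j) (bvec c 0 j) (P 0 j) (P' 0 j) ee => D C p p' ee.
move=> /(congr1 (fun z : int => z%:~R : rat)); rewrite !rmorphD rmorphM /=.
rewrite -!(ler_int rat) -!pmulrn -muln2 !natrD natrM !ler_norml.
case: b => /=; move: (D%:~R) (C%:~R) (p%:~R) (p'%:~R) (n'%:R) ee
  => {D C p p'} D C p p' N ee; nra.
Qed.

Lemma small_le r r' v : (r <= r')%N -> small r v -> small r' v.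
Proof. by move=> rr /smallP h; apply/smallP => j; exact: leq_trans rr. Qed.

Lemma small0 r : small r 0.
Proof. by apply/smallP => j; rewrite row0. Qed.

Lemma masked0 : masked 0.
Proof. by apply/maskedP => j _; rewrite row0. Qed.

Lemma maskedD v P : masked v -> masked P -> masked (v + P).
Proof.
by move=> /maskedP h /maskedP h'; apply/maskedP => j nj; rewrite rowD h // h'.
Qed.

Lemma maskedN v : masked v -> masked (- v).
Proof. by move=> /maskedP h; apply/maskedP => j nj; rewrite rowN h // oppr0. Qed.

Lemma ovec_digit s e s' k u : excursion s e s' k u ->
  small 3 (ovec u) /\ masked (ovec u).
Proof.
case: u => [d|] ex; last by split; [exact: small0|exact: masked0].
have dd := excursion_newdigit ex; split; last exact: digit_masked.
by apply/smallP => j /=; have := digit_itv j dd; lia.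
Qed.

Lemma excursion_letters s e s' k u x : excursion s e s' k u -> x \in e ->
  x = 0 \/ x = ovec u.
Proof.
elim=> {s e s' k u} [d dd|d c s|d c s e s' k u _ IH]; rewrite ?inE.
- by move=> /eqP; right.
- by move=> /eqP; left.
- by rewrite mem_rcons inE => /or3P[/eqP|/eqP|/IH //]; left.
Qed.

Section Block.
Variables (s : seq cell) (e : seq 'rV[int]_m) (s' : seq cell) (k : box)
  (u : option box) (n : nat) (P : 'rV[int]_m).
Hypotheses (ex : excursion s e s' k u) (rs : counted s n P)
  (ds : all digit (digits s)).
Let block := rcons e (bvec k - ovec u).

Lemma carry_masked : masked (bvec k).
Proof.
have m1 := counted_masked rs ds.
have m2 := counted_masked (excursion_counted ex rs) (excursion_digits ex ds).
by rewrite -(addKr P (bvec k)); apply: maskedD => //; exact: maskedN.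
Qed.

Lemma block_size : size block = (logn 2 n.+1).*2.+2.
Proof. by rewrite size_rcons (excursion_size ex rs). Qed.

Lemma block_sum : \sum_(x <- block) x = bvec k.
Proof. by rewrite /block -cats1 big_cat big_seq1 /= (excursion_sum ex) addrC subrK. Qed.

Lemma block_prefix b :
  small 5 (\sum_(x <- take b block) x) && masked (\sum_(x <- take b block) x).
Proof.
have [su mu] := ovec_digit ex.
have [lb|lb] := leqP (size block) b.
  rewrite take_oversize // block_sum carry_masked andbT.
  exact: small_le (excursion_carry ex rs ds).
have {lb} : (b <= size e)%N by rewrite size_rcons in lb.
move=> lb; rewrite /block -cats1 takel_cat //.
case: (excursion_prefix b ex) => ->; first by rewrite small0 masked0.
by rewrite mu andbT; exact: small_le su.
Qed.

(** The last letter of a block is a carry minus a digit, hence bounded by 2 + 3 = 5; this fixes the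
    size of [box]. *)
Lemma block_letters : all (fun x => small 5 x && masked x) block.
Proof.
have [/smallP su mu] := ovec_digit ex; have mk := carry_masked.
have /smallP sk := excursion_carry ex rs ds.
apply/allP => x; rewrite mem_rcons inE => /orP[/eqP->|].
  apply/andP; split; last by apply: maskedD => //; exact: maskedN.
  by apply/smallP => j; rewrite rowD rowN; have := su j; have := sk j; lia.
case/(excursion_letters ex) => ->; first by rewrite small0 masked0.
by rewrite mu andbT; apply: (@small_le 3) => //; exact/smallP.
Qed.

End Block.

Definition line_pos (bs : seq (seq 'rV[int]_m)) n : 'rV[int]_m :=
  \sum_(x <- flatten (take n bs)) x.

Lemma line_pos_cons b bs n :
  line_pos (b :: bs) n.+1 = \sum_(x <- b) x + line_pos bs n.
Proof. by rewrite /line_pos /= big_cat. Qed.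

Lemma line_pos0 bs : line_pos bs 0 = 0.
Proof. by rewrite /line_pos take0 big_nil. Qed.

Lemma line_blocks a s bs n P : line a s bs -> counted s n P ->
  all digit (digits s) -> forall i, (i < size bs)%N ->
  size (nth [::] bs i) = (logn 2 (n + i).+1).*2.+2 /\
  forall b, small 5 (\sum_(x <- take b (nth [::] bs i)) x) &&
            masked (\sum_(x <- take b (nth [::] bs i)) x).
Proof.
move=> ln; elim: ln n P => {a s bs} // a s e s' k u bs gs ex ln IH n P rs ds.
case=> [|i] /= hi.
  by rewrite addn0 (block_size ex rs); split=> // b; exact: block_prefix ex rs ds b.
rewrite -addSnnS; apply: IH (excursion_counted ex rs) (excursion_digits ex ds) _ hi.
Qed.

Lemma line_letters a s bs n P : line a s bs -> counted s n P ->
  all digit (digits s) -> all (fun x => small 5 x && masked x) (flatten bs).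
Proof.
move=> ln; elim: ln n P => {a s bs} // a s e s' k u bs gs ex ln IH n P rs ds.
rewrite /= all_cat (block_letters ex rs ds).
exact: IH (excursion_counted ex rs) (excursion_digits ex ds).
Qed.

Lemma line_end a s bs n P : line a s bs -> counted s n P -> bs != [::] ->
  exists J, (n + size bs = 2 ^ J)%N.
Proof.
move=> ln; elim: ln n P => {a s bs} // a s e s' k u bs gs ex ln IH n P rs _.
have rs' := excursion_counted ex rs.
case: bs ln IH => [|b bs] ln IH; last first.
  by have [//|J eJ] := IH _ _ rs'; exists J; rewrite -eJ /= addSnnS.
rewrite addn1; apply: (excursion_pow2 ex rs).
by move ou : (isSome u) ln => a' ln; inversion ln.
Qed.

(** One slope serves the whole line: it is chosen for the final tape and pulled back along the
    increments, since each new digit only narrows the range of slopes. *)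
Lemma line_straight a s bs n P j : line a s bs -> counted s n P ->
  all digit (digits s) -> exists2 al, slope s j al & forall i,
    (i <= size bs)%N -> `|((P + line_pos bs i) 0 j)%:~R - al * (n + i)%:R| <= 3.
Proof.
move=> ln; elim: ln n P => {a s bs} [s|a s e s' k u bs gs ex ln IH] n P rs ds.
  have [al sl] := slope_ex s j; exists al => // -[] // _.
  by rewrite line_pos0 addr0 addn0; exact: counted_straight rs ds sl.
have [al sl' h] := IH _ _ (excursion_counted ex rs) (excursion_digits ex ds).
have sl := slope_excursion ex sl'; exists al => // -[_|i hi].
  by rewrite line_pos0 addr0 addn0; exact: counted_straight rs ds sl.
by rewrite line_pos_cons (block_sum ex) addrA -addSnnS; exact: h.
Qed.

(* The first digit of a line with at least two increments is big, so a line of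
   [N] increments ends at a vector of size comparable to [N]. *)
Lemma line_word bs : line false [::] bs -> let N := size bs in
  [/\ exists J, N = (2 ^ J)%N,
     forall n j, (n <= N)%N -> `|(line_pos bs n *~ N - line_pos bs N *~ n) 0 j| <= 6 * N%:Z,
     forall j, `|line_pos bs N 0 j| <= N%:Z + 3 &
     N = 1%N \/ exists2 j, live j & N%:Z <= 2 * `|line_pos bs N 0 j| + 6].
Proof.
move=> ln N; have r0 : counted [::] 0 0 by [].
have bs0 : bs != [::] by case: bs ln @N => // ln; inversion ln.
have [J JE] := line_end ln r0 bs0; rewrite add0n in JE.
have N0 : (0 < N)%N by rewrite lt0n size_eq0.
have Nq : 1 <= N%:R :> rat by rewrite ler1n.
split; first by exists J.
(* Both positions are within 3 of the slope line; eliminating the slope costs 3 N + 3 n, at most 6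
   N. *)
- move=> n j nN; have [al _ h] := line_straight j ln r0 isT.
  have := h n nN; have := h N (leqnn _); rewrite !add0r !add0n.
  rewrite rowD rowN -!scaler_int !rowZ !intz.
  rewrite -(ler_int rat) intr_norm !rmorphD !rmorphN !rmorphM /= -!pmulrn.
  have nq : n%:R <= N%:R :> rat by rewrite ler_nat.
  have nq0 : 0 <= n%:R :> rat by [].
  move: (_%:~R) (_%:~R) N%:R n%:R Nq nq nq0 => p p' N' n' Nq nq nq0.
  rewrite !ler_norml => /andP[h1 h2] /andP[h3 h4].
  by apply/andP; split; nra.
- move=> j; have [al /= sl h] := line_straight j ln r0 isT.
  have := h N (leqnn _); rewrite !add0r !add0n.
  rewrite -(ler_int rat) intr_norm !rmorphD /= -!pmulrn.
  move: sl; rewrite !ler_norml; move: (_%:~R) N%:R Nq => p N' Nq; nra.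
- inversion ln as [|a s e s' k u bs' gs ex ln' e1 e2 e3]; subst bs.
  case: bs' ln' => [|b bs'] ln' in N ln bs0 JE N0 Nq *; first by left.
  right; inversion ln' as [|a' s1 t1 s1' k1 u1 bs1 gs1 ex1 ln1 f1 f2 f3].
  (* After the first increment the tape is a single cell, and the test before the second increment
     shows that its digit is big. *)
  have [d [c es']] : exists d c, s' = [:: (true, d, c)].
    by inversion ex; eexists; eexists.
  move: gs1; rewrite {1}es' /= => /existsP[j /andP[lj /eqP dj]]; exists j => //.
  have rs' := excursion_counted ex r0.
  have ds' := excursion_digits ex isT.
  have [al sl h] := line_straight j ln' rs' ds'.
  have posE : line_pos (rcons e (bvec k - ovec u) :: b :: bs') N =
      0 + bvec k + line_pos (b :: bs') (size bs').+1.
    by rewrite /N /= line_pos_cons (block_sum ex) add0r.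
  rewrite f3; have := h _ (leqnn _); rewrite -posE add1n -/N.
  rewrite es' in ds' sl; have := slope_itv ds' sl; have := slope_big ds' sl dj.
  rewrite -(ler_int rat) rmorphD rmorphM /= intr_norm -!pmulrn.
  move: (_%:~R) N%:R Nq => p N' Nq; rewrite !ler_norml.
  have [a0|a0] := lerP 0 al; have [p0|p0] := lerP 0 p;
    rewrite ?(ger0_norm a0) ?(ltr0_norm a0) ?(ger0_norm p0) ?(ltr0_norm p0); nra.
Qed.

End Counter.

(** * Every vector is the end of a line *)

Section CounterExistence.
Local Open Scope ring_scope.
Variables (m : nat) (live : pred 'I_m).
Implicit Types (v P : 'rV[int]_m) (ds : seq (box m)).

(** The position after n increments in closed form. The lowest bit is raised once for each odd
    number up to n, that is, n - n./2 times. *)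
Fixpoint offset ds (n : nat) : 'rV[int]_m :=
  if ds is d :: ds' then half ((n - n./2)%N%:Z *: bvec d + offset ds' n./2) else 0.

Fixpoint tape_at ds (n : nat) : seq (cell m) :=
  if ds is d :: ds' then
    if n == 0%N then [::] else
    (odd n, d, tobox (par ((n - n./2)%N%:Z *: bvec d + offset ds' n./2)))
      :: tape_at ds' n./2
  else [::].

Lemma offset0 ds : offset ds 0 = 0.
Proof.
elim: ds => //= d ds ->; apply/rowP => j; rewrite !rowE; lia.
Qed.

Lemma tape_at0 ds : tape_at ds 0 = [::]. Proof. by case: ds. Qed.

Lemma excursion_tape_at ds n : all (digit live) ds -> (n.+1 < 2 ^ size ds)%N ->
  exists e k u, [/\ excursion live (tape_at ds n) e (tape_at ds n.+1) k u,
    bvec k = offset ds n.+1 - offset ds n &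
    forall J, n.+1 = (2 ^ J)%N -> isSome u].
Proof.
elim: ds n => [|d ds IH] n /= dds nlt; first by move: nlt; rewrite ltnS ltn0.
case/andP: dds => dd dds.
have parK v : bvec (tobox (par v)) = par v by exact/toboxK/par_small.
have [->|n0] := posnP n.
  exists [:: bvec d], (addh (tobox 0) d), (Some d); split=> //.
    rewrite /= tape_at0 offset0 addr0 scale1r.
    have -> : tobox (par (bvec d)) = addp (tobox 0) d.
      by rewrite /addp bvec_tobox0 add0r.
    exact: excursion_new.
  rewrite addhE bvec_tobox0 offset0 /= addr0 add0r.
  by apply/rowP => j; move: (bvec d) => D; rewrite !rowE; lia.
rewrite /=; have [n' [nE|nE]] : exists n', n = n'.*2 \/ n = n'.*2.+1.
  by exists n./2; have := odd_double_half n; case: (odd n) => /= ee; [right|left]; rewrite -[LHS]ee.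
- have h1 : uphalf n = n' by rewrite nE uphalf_double.
  have h2 : n./2 = n' by rewrite nE doubleK.
  have h3 : odd n = false by rewrite nE odd_double.
  rewrite h1 h2 h3; set T := _ *: bvec d + offset ds n'.
  have sE : (n.+1 - n')%N%:Z *: bvec d + offset ds n' = T + bvec d.
    rewrite /T; have -> : (n.+1 - n')%N = (n - n').+1 by lia.
    by rewrite intS scalerDl scale1r -addrA addrC.
  exists [:: 0], (addh (tobox (par T)) d), None; split.
  + rewrite sE.
    have -> : tobox (par (T + bvec d)) = addp (tobox (par T)) d.
      rewrite /addp parK; congr tobox; apply/rowP => j.
      by move: T (bvec d) {sE} => T D; rewrite !rowE; lia.
    exact: excursion_zero.
  + rewrite addhE parK sE; apply/rowP => j.
    by move: T (bvec d) {sE} => T D; rewrite !rowE; lia.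
  + move=> [|J]; first by rewrite expn0; lia.
    by rewrite expnS => ee; have := congr1 odd ee; rewrite oddM /= h3.
- have h1 : uphalf n = n'.+1 by rewrite nE /= doubleK.
  have h2 : n./2 = n' by rewrite nE /= uphalf_double.
  have h3 : odd n by rewrite nE /= odd_double.
  rewrite h1 h2 h3 /=.
  have lt' : (n'.+1 < 2 ^ size ds)%N.
    by move: nlt; rewrite expnS nE; move: (2 ^ size ds)%N => X; lia.
  have [e [k [u [ex kE uJ]]]] := IH _ dds lt'.
  have -> : (n - n')%N = n'.+1 by lia.
  have -> : (n.+1 - n'.+1)%N = n'.+1 by lia.
  set T := _ *: bvec d + offset ds n'.
  have sE : n'.+1%:Z *: bvec d + offset ds n'.+1 = T + bvec k.
    by rewrite /T kE -addrA; congr (_ + _); rewrite addrC subrK.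
  exists (0 :: rcons e 0), (addh (tobox (par T)) k), u; split.
  + rewrite sE.
    have -> : tobox (par (T + bvec k)) = addp (tobox (par T)) k.
      rewrite /addp parK; congr tobox; apply/rowP => j.
      by move: T (bvec k) {kE sE} => T D; rewrite !rowE; lia.
    exact: excursion_one.
  + rewrite addhE parK sE; apply/rowP => j.
    by move: T (bvec k) {kE sE} => T D; rewrite !rowE; lia.
  + move=> [|J]; first by rewrite expn0; lia.
    by rewrite expnS => ee; apply: (uJ J); lia.
Qed.

Lemma line_tape_at d ds J a n l : all (digit live) (d :: ds) -> size ds = J ->
  (0 < J)%N ==> big_digit live d -> (n + l = 2 ^ J)%N -> (0 < l)%N || a ->
  exists2 bs, line live a (tape_at (d :: ds) n) bs &
    \sum_(x <- flatten bs) x = offset (d :: ds) (2 ^ J) - offset (d :: ds) n.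
Proof.
move=> dds sJ bigd; elim: l n a => [|l IH] n a nl /= => [ta|_].
  rewrite ta; exists [::]; first exact: line_nil.
  by rewrite -nl addn0 big_nil subrr.
have [|e [k [u [ex kE uJ]]]] := excursion_tape_at dds (n := n).
  by rewrite /= sJ expnS; have := expn_gt0 2 J; lia.
have [||bs ln bsE] := IH n.+1 (isSome u).
- by rewrite addSnnS.
- by case: l nl {IH} => //=; rewrite addn1 => /uJ.
exists (rcons e (bvec k - ovec u) :: bs).
  apply: line_cons ex ln => //=; case: eqP => //= n0.
  case: J {dds IH bsE uJ} sJ bigd nl => [|J] sJ // bigd; rewrite expn0; lia.
rewrite /= big_cat -cats1 big_cat big_seq1 (excursion_sum ex) /= bsE kE.
by rewrite [ovec u + _]addrC subrK addrC addrA subrK.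
Qed.

(** After 2^(J+1) increments the position is half of 2^J d + w, where w is the position of the
    remaining digits after 2^J increments. Solving w = 2 v - 2^J d, the digit d is chosen so that
    the entries of w are again at most 2^J. *)
Lemma digits_ex J v : masked live v -> (forall j, `|v 0 j| <= (2 ^ J)%N%:Z) ->
  exists d ds, [/\ all (digit live) (d :: ds), size ds = J,
    offset (d :: ds) (2 ^ J) = v &
    (0 < J)%N -> forall j, (2 ^ J.-1)%N%:Z < `|v 0 j| -> (`|(bvec d 0 j)%R| = 3)%N].
Proof.
elim: J v => [|J IH] v /maskedP mv sv.
  (* A single increment moves by the floor of d / 2, which is v for the odd digit 2 v + 1. *)
  pose D : 'rV[int]_m := \row_j (if live j then 2 * v 0 j + 1 else 0).
  have DE j : D 0 j = if live j then 2 * v 0 j + 1 else 0 by rewrite mxE.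
  have bd : small 5 D.
    by apply/smallP => j; have := sv j; rewrite DE expn0; case: ifP => _; lia.
  exists (tobox D), [::]; split=> //=.
    rewrite andbT; apply/forallP => j; rewrite toboxK // DE.
    by have := sv j; rewrite expn0; case: (live j) => //; rewrite !inE; lia.
  rewrite toboxK //; apply/rowP => j; rewrite addr0 row_half rowZ DE.
  by case: ifPn => [_|/mv ->]; lia.
pose N : int := (2 ^ J)%N.
pose dd (z : int) : int := if N < z then 3 else if 0 <= z then 1
  else if - N <= z then -1 else -3.
pose D : 'rV[int]_m := \row_j (if live j then dd (v 0 j) else 0).
have DE j : D 0 j = if live j then dd (v 0 j) else 0 by rewrite mxE.
have bd : small 5 D.
  by apply/smallP => j; rewrite DE /dd; do 4 ?case: ifP => _.
have [||e [es [des ses oes _]]] := IH (v + v - N *: D).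
- by apply/maskedP => j nj; rewrite !rowE DE mv // (negPf nj) mulr0.
- move=> j; rewrite !rowE DE; have := sv j; rewrite expnS.
  case: ifPn => [_|/mv ->]; last by rewrite mulr0 -/N /=; lia.
  by rewrite /dd -/N; do 3 ?case: ifP => ?; lia.
exists (tobox D), (e :: es); split.
- rewrite /= in des *; rewrite des andbT; apply/forallP => j; rewrite toboxK // DE.
  by case: (live j) => //; rewrite /dd; do 3 ?case: ifP => ?.
- by rewrite /= ses.
- rewrite -[offset _ _]/(half ((2 ^ J.+1 - (2 ^ J.+1)./2)%N%:Z *: bvec (tobox D)
    + offset (e :: es) (2 ^ J.+1)./2)).
  have -> : ((2 ^ J.+1)./2 = 2 ^ J)%N by rewrite expnS mul2n doubleK.
  have -> : (2 ^ J.+1 - 2 ^ J = 2 ^ J)%N by rewrite expnS mul2n -addnn addnK.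
  rewrite oes toboxK // -/N; apply/rowP => j; rewrite !rowE; lia.
- move=> _ j; rewrite /= toboxK // DE -/N => big.
  case: ifPn => [_|/mv v0]; last by move: big; rewrite v0 /N; lia.
  have N0 : 0 <= N by [].
  by move: big; rewrite /dd; do 3 ?case: ifP => ?; lia.
Qed.

(** J is the least exponent for which 2^J bounds the entries of v. Minimality makes some entry
    larger than 2^(J-1), and therefore the first digit big. *)
Lemma line_ex v : masked live v ->
  exists2 bs, line live false [::] bs & \sum_(x <- flatten bs) x = v.
Proof.
move=> mv; pose M := (\max_j `|(v 0 j)%R|)%N.
have vM j : (`|(v 0 j)%R| <= M)%N by exact: (leq_bigmax j).
pose J := up_log 2 M.
have [|d [ds [dds sJ oE big]]] := @digits_ex J v mv.
  by move=> j; have := vM j; have := @up_logP 2 M isT; rewrite -/J; lia.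
have bigd : (0 < J)%N ==> big_digit live d.
  apply/implyP => J0.
  have M1 : (1 < M)%N by move: J0; rewrite lt0n up_log_eq0 /= -ltnNge.
  have /existsP[j /eqP jM] : [exists j, `|(v 0 j)%R|%N == M].
    apply/contraT; rewrite negb_exists => /forallP nM.
    have : (M <= M.-1)%N.
      apply/bigmax_leqP => j _; have := vM j; have := nM j; lia.
    lia.
  apply/existsP; exists j; have b3 : (2 ^ J.-1 < M)%N.
    by have /andP[] := @up_log_bounds 2 M isT M1.
  rewrite (big J0 j) ?andbT; last by lia.
  by move: mv => /maskedP/(_ j); apply: contraPT => nl /(_ nl) v0; move: jM M1; rewrite v0 => <-.
have [|bs ln bsE] := @line_tape_at d ds J false 0 (2 ^ J) dds sJ bigd (add0n _).
  by rewrite expn_gt0.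
by exists bs; rewrite // bsE oE offset0 subr0.
Qed.

Definition ones (s : seq (cell m)) : nat := count (fun x : cell m => x.1.1) s.

(* Amortized cost of an increment: the number of ones is a potential. *)
Lemma excursion_ones s e s' b u : excursion live s e s' b u ->
  (size e + 1 + 2 * ones s' = 4 + 2 * ones s)%N.
Proof.
elim=> {s e s' b u} [d dd|d c s|d c s e s' b u _ IH]; rewrite /ones /= ?size_rcons;
  rewrite -?/(ones _); lia.
Qed.

Lemma line_total_size a s bs : line live a s bs ->
  (size (flatten bs) <= 4 * size bs + 2 * ones s)%N.
Proof.
elim=> {a s bs} [s|a s e s' b u bs _ /excursion_ones ex _ IH]; first by [].
by rewrite /= size_cat size_rcons; lia.
Qed.

End CounterExistence.

(** * Real-time recognition *)

Section Machine.
Local Open Scope group_scope.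
Variables (G : groupType) (X : {fset G}) (m k : nat).
Variables (phi : nat -> 'rV[int]_m -> G) (live : nat -> pred 'I_m).

(* Before an increment (the flag tells whether the counter was a power of 2),
   moving right, or moving left with a carry and the digit of the new cell. *)
Definition mode : finType := (bool + unit + box m * option (box m))%type.
Notation Start a := (inl (inl a) : mode).
Notation GoRight := (inl (inr tt) : mode).
Notation GoLeft b u := (inr (b, u) : mode).

(** At a blank cell the letter itself supplies the digit; [pick] recovers it when distinct digits
    give distinct letters. *)
Definition new_cell (i : nat) (x : G) : option (mode * option (cell m) * move) :=
  if [pick d | digit (live i) d && (phi i (bvec d) == x)] is Some d then
    Some (GoLeft (addh (tobox 0%R) d) (Some d),
          Some (true, d, addp (tobox 0%R) d), MoveLeft)
  else None.

Definition go_right (y : cell m) (x : G) : option (mode * option (cell m) * move) :=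
  let: (b, d, c) := y in
  if x != 1 then None
  else if b then Some (GoRight, Some (false, d, c), MoveRight)
  else Some (GoLeft (addh c d) None, Some (true, d, addp c d), MoveLeft).

(** The blank at position -1 ends the way back: the letter read there must correct the sum of the
    block to the carry. A blank is refused after [Start true], so this mode reads only trivial
    letters. *)
Definition core (i : nat) (md : mode) (cur : option (cell m)) (x : G) :
    option (mode * option (cell m) * move) :=
  match md, cur with
  | inl (inl a), None => if a then None else new_cell i x
  | inl (inl _), Some y => if big_digit (live i) y.1.2 then go_right y x else None
  | inl (inr _), None => new_cell i x
  | inl (inr _), Some y => go_right y x
  | inr (b, u), Some (bit, d, c) =>
      if x == 1 then Some (GoLeft (addh c b) u, Some (bit, d, addp c b), MoveLeft)
      else None
  | inr (b, u), None =>
      if x == phi i (bvec b - ovec u)%R then Some (Start (isSome u), None, MoveRight)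
      else None
  end.

Definition core_config : Type := (mode * (int -> option (cell m)) * int)%type.

Definition core_step i (c : core_config) (x : G) : option core_config :=
  let: (md, T, p) := c in
  if core i md (T p) x is Some (md', o, mv) then
    Some (md', fun q => if q == p then o else T q, (p + Defs.shift mv)%R)
  else None.

Definition core_run i (c : core_config) (w : seq G) : option core_config :=
  foldl (fun oc x => obind (core_step i ^~ x) oc) (Some c) w.

Lemma core_run_cons i c x w : core_run i c (x :: w) =
  obind (core_run i ^~ w) (core_step i c x).
Proof.
rewrite /core_run /=; case: (core_step i c x) => //=.
by elim: w => //= y w ->.
Qed.

Lemma core_run_cat i c w w' : core_run i c (w ++ w') =
  obind (core_run i ^~ w') (core_run i c w).
Proof.
by elim: w c => //= x w IH c; rewrite !core_run_cons; case: core_step.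
Qed.

Definition tape_of (s : seq (cell m)) (p : int) : option (cell m) :=
  if p is Posz n then onth s n else None.

Lemma tape_at_mid s y s' : tape_of (s ++ y :: s') (size s) = Some y.
Proof. by rewrite /= onth_cat ltnn subnn. Qed.

Lemma tape_upd s y y' s' : (fun q => if q == Posz (size s) then Some y' else
  tape_of (s ++ y :: s') q) = tape_of (s ++ y' :: s').
Proof.
apply/funext => -[q|q] //=; rewrite eqz_nat !onth_cat.
case: ssrnat.ltngtP => // [lt|->]; last by rewrite subnn.
by rewrite -(@prednK (q - size s)) ?subn_gt0.
Qed.

Lemma tape_upd_end s y' : (fun q => if q == Posz (size s) then Some y' else
  tape_of s q) = tape_of (rcons s y').
Proof.
apply/funext => -[q|q] //=; rewrite eqz_nat -cats1 onth_cat.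
case: ssrnat.ltngtP => // [lt|->]; last by rewrite subnn.
by rewrite !onth_default //= ?subn_gt0 // ltnW.
Qed.

Lemma tape_upd_neg s : (fun q : int => if q == (-1)%R then None else tape_of s q) = tape_of s.
Proof. by apply/funext => -[q|[|q]]. Qed.

Variable i : nat.
Hypothesis phi0 : phi i 0%R = 1.

(** Induction on the tape [s] from the head onwards; [s0] holds the cells already passed. *)
Lemma excursion_sound s s0 w a T p :
  core_run i (GoRight, tape_of (s0 ++ s), Posz (size s0)) w = Some (Start a, T, p) ->
  exists e s' b u w', [/\ w = map (phi i) e ++ w', excursion (live i) s e s' b u &
    core_run i (GoLeft b u, tape_of (s0 ++ s'), ((size s0)%:Z - 1)%R) w' =
      Some (Start a, T, p)].
Proof.
elim: s s0 w => [|[[bit d] c] s IH] s0 [|x w] //; rewrite core_run_cons.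
- rewrite cats0 /core_step /= onth_default //= /new_cell.
  case: pickP => [d /andP[dd /eqP <-]|] //=.
  rewrite tape_upd_end => run.
  exists [:: bvec d], [:: (true, d, addp (tobox 0%R) d)], (addh (tobox 0%R) d), (Some d), w.
  by split=> //; [exact: excursion_new|rewrite cats1].
- rewrite /core_step tape_at_mid /=; case: eqP => //= ->; case: bit => /=; last first.
    rewrite tape_upd => run.
    exists [:: 0%R], ((true, d, addp c d) :: s), (addh c d), None, w.
    by split=> //=; [rewrite phi0|exact: excursion_zero].
  rewrite tape_upd -PoszD addn1 -cat_rcons -(size_rcons s0 (false, d, c)) => /IH.
  case=> e [s' [b [u [w' [-> ex]]]]]; rewrite size_rcons cat_rcons.
  case: w' => [|x' w'] //; rewrite core_run_cons /core_step.
  have -> : ((size s0).+1%:Z - 1)%R = Posz (size s0) by lia.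
  rewrite tape_at_mid /=; case: eqP => //= ->; rewrite tape_upd => run.
  exists (0%R :: rcons e 0%R), ((false, d, addp c b) :: s'), (addh c b), u, w'.
  split=> //; last exact: excursion_one.
  by rewrite /= map_rcons phi0 cat_rcons.
Qed.

Lemma line_sound s a w T p :
  core_run i (Start a, tape_of s, 0%R) w = Some (Start true, T, p) ->
  exists2 bs, w = map (phi i) (flatten bs) & line (live i) a s bs.
Proof.
have [n] := ubnP (size w); elim: n => // n IH in s a w *; rewrite ltnS => wn.
case: w wn => [_ [-> _ _]|x w wn run]; first by exists [::] => //; exact: line_nil.
have gs : good_start (live i) s.
  move: run; rewrite core_run_cons /core_step.
  by case: s => //= y s; case: ifP.
have sa : (s == [::]) ==> ~~ a.
  by move: run; rewrite core_run_cons /core_step; case: s {gs} => //=; case: a.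
(* Once the first digit has passed its test, [Start] acts like [GoRight] at position 0. *)
have {}run : core_run i (GoRight, tape_of ([::] ++ s), Posz (size (Nil (cell m))))
    (x :: w) = Some (Start true, T, p).
  rewrite -run !core_run_cons /core_step; congr obind.
  case: s gs sa {run} => [|y s] /= gs; last by rewrite gs.
  by case: a.
have [e [s' [b [u [[|x' w'] [we ex]]]]]] := excursion_sound run => //.
rewrite core_run_cons /core_step /=; case: eqP => //= x'E.
rewrite tape_upd_neg => run'.
have [|bs w'E ln] := IH _ _ _ _ run'.
  by move: (congr1 size we) wn; rewrite size_cat /= => -> ; lia.
exists (rcons e (bvec b - ovec u)%R :: bs); last exact: line_cons ex ln.
by rewrite we /= map_cat map_rcons cat_rcons -w'E x'E.
Qed.

Hypothesis phi_digit_inj : forall d d', digit (live i) d -> digit (live i) d' ->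
  phi i (bvec d) = phi i (bvec d') -> d = d'.

Lemma excursion_run s s0 e s' b u : excursion (live i) s e s' b u ->
  core_run i (GoRight, tape_of (s0 ++ s), Posz (size s0)) (map (phi i) e) =
    Some (GoLeft b u, tape_of (s0 ++ s'), ((size s0)%:Z - 1)%R).
Proof.
move=> ex; elim: ex s0 => {s e s' b u} [d dd|d c s|d c s e s' b u _ IH] s0 /=.
- rewrite core_run_cons cats0 /core_step /= onth_default //= /new_cell.
  case: pickP => [d' /andP[dd' /eqP e]|/(_ d)]; last by rewrite dd eqxx.
  by rewrite (phi_digit_inj dd' dd e) /= tape_upd_end cats1.
- by rewrite core_run_cons /core_step tape_at_mid /= phi0 eqxx /= tape_upd.
- rewrite core_run_cons /core_step tape_at_mid /= phi0 eqxx /= tape_upd.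
  rewrite -PoszD addn1 -cat_rcons -(size_rcons s0 (false, d, c)).
  rewrite map_rcons -[rcons (map _ _) _]cats1 core_run_cat IH /= size_rcons cat_rcons.
  have -> : ((size s0).+1%:Z - 1)%R = Posz (size s0) by lia.
  by rewrite core_run_cons /core_step tape_at_mid /= phi0 eqxx /= tape_upd.
Qed.

Lemma line_run s a bs : line (live i) a s bs -> (s == [::]) ==> ~~ a ->
  exists T p, core_run i (Start a, tape_of s, 0%R) (map (phi i) (flatten bs)) =
    Some (Start true, T, p).
Proof.
elim=> {s a bs} [s _|a s e s' b u bs gs ex _ IH sa]; first by exists (tape_of s), 0%R.
have [|T [p run]] := IH; first by inversion ex.
exists T, p; rewrite -run /= map_cat map_rcons cat_rcons core_run_cat.
have -> : core_run i (Start a, tape_of s, 0%R) (map (phi i) e) =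
  core_run i (GoRight, tape_of ([::] ++ s), Posz (size (Nil (cell m)))) (map (phi i) e).
  have [x [e' ->]] : exists x e', e = x :: e' by inversion ex; eexists; eexists.
  rewrite /= !core_run_cons /core_step; congr obind.
  case: s gs sa {ex} => [|y s] /= gs sa; last by rewrite gs.
  by rewrite (negPf sa).
rewrite (excursion_run [::] ex) /= core_run_cons /core_step /= eqxx /=.
by rewrite tape_upd_neg.
Qed.

End Machine.

(** * One machine for the concatenation of all factors *)

Section CompositeMachine.
Local Open Scope group_scope.
Variables (G : groupType) (X : {fset G}) (m k : nat).
Variables (phi : nat -> 'rV[int]_m -> G) (live : nat -> pred 'I_m).

Notation Start a := (inl (inl a) : mode m).
Notation state := (option ('I_k.+1 * mode m)).

(* An accepting factor hands over to the next one on the first nontrivial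
   letter, which can only announce a new digit. *)
Definition hand_over (i : 'I_k.+1) (md : mode m) (x : G) : bool :=
  [&& md == Start true, x != 1 & (i < k)%N].

Definition counter_delta (st : state) (x : X)
    (tp : {ffun 'I_k.+1 -> option (cell m)}) :
    state * {ffun 'I_k.+1 -> option (cell m) * move} :=
  let stop := (None, [ffun t => (tp t, Stay)]) in
  if st is Some (i, md) then
    let j := if hand_over i md (fsval x) then inord i.+1 else i in
    let md0 := if hand_over i md (fsval x) then Start false else md in
    if core phi live j md0 (tp j) (fsval x) is Some (md', o, mv) then
      (Some (j, md'), [ffun t => if t == j then (o, mv) else (tp t, Stay)])
    else stop
  else stop.

Definition counter_accepting (st : state) : bool :=
  if st is Some (i, md) then (i == k :> nat) && (md == Start true) else false.

Definition counter_machine : rt_machine X :=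
  RTMachine (Some (ord0, Start false)) counter_accepting counter_delta.

Local Notation run := (foldl (@rt_step X counter_machine)).

Definition core_init : core_config m := (Start false, tape_of [::], 0%R).

(** Earlier tapes are never visited again, and later ones are still blank with their heads at 0. *)
Definition simulates (c : rt_config counter_machine) (i : 'I_k.+1)
    (cc : core_config m) : Prop :=
  [/\ cfg_state c = Some (i, cc.1.1), cfg_tape c i = cc.1.2, cfg_head c i = cc.2 &
    forall j : 'I_k.+1, (i < j)%N -> cfg_tape c j = tape_of [::] /\ cfg_head c j = 0%R].

Lemma simulates_step c i cc (x : X) : simulates c i cc ->
  let j := if hand_over i cc.1.1 (fsval x) then inord i.+1 else i in
  let cj := if hand_over i cc.1.1 (fsval x) then core_init else cc in
  if core_step phi live j cj (fsval x) is Some cc' then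
    simulates (rt_step c x) j cc'
  else cfg_state (rt_step c x) = None.
Proof.
case: cc => [[md T] p] [/= cs ct ch cl].
set b := hand_over _ _ _; set j := if b then _ else _; set cj := if b then _ else _.
have [cjt cjh] : cfg_tape c j = cj.1.2 /\ cfg_head c j = cj.2.
  rewrite /j /cj; case: ifP => // bt; apply: cl.
  by rewrite inordK // ltnS; case/and3P: bt.
have cjl t : (j < t)%N -> (i < t)%N.
  rewrite /j; case: ifP => // bt; rewrite inordK; first exact: ltnW.
  by rewrite ltnS; case/and3P: bt.
have dE : counter_delta (cfg_state c) x [ffun t => cfg_tape c t (cfg_head c t)] =
    if core phi live j cj.1.1 (cj.1.2 cj.2) (fsval x) is Some (md', o, mv) then
      (Some (j, md'), [ffun t => if t == j then (o, mv) else (cfg_tape c t (cfg_head c t), Stay)])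
    else (None, [ffun t => (cfg_tape c t (cfg_head c t), Stay)]).
  rewrite cs /= -/b -/j ffunE cjt cjh.
  have -> : (if b then Start false else md) = cj.1.1 by rewrite /cj; case: ifP.
  case: core => [[[md' o] mv]|]; congr pair; apply/ffunP => t; rewrite !ffunE //.
case: cj cjt cjh dE => [[md0 T0] p0] /= cjt cjh dE.
rewrite /core_step; case: core dE => [[[md' o] mv]|] dE;
  rewrite /simulates /rt_step /= dE //=; split=> //.
- by apply/funext => q; rewrite ffunE eqxx cjh cjt.
- by rewrite ffunE eqxx cjh.
- move=> t jt; have tj : (t == j) = false by rewrite -val_eqE /= gtn_eqF.
  have [tt th] := cl t (cjl t jt); rewrite !ffunE tj /= th tt addr0; split=> //.
  by apply/funext => q; case: eqP => // ->.
Qed.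

Lemma run_dead (c : rt_config counter_machine) w : cfg_state c = None ->
  rt_accepting (cfg_state (run c w)) = false.
Proof.
elim: w c => [|x w IH] c cs /=; first by rewrite cs.
by apply: IH; rewrite /rt_step cs.
Qed.

Definition accepts_part i (cc : core_config m) (w : seq X) : Prop :=
  exists T p, core_run phi live i cc [seq fsval x | x <- w] = Some (Start true, T, p).

Lemma run_sound w (c : rt_config counter_machine) (i : 'I_k.+1) cc : simulates c i cc ->
  rt_accepting (cfg_state (run c w)) ->
  exists ws : nat -> seq X, [/\ w = \big[cat/[::]]_(i <= j < k.+1) ws j,
    accepts_part i cc (ws i) &
    forall j, (i < j <= k)%N -> accepts_part j core_init (ws j)].
Proof.
elim: w c i cc => [|x w IH] c i cc sc.
  case: cc sc => [[md T] p] [/= -> ct ch _] /andP[/eqP ik /eqP ->].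
  exists (fun=> [::]); split; first by rewrite ik big_nat1.
    by exists T, p.
  by move=> j; rewrite ik => /andP[h1 h2]; rewrite ltnNge h2 in h1.
have := simulates_step x sc; cbv zeta; set b := hand_over _ _ _.
case E : (core_step phi live _ _ _) => [cc'|]; last first.
  by move=> dead acc; case/negP: (negbT (run_dead w dead)); exact: acc.
move=> s' /(IH _ _ _ s')[ws [wE [T [p acc]] accl]].
have step : accepts_part (if b then inord i.+1 else i)
    (if b then core_init else cc) (x :: ws (if b then inord i.+1 else i)).
  by exists T, p; rewrite /= core_run_cons E.
move: E s' wE acc accl step; case: ifP => bt E s' wE acc accl step; last first.
  exists (fun j : nat => if j == i :> nat then x :: ws i else ws j); split.
  - rewrite (big_ltn (ltn_ord i)) eqxx /= wE (big_ltn (ltn_ord i)) /=.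
    congr (_ :: _ ++ _); apply: eq_big_nat => j /andP[ij _].
    by rewrite gtn_eqF.
  - by rewrite eqxx.
  - by move=> j /[dup] /andP[ij _] /accl; rewrite gtn_eqF.
have /and3P[mdE _ ik] := bt.
have iE : (inord i.+1 : 'I_k.+1) = i.+1 :> nat by rewrite inordK.
rewrite iE in wE acc accl step.
(* The letter of a hand-over opens the part of factor i + 1, so nothing remains for factor i. *)
exists (fun j : nat => if j == i :> nat then [::] else if j == i.+1 then x :: ws i.+1 else ws j).
split.
- rewrite (big_ltn (ltn_ord i)) eqxx /= (big_ltn (ik : (i.+1 < k.+1)%N)).
  rewrite gtn_eqF // eqxx /= wE (big_ltn (ik : (i.+1 < k.+1)%N)) /=.
  congr (_ :: _ ++ _); apply: eq_big_nat => j /andP[ij _].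
  by rewrite (gtn_eqF ij) (gtn_eqF (ltnW ij)).
- case: cc sc mdE {s' E bt b} => [[md T0] p0] _ /= /eqP ->.
  by rewrite eqxx; exists T0, p0.
- move=> j /andP[ij jk]; rewrite gtn_eqF //; case: eqP => [->//|/eqP nj].
  by apply: accl; rewrite jk andbT ltn_neqAle eq_sym nj.
Qed.

(** This makes the hand-over deterministic: a nontrivial letter never continues a finished line. *)
Lemma core_start_true i T p x c :
  core_step phi live i (Start true, T, p) x = Some c -> x = 1.
Proof.
rewrite /core_step /=; case: (T p) => //= -[[bit d] c0].
by case: ifP => //= _; case: eqP.
Qed.

Lemma run_part w (c : rt_config counter_machine) (i : 'I_k.+1) cc T p : simulates c i cc ->
  core_run phi live i cc [seq fsval x | x <- w] = Some (Start true, T, p) ->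
  simulates (run c w) i (Start true, T, p).
Proof.
elim: w c cc => [|x w IH] c cc sc /=; first by case=> <-.
rewrite core_run_cons; case E : (core_step phi live _ _ _) => [cc'|] //=.
have := simulates_step x sc; have -> : hand_over i cc.1.1 (fsval x) = false.
  apply/negP => /and3P[/eqP mdE x1 _]; case: cc mdE E {sc} => [[md T0] p0] /= ->.
  by move=> /core_start_true x1'; rewrite x1' eqxx in x1.
by rewrite /= E => /IH.
Qed.

Lemma run_complete (ws : nat -> seq X) n (i : 'I_k.+1)
    (c : rt_config counter_machine) T p :
  (i + n = k)%N -> simulates c i (Start true, T, p) ->
  (forall j, (i < j <= k)%N -> accepts_part j core_init (ws j) /\
    exists x w, ws j = x :: w /\ fsval x != 1) ->
  rt_accepting (cfg_state (run c (\big[cat/[::]]_(i.+1 <= j < k.+1) ws j))).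
Proof.
elim: n i c T p => [|n IH] i c T p ik sc acc.
  rewrite addn0 in ik; rewrite ik big_geq //=.
  by case: sc => -> _ _ _ /=; rewrite ik !eqxx.
have ilt : (i < k)%N by move: ik; move: (nat_of_ord i) => i'; lia.
rewrite big_ltn // foldl_cat.
have iE : (inord i.+1 : 'I_k.+1) = i.+1 :> nat by rewrite inordK.
have [[T' [p' acc1]] [x [w [wE x1]]]] := acc i.+1 (ssrbool.introT andP (conj (leqnn _) ilt)).
have sc' : simulates (run c (ws i.+1)) (inord i.+1) (Start true, T', p').
  rewrite wE /=; rewrite wE /= core_run_cons in acc1.
  move: acc1; case E : (core_step phi live _ _ _) => [cc'|] //= acc1.
  apply: (run_part (cc := cc')); last by rewrite iE.
  have ho : hand_over i (Start true) (fsval x) by rewrite /hand_over eqxx x1 ilt.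
  have := simulates_step x sc; rewrite /= ho iE E.
  by apply.
have := IH (inord i.+1) _ _ _ _ sc'; rewrite iE; apply; first by rewrite addSnnS.
by move=> j /andP[ij jk]; apply: acc; rewrite jk (ltnW ij).
Qed.

Hypothesis phi0 : forall i, (i <= k)%N -> phi i 0%R = 1.
Hypothesis phi_digit_inj : forall i d d', (i <= k)%N -> digit (live i) d ->
  digit (live i) d' -> phi i (bvec d) = phi i (bvec d') -> d = d'.
Hypothesis phi_digit_neq1 : forall i d, (0 < i <= k)%N -> digit (live i) d ->
  phi i (bvec d) != 1.

Lemma simulates_init : simulates (rt_init counter_machine) ord0 core_init.
Proof.
have blank : (fun=> None) = tape_of (Nil (cell m)).
  by apply/funext => -[n|n] //=; rewrite onth_default.
by split.
Qed.

Lemma counter_machineP w : rt_accepts counter_machine w <->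
  exists (ws : nat -> seq X) (bss : nat -> seq (seq 'rV[int]_m)),
    w = \big[cat/[::]]_(0 <= i < k.+1) ws i /\
    forall i, (i <= k)%N -> line (live i) false [::] (bss i) /\
      [seq fsval x | x <- ws i] = map (phi i) (flatten (bss i)).
Proof.
split=> [acc|[ws [bss [-> h]]]].
  have [ws [-> acc0 accl]] := run_sound simulates_init acc.
  have acc' j : (j <= k)%N -> accepts_part j core_init (ws j).
    by case: j => [//|j] jk; apply: accl.
  exists ws; have bex i : exists bs, (i <= k)%N -> line (live i) false [::] bs /\
      [seq fsval x | x <- ws i] = map (phi i) (flatten bs).
    have [ik|ik] := leqP i k; last by exists [::].
    have [T [p run]] := acc' i ik.
    by have [bs wE ln] := line_sound (phi0 ik) run; exists bs.
  by have [bss hb] := choice bex; exists bss; split.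
have part i : (i <= k)%N -> accepts_part i core_init (ws i).
  move=> ik; have [ln wE] := h i ik; rewrite /accepts_part wE.
  by apply: line_run ln _ => //; [exact: phi0|move=> d d'; exact: phi_digit_inj].
rewrite /rt_accepts big_ltn // foldl_cat.
have [T [p run0]] := part 0%N isT.
apply: (@run_complete ws k ord0 _ T p) => //.
  exact: run_part simulates_init run0.
move=> j /andP[j0 jk]; split; first exact: part.
(* A line starts on the empty tape, so its first letter is a digit and triggers the hand-over. *)
have [ln wE] := h j jk; inversion ln as [|a s e s' b u bs gs ex ln' e1 e2 e3].
rewrite -e3 in wE; inversion ex as [d dd e4 e5 e6 e7| |]; subst e.
case: (ws j) wE => [|x w'] //= [xE _]; exists x, w'; split=> //.
by rewrite xE; apply: phi_digit_neq1 => //; rewrite jk andbT.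
Qed.

End CompositeMachine.

(** * Towers of abelian factors *)

(* [G] is the product of its subgroups [phi 0 Z^m], ..., [phi k Z^m], each
   normalized by the previous ones, with unique coordinates; the coordinates of
   the i-th factor that are not [live i] are unused. *)
Record abelian_tower (G : groupType) (m k d : nat) := AbelianTower {
  tw_phi : nat -> 'rV[int]_m -> G;
  tw_live : nat -> pred 'I_m;
  tw_act : nat -> 'rV[int]_m -> nat -> 'M[int]_m;
  tw_wt : nat -> 'I_m -> nat;
  tw_phiD : forall i u v, (i <= k)%N ->
    tw_phi i (u + v)%R = (tw_phi i u * tw_phi i v)%g;
  tw_phi_act : forall i j u v, (j < i <= k)%N ->
    masked (tw_live j) u -> masked (tw_live i) v ->
    (tw_phi i v * tw_phi j u = tw_phi j u * tw_phi i (v *m tw_act j u i)%R)%g;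
  tw_act_unip : forall i j u a b, (j < i <= k)%N ->
    ~~ (tw_live i b && (tw_wt i a < tw_wt i b)%N) ->
    tw_act j u i a b = (a == b)%:R%R;
  tw_wt_itv : forall i a, (i <= k)%N -> tw_live i a -> (0 < tw_wt i a <= d)%N;
  tw_live_ex : forall i, (0 < i <= k)%N -> exists a, tw_live i a;
  tw_surj : forall g, exists2 v : nat -> 'rV[int]_m,
    (forall i, masked (tw_live i) (v i)) &
    g = (\prod_(0 <= i < k.+1) tw_phi i (v i))%g;
  tw_inj : forall v v' : nat -> 'rV[int]_m,
    (forall i, masked (tw_live i) (v i)) ->
    (forall i, masked (tw_live i) (v' i)) ->
    (\prod_(0 <= i < k.+1) tw_phi i (v i) = \prod_(0 <= i < k.+1) tw_phi i (v' i))%g ->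
    forall i, (i <= k)%N -> v i = v' i }.

(** * Collecting a product into normal form *)

Section Collection.
Local Open Scope group_scope.
Variables (G : groupType) (m k : nat) (phi : nat -> 'rV[int]_m -> G)
  (live : nat -> pred 'I_m) (act : nat -> 'rV[int]_m -> nat -> 'M[int]_m)
  (wt : nat -> 'I_m -> nat).
Hypothesis phiD : forall i u v, (i <= k)%N -> phi i (u + v)%R = phi i u * phi i v.
Hypothesis phi_act : forall i j u v, (j < i <= k)%N -> masked (live j) u ->
  masked (live i) v -> phi i v * phi j u = phi j u * phi i (v *m act j u i)%R.
Hypothesis act_unip : forall i j u a b, (j < i <= k)%N ->
  ~~ (live i b && (wt i a < wt i b)%N) -> act j u i a b = (a == b)%:R%R.

Definition normal_form (v : nat -> 'rV[int]_m) : G := \prod_(0 <= i < k.+1) phi i (v i).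

(** The coordinates after right multiplication by [phi j u], which moves to the left across the
    factors behind j. *)
Definition collect j (u : 'rV[int]_m) (v : nat -> 'rV[int]_m) i : 'rV[int]_m :=
  if (i < j)%N then v i else if i == j then (v i + u)%R else (v i *m act j u i)%R.

Lemma mulmx_act_masked i j u (v : 'rV[int]_m) : (j < i <= k)%N ->
  masked (live i) v -> masked (live i) (v *m act j u i)%R.
Proof.
move=> ji /maskedP mv; apply/maskedP => b nb; rewrite mxE big1 // => a _.
rewrite act_unip // ?negb_and ?nb //; case: eqP => [->|_]; last by rewrite mulr0.
by rewrite mv ?mul0r.
Qed.

Lemma collect_masked j u v : masked (live j) u -> (forall i, masked (live i) (v i)) ->
  forall i, (i <= k)%N -> masked (live i) (collect j u v i).
Proof.
move=> mu mv i ik; rewrite /collect; case: ssrnat.ltngtP => [//|ji|->].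
  by apply: mulmx_act_masked => //; rewrite ji.
exact: maskedD.
Qed.

Lemma normal_form_mul j u v : (j <= k)%N -> masked (live j) u ->
  (forall i, masked (live i) (v i)) ->
  normal_form v * phi j u = normal_form (collect j u v).
Proof.
move=> jk mu mv; rewrite /normal_form.
have tail n : (j < n <= k.+1)%N -> (\prod_(j.+1 <= i < n) phi i (v i)) * phi j u =
    phi j u * \prod_(j.+1 <= i < n) phi i (v i *m act j u i)%R.
  elim: n => // n IH /andP[jn nk]; have [->|jn'] := eqVneq n j.
    by rewrite !big_geq // mulg1 mul1g.
  have {jn'}jn : (j < n)%N by rewrite ltn_neqAle eq_sym jn'.
  rewrite !big_nat_recr //= -mulgA phi_act //; last by rewrite jn.
  by rewrite mulgA IH ?jn ?(ltnW nk) // mulgA.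
have jk1 : (j <= k.+1)%N by exact: leqW.
rewrite (big_cat_nat (leq0n j) jk1) /= [in RHS](big_cat_nat (leq0n j) jk1) /=.
rewrite -mulgA; congr (_ * _).
  by apply: eq_big_nat => i /andP[_ ij]; rewrite /collect ij.
rewrite big_ltn // [in RHS]big_ltn // /collect ltnn eqxx phiD // -!mulgA tail ?ltnS ?jk ?leqnn //.
congr (_ * (_ * _)); apply: eq_big_nat => i /andP[ji _].
by rewrite ltnNge ltnW //= gtn_eqF.
Qed.

Lemma phi0 i : (i <= k)%N -> phi i 0%R = 1.
Proof. by move=> ik; apply: (@mulgI G (phi i 0%R)); rewrite -phiD // addr0 mulg1. Qed.

Lemma phiN i v : (i <= k)%N -> phi i (- v)%R = (phi i v)^-1.
Proof. by move=> ik; apply: (@mulgI G (phi i v)); rewrite -phiD // subrr mulgV phi0. Qed.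

Lemma phi_sum i (I : Type) (r : seq I) (F : I -> 'rV[int]_m) : (i <= k)%N ->
  phi i (\sum_(x <- r) F x)%R = \prod_(x <- r) phi i (F x).
Proof.
move=> ik; elim: r => [|x r IH]; first by rewrite !big_nil phi0.
by rewrite !big_cons phiD // IH.
Qed.

Lemma normal_form0 : normal_form (fun=> 0%R) = 1.
Proof. by rewrite /normal_form big_nat big1 // => i /andP[_ ik]; exact: phi0. Qed.

(* The normal forms are closed under multiplication by the generators. *)
Lemma normal_form_surj :
  generated [set x | exists i u, [/\ (i <= k)%N, masked (live i) u & x = phi i u]]%classic
    = [set: G]%classic ->
  forall g, exists2 v, (forall i, masked (live i) (v i)) & g = normal_form v.
Proof.
move=> gen g; pose S := [set g : G | exists2 v, (forall i, masked (live i) (v i)) &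
  g = normal_form v]%classic.
(* The right multipliers preserving [S]; requiring the same of the inverse makes them a subgroup. *)
pose H := [set h : G | forall g, S g -> S (g * h) /\ S (g * h^-1)]%classic.
have H1 : is_subgroup H.
  split=> [x Sx|x y Hx Hy z Sz|x Hx z Sz] /=.
  - by rewrite invg1 mulg1.
  - rewrite invgM !mulgA; split; first by case: (Hy _ (Hx _ Sz).1).
    by case: (Hx _ (Hy _ Sz).2).
  - by rewrite invgK; case: (Hx _ Sz).
have Hall : H g.
  have : [set: G]%classic g by [].
  rewrite -gen; apply; split=> // _ [i [u [ik mu ->]]].
  have step u' : masked (live i) u' -> forall y, S y -> S (y * phi i u').
    move=> mu' y [v mv ->]; rewrite normal_form_mul //.
    exists (fun l => if (l <= k)%N then collect i u' v l else 0%R).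
      move=> l; case: ifP => lk; last exact: masked0.
      exact: collect_masked.
    by rewrite /normal_form; apply: eq_big_nat => l /andP[_]; rewrite ltnS => ->.
  by move=> y Sy; split; [|rewrite -phiN //]; apply: step => //; exact: maskedN.
have [|+ _] := Hall 1; last by rewrite mul1g.
by exists (fun=> 0%R); [move=> i; exact: masked0|rewrite normal_form0].
Qed.

End Collection.

(** * Generators of a tower and growth of the coordinates *)

Section TowerGenerators.
Local Open Scope group_scope.
Variables (G : groupType) (m k d : nat) (T : abelian_tower G m k d).
Notation phi := (tw_phi T).
Notation live := (tw_live T).
Notation act := (tw_act T).
Notation wt := (tw_wt T).
Notation nf := (normal_form k phi).
Let phiD := @tw_phiD _ _ _ _ T.
Let phi0 := phi0 phiD.
Let phiN := phiN phiD.

(* The trivial letter belongs to this set; it marks time in the words. *)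
Definition tower_gens : {fset G} :=
  [fset x in [seq phi p.1 (bvec p.2) | p <- [seq (i, b) | i <- iota 0 k.+1,
    b <- enum (box m)] & masked (live p.1) (bvec p.2)]]%fset.

Lemma tower_gensP x : reflect (exists i u, [/\ (i <= k)%N, small 5 u,
  masked (live i) u & x = phi i u]) (x \in tower_gens).
Proof.
rewrite in_fset; apply: (iffP mapP) => [[[i b]]|[i [u [ik su mu ->]]]].
  rewrite mem_filter => /andP[mb /allpairsPdep[i' [b' [ii _ [? ?]]]]] ->; subst i' b'.
  rewrite mem_iota in ii; exists i, (bvec b).
  by split=> //; exact: bvec_small.
exists (i, tobox u); last by rewrite /= toboxK.
rewrite mem_filter; apply/andP; split; first by rewrite /= toboxK.
by apply/allpairsPdep; exists i, (tobox u); rewrite mem_iota mem_enum.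
Qed.

Lemma tower_gensV x : x \in tower_gens -> x^-1 \in tower_gens.
Proof.
case/tower_gensP => i [u [ik /smallP su mu ->]]; apply/tower_gensP.
exists i, (- u)%R; split=> //; [|exact: maskedN|by rewrite phiN].
by apply/smallP => j; rewrite rowN; have := su j; lia.
Qed.

Notation ball := (@ball G tower_gens).

(** Taking off the vector of signs, which is one letter, lowers all nonzero entries at once. *)
Lemma ball_phi K i v : (i <= k)%N -> masked (live i) v -> small K v -> ball K (phi i v).
Proof.
move=> ik; elim: K v => [|K IH] v mv sv.
  have -> : v = 0%R.
    apply/rowP => j; rewrite row0; have /smallP/(_ j) := sv; lia.
  by rewrite phi0 //; exact: ball1.
pose e : 'rV[int]_m := (map_mx (fun z : int => sgz z) v).
have eE j : e 0%R j = sgz (v 0%R j) by rewrite mxE.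
have me : masked (live i) e.
  by apply/maskedP => j nj; rewrite eE; move/maskedP: mv => ->.
have -> : v = ((v - e) + e)%R by rewrite subrK.
rewrite phiD // -addn1; apply: ballM.
  apply: IH; first by apply: maskedD => //; exact: maskedN.
  by apply/smallP => j; rewrite rowD rowN eE; have /smallP/(_ j) := sv; lia.
have eX : phi i e \in tower_gens.
  apply/tower_gensP; exists i, e; split=> //.
  by apply/smallP => j; rewrite eE; lia.
exact: (ball_letter [` eX]%fset).
Qed.

Lemma ball_generated K g : ball K g -> generated [set` tower_gens]%classic g.
Proof.
have [g1 gM _] := generated_subgroup [set` tower_gens]%classic.
case=> u _ <-; elim: u => [|x u IH]; first by rewrite word_eval_nil.
rewrite word_eval_cons; apply: gM => // H [_]; apply; exact: fsvalP.
Qed.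

Lemma tower_gens_generating : inverse_closed_generating tower_gens.
Proof.
split; first exact: tower_gensV.
apply/seteqP; split=> // g _; have [v mv ->] := tw_surj T g.
have [g1 gM _] := generated_subgroup [set` tower_gens]%classic.
rewrite big_nat; elim/big_ind: _ => // i /andP[_ ik].
have sv : small (\max_j `|(v i 0 j)%R|) (v i).
  by apply/smallP => j; exact: (leq_bigmax j).
exact: ball_generated (ball_phi ik (mv i) sv).
Qed.

(** The successor makes it bound the identity matrix as well. *)
Definition act_bound : nat := (\max_(i < k.+1) \max_(j < k.+1) \max_(u : box m)
  \max_(a < m) \max_(b < m) `|act j (bvec u) i a b|).+1.

Definition entries_le (r : nat) (A : 'M[int]_m) : bool :=
  [forall a, forall b, (`|A a b| <= r)%N].

Lemma entries_leP r (A : 'M[int]_m) : reflect (forall a b, (`|A a b| <= r)%N) (entries_le r A).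
Proof.
apply: (iffP forallP) => h a; first by have /forallP := h a.
by apply/forallP => b.
Qed.

Lemma entries_le1 : entries_le act_bound 1%:M.
Proof. by apply/entries_leP => a b; rewrite mxE; case: eqP. Qed.

Lemma entries_le_act i j u : (i <= k)%N -> (j <= k)%N -> small 5 u ->
  entries_le act_bound (act j u i).
Proof.
move=> ik jk su; apply/entries_leP => a b; rewrite -(toboxK su) ltnW // ltnS.
apply: leq_trans (leq_bigmax (Ordinal (ik : (i < k.+1)%N))).
apply: leq_trans (leq_bigmax (Ordinal (jk : (j < k.+1)%N))).
apply: leq_trans (leq_bigmax (tobox u)).
by apply: leq_trans (leq_bigmax a); apply: leq_trans (leq_bigmax b).
Qed.

Lemma small_mulmx r K (v : 'rV[int]_m) (A : 'M[int]_m) :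
  entries_le r A -> small K v -> small (m * (r * K)) (v *m A)%R.
Proof.
move=> /entries_leP eA /smallP sv; apply/smallP => j; rewrite mxE.
have -> : (m * (r * K) = \sum_(a < m) r * K)%N by rewrite sum_nat_const card_ord.
elim/big_ind2: _ => // [x x' y y' xx yy|a _].
  by lia.
by rewrite abszM mulnC leq_mul.
Qed.

Definition growth_const := (m * act_bound + 5)%N.

Lemma leq_exp_base a b e : (a <= b)%N -> (a ^ e <= b ^ e)%N.
Proof. by move=> ab; elim: e => // e IH; rewrite !expnS leq_mul. Qed.

(** (a + c)^e is a (a + c)^(e-1), which is at least a^e, plus c (a + c)^(e-1). *)
Lemma exp_step a c e B : (0 < e)%N -> (B <= c * (a + c) ^ e.-1)%N ->
  (a ^ e + B <= (a + c) ^ e)%N.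
Proof.
case: e => // e _ /= hB; rewrite !expnS mulnDl leq_add // leq_mul2l.
by rewrite (leq_exp_base _ (leq_addr _ _)) orbT.
Qed.

(** A coordinate of weight w grows like a w-th power. By unipotence it receives only coordinates of
    smaller weight, in total at most m * [act_bound] times M^(w-1), or else an entry of the letter,
    at most 5; [growth_const] covers both. *)
Lemma collect_growth L j u v : (j <= k)%N -> masked (live j) u -> small 5 u ->
  (forall i, masked (live i) (v i)) ->
  (forall i a, (i <= k)%N -> live i a ->
    (`|(v i 0 a)%R| <= (growth_const * L) ^ wt i a)%N) ->
  forall i a, (i <= k)%N -> live i a ->
    (`|(collect act j u v i 0 a)%R| <= (growth_const * L.+1) ^ wt i a)%N.
Proof.
move=> jk mu su mv hv i b ik lb; have hb := hv i b ik lb.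
have w0 : (0 < wt i b)%N by have /andP[] := tw_wt_itv ik lb.
set c := growth_const in hv hb *; set M := (c * L.+1)%N.
have ME : M = (c * L + c)%N by rewrite /M mulnS addnC.
have c5 : (5 <= c)%N by rewrite /c /growth_const leq_addl.
have M0 : (0 < M)%N by lia.
have step B x : (`|x| <= B)%N -> (B <= c * M ^ (wt i b).-1)%N ->
    (`|((v i 0 b) + x)%R| <= M ^ wt i b)%N.
  move=> xB Bc; apply: (@leq_trans ((c * L) ^ wt i b + B)%N); first by lia.
  by rewrite ME; apply: exp_step; rewrite -?ME.
have Mw : (0 < M ^ (wt i b).-1)%N by rewrite expn_gt0 M0.
rewrite /collect; case: ssrnat.ltngtP => ij.
- by rewrite -[X in absz X]addr0; apply: (step 0%N).
- rewrite mxE (bigD1 b) //= (@tw_act_unip _ _ _ _ T) ?ij ?ltnn ?andbF // eqxx mulr1.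
  have mA : (m * act_bound * M ^ (wt i b).-1 <= c * M ^ (wt i b).-1)%N.
    by rewrite leq_mul2r /c /growth_const leq_addr orbT.
  apply: step mA.
  have -> : (m * act_bound * M ^ (wt i b).-1 =
      \sum_(a < m) act_bound * M ^ (wt i b).-1)%N.
    by rewrite sum_nat_const card_ord mulnA.
  rewrite [X in (_ <= X)%N](bigID (fun a => a != b)) /=.
  apply: leq_trans (leq_addr _ _).
  elim/big_ind2: _ => // [x x' y y' xx yy|a ab]; first by lia.
  have [/andP[_ lt]|nl] := boolP (live i b && (wt i a < wt i b)%N); last first.
    by rewrite (@tw_act_unip _ _ _ _ T) ?ij // (negPf ab) mulr0.
  have [la|na] := boolP (live i a); last first.
    by have /maskedP -> := mv i; rewrite // mul0r.
  rewrite abszM mulnC leq_mul //.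
    by have /entries_leP := entries_le_act ik jk su.
  apply: leq_trans (hv i a ik la) _.
  apply: (@leq_trans (M ^ wt i a)).
    by apply: leq_exp_base; rewrite ME leq_addr.
  by rewrite leq_pexp2l // -ltnS prednK.
- rewrite rowD; subst j; apply: (step 5%N); first by have /smallP := su.
  by rewrite -[5%N]muln1 leq_mul.
Qed.

Lemma word_growth (w : seq tower_gens) : exists2 v,
  (forall i, masked (live i) (v i)) & word_eval w = nf v /\
  forall i a, (i <= k)%N -> live i a ->
    (`|(v i 0 a)%R| <= (growth_const * size w) ^ wt i a)%N.
Proof.
elim/last_ind: w => [|w x [v mv [wE hv]]].
  exists (fun=> 0%R); first by move=> i; exact: masked0.
  by rewrite word_eval_nil normal_form0 //; split=> // i a _ _; rewrite row0.
have /tower_gensP[j [u [jk su mu xE]]] := fsvalP x.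
exists (fun l => if (l <= k)%N then collect act j u v l else 0%R).
  move=> i; case: ifP => ik; last exact: masked0.
  exact: (collect_masked (@tw_act_unip _ _ _ _ T)).
split.
  rewrite -cats1 word_eval_cat word_eval_cons word_eval_nil mulg1 wE xE.
  rewrite (normal_form_mul phiD (@tw_phi_act _ _ _ _ T)) //.
  by apply: eq_big_nat => l /andP[_]; rewrite ltnS => ->.
move=> i a ik la; rewrite ik size_rcons.
exact: collect_growth.
Qed.

End TowerGenerators.

(** * Matching two lines in one factor *)

Section FactorMatching.
Local Open Scope group_scope.
Variables (G : groupType) (m k d : nat) (T : abelian_tower G m k d).
Notation phi := (tw_phi T).
Notation live := (tw_live T).
Notation X := (tower_gens T).
Notation ball := (@ball G X).
Let phiD := @tw_phiD _ _ _ _ T.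
Let phi0 := phi0 phiD.
Let phiN := phiN phiD.

(* A word that runs in [N] blocks along the line from 0 to [P N] in factor i. *)
Record factor_path (i : nat) (w : seq X) (N : nat) (B : nat -> seq X)
    (P : nat -> 'rV[int]_m) : Prop := FactorPath {
  fp_word : w = flatten [seq B n | n <- iota 0 N];
  fp_start : P 0%N = 0%R;
  fp_masked : forall n, masked (live i) (P n);
  fp_eval : forall n, (n < N)%N -> word_eval (B n) = phi i (P n.+1 - P n)%R;
  fp_size : forall n, (n < N)%N -> size (B n) = (logn 2 n.+1).*2.+2;
  fp_prefix : forall n a, (n < N)%N -> exists2 z, small 5 z && masked (live i) z &
    word_eval (take a (B n)) = phi i z;
  fp_straight : forall n, (n <= N)%N ->
    small (6 * N) (N%:Z *: P n - n%:Z *: P N)%R;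
  fp_upper : small (N + 3) (P N);
  fp_lower : N = 1%N \/ exists2 j, live i j & (N <= 2 * `|(P N 0 j)%R| + 6)%N;
  fp_pow2 : exists J, N = (2 ^ J)%N;
  fp_total : (size w <= 4 * N)%N }.

Lemma split_blocks i (w : seq X) (bs : seq (seq 'rV[int]_m)) :
  [seq fsval x | x <- w] = map (phi i) (flatten bs) ->
  exists2 Bs : seq (seq X), w = flatten Bs &
    [seq [seq fsval x | x <- b] | b <- Bs] = map (map (phi i)) bs.
Proof.
elim: bs w => [|b bs IH] w /=; first by case: w => // _; exists [::].
rewrite map_cat => wE; have [|Bs wE' BE] := IH (drop (size b) w).
  by rewrite map_drop wE drop_size_cat // size_map.
exists (take (size b) w :: Bs); first by rewrite /= -wE' cat_take_drop.
by rewrite /= BE map_take wE take_size_cat // size_map.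
Qed.

Lemma eval_map i (w : seq X) b : (i <= k)%N -> [seq fsval x | x <- w] = map (phi i) b ->
  word_eval w = phi i (\sum_(v <- b) v)%R.
Proof.
move=> ik wE; rewrite (phi_sum phiD) // /word_eval.
by rewrite -(big_map (fun x : X => fsval x) predT id) wE big_map.
Qed.

Lemma line_pos_masked bs i n : all (fun x => small 5 x && masked (live i) x) (flatten bs) ->
  masked (live i) (line_pos bs n).
Proof.
rewrite /line_pos => /allP h; rewrite big_seq.
elim/big_ind: _ => [|u v mu mv|v vb]; [exact: masked0|exact: maskedD|].
have /h/andP[//] : v \in flatten bs.
by rewrite -(cat_take_drop n bs) flatten_cat mem_cat vb.
Qed.

Lemma line_posS (bs : seq (seq 'rV[int]_m)) n : (n < size bs)%N ->
  line_pos bs n.+1 = (line_pos bs n + \sum_(v <- nth [::] bs n) v)%R.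
Proof.
move=> nb; rewrite /line_pos (take_nth [::] nb) flatten_rcons big_cat.
by [].
Qed.

Lemma line_factor_path i (w : seq X) bs : (i <= k)%N -> line (live i) false [::] bs ->
  [seq fsval x | x <- w] = map (phi i) (flatten bs) ->
  exists B, factor_path i w (size bs) B (line_pos bs).
Proof.
move=> ik ln wE; have [Bs wB BE] := split_blocks wE.
have r0 : counted (Nil (cell m)) 0 0 by [].
have sB : size Bs = size bs by have := congr1 size BE; rewrite !size_map.
have [pow st up lo] := line_word ln.
have BnE n : [seq fsval x | x <- nth [::] Bs n] = map (phi i) (nth [::] bs n).
  have [nb|nb] := ltnP n (size bs); last by rewrite !nth_default ?sB.
  have := congr1 (fun s => nth [::] s n) BE.
  by rewrite !(nth_map [::]) // sB.
have bl n (nb : (n < size bs)%N) := line_blocks ln r0 isT nb.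
exists (nth [::] Bs); split.
- by rewrite wB -sB -/(mkseq _ _) mkseq_nth.
- exact: line_pos0.
- by move=> n; apply: line_pos_masked; exact: line_letters ln r0 isT.
- by move=> n nb; rewrite (eval_map ik (BnE n)) line_posS // addrAC subrr add0r.
- move=> n nb; have [<- _] := bl n nb.
  by have := congr1 size (BnE n); rewrite !size_map.
- move=> n a nb; have [_ /(_ a) h] := bl n nb; eexists; first exact: h.
  by apply: eval_map => //; rewrite map_take BnE -map_take.
- move=> n nb; apply/smallP => j; have := st n j nb.
  rewrite -!scaler_int !intz !rowE; lia.
- by apply/smallP => j; have := up j; lia.
- case: lo => [->|[j lj h]]; [by left|by right; exists j].
- exact: pow.
- have -> : size w = size (flatten bs) by have := congr1 size wE; rewrite !size_map.
  by have := line_total_size ln; rewrite /ones /= muln0 addn0.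
Qed.

Lemma smallD r r' (u v : 'rV[int]_m) : small r u -> small r' v -> small (r + r') (u + v)%R.
Proof.
move=> /smallP h /smallP h'; apply/smallP => j; rewrite rowD.
by have := h j; have := h' j; lia.
Qed.

Lemma smallN r (v : 'rV[int]_m) : small r v -> small r (- v)%R.
Proof. by move=> /smallP h; apply/smallP => j; rewrite rowN abszN. Qed.

Lemma smallZ r n (v : 'rV[int]_m) : small r v -> small (n * r) (n%:Z *: v)%R.
Proof.
by move=> /smallP h; apply/smallP => j; rewrite rowZ abszM leq_mul.
Qed.

Lemma smallZ_inv r n (v : 'rV[int]_m) : (0 < n)%N ->
  small (n * r) (n%:Z *: v)%R -> small r v.
Proof.
move=> n0 /smallP h; apply/smallP => j; have := h j.
by rewrite rowZ abszM leq_pmul2l.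
Qed.

Lemma take_blocks i w N B P n0 L b : (i <= k)%N -> factor_path i w N B P ->
  (n0 + L <= N)%N -> exists s z, [/\ (s <= L)%N, small 5 z, masked (live i) z &
    word_eval (take b (flatten [seq B n | n <- iota n0 L])) =
      phi i (P (n0 + s)%N - P n0 + z)%R].
Proof.
move=> ik fp; elim: L n0 b => [|L IH] n0 b nL /=.
  exists 0%N, 0%R; rewrite small0 masked0 word_eval_nil addn0 subrr addr0 phi0 //.
have n0N : (n0 < N)%N by apply: leq_trans nL; rewrite addnS ltnS leq_addr.
rewrite take_cat; case: ifP => _.
  have [z /andP[sz mz] ->] := fp_prefix fp b n0N.
  by exists 0%N, z; rewrite addn0 subrr add0r.
have [|s [z [sL sz mz E]]] := IH n0.+1 (b - size (B n0))%N; first by rewrite addSnnS.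
exists s.+1, z; split=> //; rewrite word_eval_cat E (fp_eval fp) // -phiD //.
congr (phi i _); rewrite addSnnS; move: (P _) (P n0.+1) (P n0) => a1 a2 a3.
by apply/rowP => j; rewrite !rowE; ring.
Qed.

Lemma eval_blocks i w N B P n0 L : (i <= k)%N -> factor_path i w N B P ->
  (n0 + L <= N)%N -> word_eval (flatten [seq B n | n <- iota n0 L]) =
    phi i (P (n0 + L)%N - P n0)%R.
Proof.
move=> ik fp; elim: L n0 => [|L IH] n0 nL /=.
  by rewrite word_eval_nil addn0 subrr phi0.
have n0N : (n0 < N)%N by apply: leq_trans nL; rewrite addnS ltnS leq_addr.
rewrite word_eval_cat (fp_eval fp) // IH ?addSnnS // -phiD //.
congr (phi i _); move: (P _) (P n0.+1) (P n0) => a1 a2 a3.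
by apply/rowP => j; rewrite !rowE; ring.
Qed.

Lemma flatten_iota_mul (A : Type) (F : nat -> seq A) q N :
  flatten [seq flatten [seq F l | l <- iota (q * n) q] | n <- iota 0 N] =
  flatten [seq F l | l <- iota 0 (q * N)].
Proof.
elim: N => [|N IH]; first by rewrite muln0.
rewrite -[in LHS](addn1 N) iotaD map_cat flatten_cat IH /= cats0 add0n mulnSr.
by rewrite iotaD map_cat flatten_cat add0n.
Qed.

(** Of the numbers q n + 1, ..., q n + q only the last one, q (n + 1), is divisible by q. *)
Lemma logn_block q r n l : q = (2 ^ r)%N -> (l < q)%N ->
  (logn 2 (q * n + l).+1 <= r + logn 2 n.+1)%N.
Proof.
move=> qE lq; have [lE|lE] := eqVneq l.+1 q.
  have -> : (q * n + l).+1 = (q * n.+1)%N by rewrite -addnS lE mulnS addnC.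
  by rewrite qE lognM ?expn_gt0 // pfactorK.
apply: (@leq_trans r); last exact: leq_addr.
rewrite leqNgt; apply/negP => rl.
have : (2 ^ r %| (q * n + l).+1)%N by rewrite pfactor_dvdn // ltnW.
rewrite -qE -addnS dvdn_addr ?dvdn_mulr // => /dvdn_leq ql.
by case/negP: lE; rewrite eqn_leq lq ql.
Qed.

(** The lower bound comes from the last block of the group, whose index plus one is q (n + 1); the
    upper one is q times the largest possible block. *)
Lemma group_size i w N B P q r n : factor_path i w N B P -> q = (2 ^ r)%N ->
  (q * n + q <= N)%N ->
  let S := size (flatten [seq B l | l <- iota (q * n) q]) in
  ((logn 2 n.+1).*2.+2 <= S <= q * r.+1 * (logn 2 n.+1).*2.+2)%N.
Proof.
move=> fp qE qN; have q0 : (0 < q)%N by rewrite qE expn_gt0.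
rewrite /= size_flatten /shape -map_comp sumnE big_map.
have sz l : l \in iota (q * n) q -> exists2 l', (l' < q)%N & l = (q * n + l')%N.
  rewrite mem_iota => /andP[h1 h2]; exists (l - q * n)%N; last by rewrite subnKC.
  by rewrite ltn_subLR.
apply/andP; split.
  have lm : (q * n + q.-1)%N \in iota (q * n) q.
    by rewrite mem_iota leq_addr /= ltn_add2l prednK.
  rewrite (big_rem _ lm) /= (fp_size fp); last first.
    by apply: leq_trans qN; rewrite ltn_add2l prednK.
  apply: leq_trans (leq_addr _ _); rewrite -addnS prednK // addnC -mulnS mulnC.
  by rewrite qE lognM ?expn_gt0 // ltnS ltnS leq_double leq_addr.
have -> : (q * r.+1 * (logn 2 n.+1).*2.+2)%N =
    (\sum_(l <- iota (q * n) q) r.+1 * (logn 2 n.+1).*2.+2)%N.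
  by rewrite big_const_seq count_predT size_iota iter_addn_0 -mulnA mulnC.
rewrite big_seq [X in (_ <= X)%N]big_seq; apply: leq_sum => l /sz[l' lq ->] /=.
rewrite (fp_size fp); last by apply: leq_trans qN; rewrite ltn_add2l.
by have := logn_block n qE lq; nia.
Qed.

Section OneDirection.
Variables (i : nat) (y : G) (A : 'M[int]_m) (Ab : nat) (c : 'rV[int]_m).
Variables (w : seq X) (N : nat) (B : nat -> seq X) (P : nat -> 'rV[int]_m).
Variables (w' : seq X) (N' : nat) (B' : nat -> seq X) (P' : nat -> 'rV[int]_m).
Hypothesis ik : (i <= k)%N.
Hypothesis yb : ball 1 y.
Hypothesis yA : forall v, masked (live i) v -> phi i v * y = y * phi i (v *m A)%R.
Hypothesis mA : forall v, masked (live i) v -> masked (live i) (v *m A)%R.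
Hypothesis eA : entries_le Ab A.
Hypothesis fp : factor_path i w N B P.
Hypothesis fp' : factor_path i w' N' B' P'.
Hypothesis PN : P' N' = (P N *m A + c)%R.
Hypothesis sc : small 5 c.

(** From N' <= 2 |P' N'| + 6 with P' N' = P N A + c: here |P N| <= N + 3 <= 4 N, the matrix
    contributes m * Ab, and 16 = 2 * 5 + 6. *)
Definition size_ratio := (2 * (m * Ab * 4) + 16)%N.

Lemma endpoint_ratio : (N' <= size_ratio * N)%N.
Proof.
have N0 : (0 < N)%N by have [J ->] := fp_pow2 fp; rewrite expn_gt0.
case: (fp_lower fp') => [->|[j _ h]]; first by rewrite /size_ratio; nia.
have s1 := small_mulmx eA (fp_upper fp).
have /smallP/(_ j) := smallD s1 sc; rewrite -PN /size_ratio => h1.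
have : (m * (Ab * (N + 3)) <= m * Ab * 4 * N)%N by rewrite -!mulnA !leq_mul //; lia.
lia.
Qed.

(** One letter for [y], four summands from [offset_small], and the last two for the incomplete
    blocks of the two lines. *)
Definition track_radius q := (1 + (4 * q + 5 + 6 + 6 * (m * Ab) + 5 * (m * Ab) + 5))%N.

Lemma offset_small q n s : (N' = q * N)%N -> (n < N)%N -> (s <= q)%N ->
  small (4 * q + 5 + 6 + 6 * (m * Ab)) (P' (q * n + s)%N - P n *m A)%R.
Proof.
move=> N'E nN sq; set E := (_ - _)%R.
have N0 : (0 < N)%N by apply: leq_ltn_trans nN.
have N'0 : (0 < N')%N by have [J ->] := fp_pow2 fp'; rewrite expn_gt0.
have q0 : (0 < q)%N by move: N'0; rewrite N'E muln_gt0 => /andP[].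
have tN : (q * n + s <= N')%N.
  by rewrite N'E (leq_trans (leq_add (leqnn _) sq)) // -mulnSr leq_mul2l nN orbT.
(* N' times the offset is the advance of s blocks within a group, plus a share of c, plus the
   deviations of the two lines from straightness; the four bounds below follow this order. *)
have EE : (N'%:Z *: E = s%:Z *: P' N' + (q * n)%N%:Z *: c +
    (N'%:Z *: P' (q * n + s)%N - (q * n + s)%N%:Z *: P' N') -
    q%:Z *: ((N%:Z *: P n - n%:Z *: P N) *m A))%R.
  rewrite /E PN mulmxBl -!scalemxAl N'E !PoszD !PoszM.
  move: (P' _) (P n *m A)%R (P N *m A)%R => a1 a2 a3.
  by apply/rowP => j; rewrite !rowE; ring.
apply: (smallZ_inv N'0); rewrite EE.
have h1 := smallZ s (fp_upper fp').
have h2 := smallZ (q * n) sc.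
have h3 := fp_straight fp' tN.
have h4 := smallN (smallZ q (small_mulmx eA (fp_straight fp (ltnW nN)))).
apply: small_le (smallD (smallD (smallD h1 h2) h3) h4).
have a1 : (s * (N' + 3) <= 4 * q * N')%N by nia.
have a2 : (q * n * 5 <= 5 * N')%N by rewrite N'E; nia.
have a3 : (q * (m * (Ab * (6 * N))) = 6 * (m * Ab) * N')%N by rewrite N'E; lia.
lia.
Qed.

Lemma tracks_one_direction q r : q = (2 ^ r)%N -> (N' = q * N)%N ->
  exists zs, [/\ fst_word zs = w, snd_word zs = w' &
    tracks (track_radius q) (q * r.+1) zs y].
Proof.
move=> qE N'E; have q0 : (0 < q)%N by rewrite qE expn_gt0.
pose z n := (B n, flatten [seq B' l | l <- iota (q * n) q]).
exists [seq z n | n <- iota 0 N]; split.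
- by rewrite (fp_word fp) /fst_word -map_comp.
- by rewrite (fp_word fp') /snd_word -map_comp N'E -flatten_iota_mul.
(* After n matched segments the offset between the two paths is [y * phi i (D n)]. *)
pose D n : 'rV[int]_m := (P' (q * n)%N - P n *m A)%R.
have mD n : masked (live i) (D n).
  apply: maskedD; first exact: (fp_masked fp').
  by apply/maskedN/mA; exact: (fp_masked fp).
suff main l n : (n + l = N)%N ->
    tracks (track_radius q) (q * r.+1) [seq z n | n <- iota n l] (y * phi i (D n)).
  have := main N 0%N (add0n _); rewrite /D muln0 (fp_start fp) (fp_start fp').
  by rewrite mul0mx subr0 phi0 // mulg1.
have phiB u v : phi i (u - v)%R = phi i u * (phi i v)^-1 by rewrite phiD // phiN.
have swap v : masked (live i) v -> (phi i v)^-1 * y = y * (phi i (v *m A)%R)^-1.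
  by move=> mv; apply: (@mulgI G (phi i v)); rewrite mulVKg mulgA yA // mulgK.
elim: l n => [|l IH] n nl.
  rewrite addn0 in nl; rewrite nl /D -N'E PN addrC addKr /=.
  apply: (@ball_le _ _ (1 + 5)%N); first by rewrite /track_radius; lia.
  apply: ballM => //; apply: ball_phi => //.
  have -> : c = (P' N' - P N *m A)%R by rewrite PN addrC addKr.
  apply: maskedD; first exact: (fp_masked fp').
  by apply/maskedN/mA; exact: (fp_masked fp).
have nN : (n < N)%N by rewrite -nl -addSnnS leq_addr.
have qnN : (q * n + q <= N')%N by rewrite N'E -mulnSr leq_mul2l nN orbT.
have gs := group_size fp' qE qnN.
split.
- rewrite /= (fp_size fp) //; case/andP: gs => g1 g2.
  apply/and3P; split=> //=.
  apply: leq_trans g1 _; apply: leq_pmull; by rewrite muln_gt0 q0.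
- move=> a b _ _ /=.
  have [v /andP[sv mv] ->] := fp_prefix fp a nN.
  have [s [v' [sq sv' mv' ->]]] := take_blocks b ik fp' qnN.
  rewrite !mulgA swap // -phiN // -!mulgA -!phiD //.
  rewrite /track_radius; apply: ballM => //.
  have -> : (- (v *m A) + (D n + (P' (q * n + s)%N - P' (q * n)%N + v')) =
      (P' (q * n + s)%N - P n *m A) + - (v *m A) + v')%R.
    rewrite /D; move: (v *m A)%R (P n *m A)%R (P' _) (P' (q * n)%N) => a1 a2 a3 a4.
    by apply/rowP => j; rewrite !rowE; ring.
  apply: ball_phi => //.
    apply: maskedD => //; apply: maskedD; last by apply/maskedN/mA.
    apply: maskedD; first exact: (fp_masked fp').
    by apply/maskedN/mA; exact: (fp_masked fp).
  apply: smallD => //; apply: smallD; first exact: offset_small.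
  by apply: smallN; have := small_mulmx eA sv; rewrite mulnA mulnC.
- have -> : (word_eval (z n).1)^-1 * (y * phi i (D n)) * word_eval (z n).2 =
      y * phi i (D n.+1).
    rewrite /= (eval_blocks ik fp' qnN) -mulnSr.
    rewrite (fp_eval fp) // mulgA swap; last first.
      by apply: maskedD; [|apply: maskedN]; exact: (fp_masked fp).
    rewrite -phiN // -!mulgA -!phiD //; congr (y * phi i _).
    rewrite /D mulmxBl; move: (P' _) (P' (q * n)%N) (P n *m A)%R (P _ *m A)%R => a1 a2 a3 a4.
    by apply/rowP => j; rewrite !rowE; ring.
  by apply: IH; rewrite -nl addSnnS.
Qed.

End OneDirection.

End FactorMatching.

(** * The combing of a tower and its length function *)

Section TowerCombing.
Local Open Scope group_scope.
Variables (R : realType) (G : groupType) (m k d : nat) (T : abelian_tower G m k d).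
Notation phi := (tw_phi T).
Notation live := (tw_live T).
Notation act := (tw_act T).
Notation X := (tower_gens T).
Notation ball := (@ball G X).
Let phiD := @tw_phiD _ _ _ _ T.
Let phi0 := phi0 phiD.
Let phiN := phiN phiD.

Let ratio := size_ratio m (act_bound T).
Definition pair_radius := track_radius m (act_bound T) ratio.
Definition pair_ratio := (ratio * ratio.+1)%N.

(** The data are symmetric under inverting [y], so the line with fewer blocks may be taken first.
    Both numbers of blocks are powers of 2, hence so is their quotient, which [endpoint_ratio]
    bounds. *)
Lemma factor_tracks i y (A A' : 'M[int]_m) (c c' : 'rV[int]_m)
    (w : seq X) N B P (w' : seq X) N' B' P' :
  (i <= k)%N -> ball 1 y ->
  (forall v, masked (live i) v -> phi i v * y = y * phi i (v *m A)%R) ->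
  (forall v, masked (live i) v -> phi i v * y^-1 = y^-1 * phi i (v *m A')%R) ->
  (forall v, masked (live i) v -> masked (live i) (v *m A)%R) ->
  (forall v, masked (live i) v -> masked (live i) (v *m A')%R) ->
  entries_le (act_bound T) A -> entries_le (act_bound T) A' ->
  factor_path i w N B P -> factor_path i w' N' B' P' ->
  P' N' = (P N *m A + c)%R -> P N = (P' N' *m A' + c')%R ->
  small 5 c -> small 5 c' ->
  exists zs, [/\ fst_word zs = w, snd_word zs = w' & tracks pair_radius pair_ratio zs y].
Proof.
move=> ik yb yA yA' mA mA' eA eA' fp fp' PN PN' sc sc'.
wlog NN : y A A' c c' w N B P w' N' B' P' yb yA yA' mA mA' eA eA' fp fp' PN PN' sc sc' /
    (N <= N')%N.
  move=> main; have [NN|NN] := leqP N N'.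
    exact: (main y A A' c c' w N B P w' N' B' P').
  have yb' := ballV (@tower_gensV _ _ _ _ T) yb.
  have [||zs [f s t]] := main y^-1 A' A c' c w' N' B' P' w N B P yb' yA' _ mA' mA
    eA' eA fp' fp PN' PN sc' sc.
  - by rewrite invgK.
  - exact: ltnW.
  exists [seq (z.2, z.1) | z <- zs].
  rewrite fst_word_swap snd_word_swap; split=> //.
  rewrite -[y]invgK; exact: (tracks_swap (@tower_gensV _ _ _ _ T) t).
have [a NE] := fp_pow2 fp; have [b N'E] := fp_pow2 fp'.
have ab : (a <= b)%N by rewrite -(@leq_exp2l 2) // -NE -N'E.
have qE : (N' = 2 ^ (b - a) * N)%N by rewrite N'E NE -expnD subnK.
have N0 : (0 < N)%N by rewrite NE expn_gt0.
have qR : (2 ^ (b - a) <= ratio)%N.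
  by have := endpoint_ratio ik eA fp fp' PN sc; rewrite qE leq_pmul2r.
have rR : (b - a < ratio)%N by apply: leq_trans qR; exact: ltn_expl.
have [zs [f s t]] := tracks_one_direction ik yb yA mA eA fp fp' PN sc (erefl _) qE.
exists zs; split=> //; apply: tracks_mono t.
  by rewrite /pair_radius /track_radius; lia.
by rewrite /pair_ratio leq_mul // ltnS ltnW.
Qed.

Definition tower_lang : set (seq X) :=
  [set w | rt_accepts (@counter_machine G X m k phi live) w]%classic.

Lemma phi_inj i u v : (i <= k)%N -> masked (live i) u -> masked (live i) v ->
  phi i u = phi i v -> u = v.
Proof.
move=> ik mu mv e; pose f x j : 'rV[int]_m := if j == i then x else 0%R.
have mf x : masked (live i) x -> forall j, masked (live j) (f x j).
  by move=> mx j; rewrite /f; case: eqP => [->|_] //; exact: masked0.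
have := @tw_inj _ _ _ _ T (f u) (f v) (mf _ mu) (mf _ mv) _ i ik.
rewrite /f eqxx; apply; apply: eq_big_nat => j /andP[_ jk].
by case: eqP => [->|].
Qed.

Lemma bvec_inj : injective (@bvec m).
Proof.
move=> b b' /rowP e; apply/ffunP => j; apply: val_inj.
by have := e j; rewrite !mxE /= => /(congr1 (+%R^~ 5%R)); rewrite !subrK => -[].
Qed.

Lemma phi_digit_inj i e e' : (i <= k)%N -> digit (live i) e -> digit (live i) e' ->
  phi i (bvec e) = phi i (bvec e') -> e = e'.
Proof.
by move=> ik /digit_masked m1 /digit_masked m2 /(phi_inj ik m1 m2)/bvec_inj.
Qed.

(** Some coordinate is live, and the digit is odd there. *)
Lemma phi_digit_neq1 i e : (0 < i <= k)%N -> digit (live i) e -> phi i (bvec e) != 1.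
Proof.
move=> ik de; have [a la] := tw_live_ex T ik; have /andP[_ ik'] := ik.
apply/eqP; rewrite -(phi0 ik') => /(phi_inj ik' (digit_masked de) (masked0 _)) e0.
by have /forallP/(_ a) := de; rewrite la e0 row0.
Qed.

Lemma tower_langP w : tower_lang w <->
  exists (ws : nat -> seq X) (bss : nat -> seq (seq 'rV[int]_m)),
    w = \big[cat/[::]]_(0 <= i < k.+1) ws i /\
    forall i, (i <= k)%N -> line (live i) false [::] (bss i) /\
      [seq fsval x | x <- ws i] = map (phi i) (flatten (bss i)).
Proof. exact: counter_machineP phi0 phi_digit_inj phi_digit_neq1 w. Qed.

Lemma word_eval_big (ws : nat -> seq X) a b :
  word_eval (\big[cat/[::]]_(a <= i < b) ws i) = \prod_(a <= i < b) word_eval (ws i).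
Proof.
by apply: (big_morph (@word_eval G X)); [exact: word_eval_cat|exact: word_eval_nil].
Qed.

Lemma tower_lang_represents : represents_all tower_lang.
Proof.
move=> g; have [v mv ->] := tw_surj T g.
have lets (s : seq G) : all (mem X) s -> exists w : seq X, [seq fsval x | x <- w] = s.
  elim: s => [|x s IH] /=; first by exists [::].
  by case/andP=> xX /IH[w <-]; exists ([` xX]%fset :: w).
have ex i : exists p : seq X * seq (seq 'rV[int]_m), (i <= k)%N ->
    [/\ line (live i) false [::] p.2,
      [seq fsval x | x <- p.1] = map (phi i) (flatten p.2) & word_eval p.1 = phi i (v i)].
  have [ik|ik] := leqP i k; last by exists ([::], [::]).
  have [bs ln bsE] := line_ex (mv i).
  have r0 : counted (Nil (cell m)) 0 0 by [].
  have [|w wE] := lets (map (phi i) (flatten bs)).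
    apply/allP => _ /mapP[u ub ->]; apply/tower_gensP; exists i, u.
    by have /allP/(_ _ ub)/andP[] := line_letters ln r0 isT.
  by exists (w, bs); split=> //=; rewrite (eval_map ik wE) bsE.
have [p hp] := choice ex.
exists (\big[cat/[::]]_(0 <= i < k.+1) (p i).1).
  apply/tower_langP; exists (fun i => (p i).1), (fun i => (p i).2); split=> // i ik.
  by have [] := hp i ik.
rewrite word_eval_big; apply: eq_big_nat => i /andP[_ ik].
by have [] := hp i ik.
Qed.

Lemma tower_lang_factors w : tower_lang w ->
  exists (ws : nat -> seq X) (v : nat -> 'rV[int]_m),
  [/\ w = \big[cat/[::]]_(0 <= i < k.+1) ws i, (forall i, masked (live i) (v i)),
    word_eval w = normal_form k phi v &
    forall i, (i <= k)%N -> exists N B P, factor_path i (ws i) N B P /\ P N = v i].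
Proof.
move=> /tower_langP[ws [bss [wE h]]].
pose v i : 'rV[int]_m := if (i <= k)%N then line_pos (bss i) (size (bss i)) else 0%R.
have fpi i : (i <= k)%N -> exists N B P, factor_path i (ws i) N B P /\ P N = v i.
  move=> ik; have [ln we] := h i ik; have [B fp] := line_factor_path ik ln we.
  by exists (size (bss i)), B, (line_pos (bss i)); rewrite /v ik.
exists ws, v; split=> //.
  move=> i; case: (leqP i k) => ik; last by rewrite /v leqNgt ik masked0.
  by have [N [B [P [fp <-]]]] := fpi i ik; exact: fp_masked fp _.
rewrite wE word_eval_big; apply: eq_big_nat => i /andP[_]; rewrite ltnS => ik.
have [ln we] := h i ik; rewrite (eval_map ik we) /v; rewrite ik.
by rewrite /line_pos take_size.
Qed.

Lemma factor_path_eval i (w : seq X) N B P : (i <= k)%N -> factor_path i w N B P ->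
  word_eval w = phi i (P N).
Proof.
move=> ik fp; rewrite (fp_word fp) (eval_blocks ik fp) ?add0n //.
by rewrite (fp_start fp) subr0.
Qed.

Lemma combing_pair_tracks v w : combing_pair tower_lang v w ->
  exists zs, [/\ fst_word zs = v, snd_word zs = w & tracks pair_radius pair_ratio zs 1].
Proof.
case=> /tower_lang_factors[ws [V [-> mV vE fpV]]].
move=> /tower_lang_factors[ws' [V' [-> mV' wE fpV']]] [x xX].
have [j [u [jk su mu xE]]] : exists j u, [/\ (j <= k)%N, small 5 u, masked (live j) u &
    x = phi j u].
  case: xX => [/tower_gensP //|->]; exists 0%N, 0%R.
  by rewrite small0 masked0 phi0.
rewrite wE vE xE (normal_form_mul phiD (@tw_phi_act _ _ _ _ T)) // => nfE.
have V'E i : (i <= k)%N -> V' i = collect act j u V i.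
  pose V2 i := if (i <= k)%N then collect act j u V i else 0%R.
  move=> ik; have -> : collect act j u V i = V2 i by rewrite /V2 ik.
  apply: (@tw_inj _ _ _ _ T V' V2 mV' _ _ i ik).
    move=> l; rewrite /V2; case: ifP => lk; last exact: masked0.
    exact: (collect_masked (@tw_act_unip _ _ _ _ T)).
  rewrite -[LHS]/(normal_form k phi V') nfE; apply: eq_big_nat => l /andP[_].
  by rewrite ltnS /V2 => ->.
(* The offset between the two words before factor i: trivial up to the factor j of the letter, and
   the letter itself behind it. *)
pose y i := if (i <= j)%N then 1 else x.
have yb i : ball 1 (y i).
  rewrite /y; case: ifP => _; first exact: ball1.
  by case: xX => [xX|->]; [exact: (ball_letter [` xX]%fset)|exact: ball1].
have ex i : exists zs, (i <= k)%N -> [/\ fst_word zs = ws i, snd_word zs = ws' i &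
    tracks pair_radius pair_ratio zs (y i)].
  have [ik|ik] := leqP i k; last by exists [::].
  have [N [B [P [fp PV]]]] := fpV i ik; have [N' [B' [P' [fp' PV']]]] := fpV' i ik.
  have VE := V'E i ik.
  suff [zs h] : exists zs, [/\ fst_word zs = ws i, snd_word zs = ws' i &
    tracks pair_radius pair_ratio zs (y i)] by exists zs.
  have [ij|ji] := leqP i j.
    have yE : y i = 1 by rewrite /y ij.
    have sV : small 5 (V' i - V i)%R.
      rewrite VE /collect; move: ij; rewrite leq_eqVlt => /orP[/eqP->|->].
        by rewrite ltnn eqxx addrAC subrr add0r.
      by rewrite subrr small0.
    apply: (@factor_tracks i (y i) 1%:M%R 1%:M%R (V' i - V i)%R (V i - V' i)%R
      _ _ _ _ _ _ _ _ ik (yb i) _ _ _ _ (entries_le1 T) (entries_le1 T) fp fp').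
    - by move=> a _; rewrite yE mulmx1 mulg1 mul1g.
    - by move=> a _; rewrite yE mulmx1 invg1 mulg1 mul1g.
    - by move=> a; rewrite mulmx1.
    - by move=> a; rewrite mulmx1.
    - by rewrite mulmx1 PV PV' addrC subrK.
    - by rewrite mulmx1 PV PV' addrC subrK.
    - exact: sV.
    - by rewrite -opprB; exact: smallN.
  have yE : y i = phi j u by rewrite /y leqNgt ji xE.
  have jik : (j < i <= k)%N by rewrite ji.
  have VE' : V' i = (V i *m act j u i)%R.
    by rewrite VE /collect ltnNge (ltnW ji) gtn_eqF.
  have mN := maskedN mu.
  have sN := smallN su.
  have yA a : masked (live i) a -> phi i a * y i = y i * phi i (a *m act j u i)%R.
    by move=> mv; rewrite yE; exact: tw_phi_act.
  have yA' a : masked (live i) a -> phi i a * (y i)^-1 = (y i)^-1 * phi i (a *m act j (- u) i)%R.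
    by move=> mv; rewrite yE -phiN //; exact: tw_phi_act.
  have mA a u' : masked (live i) a -> masked (live i) (a *m act j u' i)%R.
    exact: (mulmx_act_masked (@tw_act_unip _ _ _ _ T)).
  apply: (@factor_tracks i (y i) (act j u i) (act j (- u)%R i) 0%R 0%R
    _ _ _ _ _ _ _ _ ik (yb i) yA yA' (fun a => mA a u) (fun a => mA a (- u)%R)
    (entries_le_act T ik jk su) (entries_le_act T ik jk sN) fp fp').
  - by rewrite addr0 PV PV'.
  (* [act j (- u) i] undoes [act j u i] on masked vectors, because conjugations by inverse elements
     cancel and [phi i] is injective there. *)
  - rewrite addr0 PV PV' VE'; apply: (phi_inj ik) => //; first by apply/mA/mA.
    apply: (@mulIg _ (y i)); rewrite yA //; apply: (@mulgI _ (y i)^-1).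
    by rewrite mulKg !mulgA -yA' ?mulgVK //; exact: mA.
  - exact: small0.
  - exact: small0.
have [f hf] := choice ex.
exists (flatten [seq f i | i <- iota 0 k.+1]).
have main n i : (i + n = k.+1)%N -> let Z := flatten [seq f l | l <- iota i n] in
    [/\ fst_word Z = \big[cat/[::]]_(i <= l < k.+1) ws l,
        snd_word Z = \big[cat/[::]]_(i <= l < k.+1) ws' l &
        tracks pair_radius pair_ratio Z (y i)].
  elim: n i => [|n IH] i ik.
    rewrite addn0 in ik; rewrite ik !big_geq //=; split=> //.
    by apply: ball_le (yb _); rewrite /pair_radius /track_radius; lia.
  have ik' : (i < k.+1)%N by rewrite -ik -addSnnS leq_addr.
  have ik2 : (i <= k)%N := ik'.
  have [f1 f2 ft] := hf i ik2.
  have [|g1 g2 gt] := IH i.+1; first by rewrite addSnnS.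
  rewrite /= !(big_ltn ik') -g1 -g2 -f1 -f2; split.
  - by rewrite /fst_word map_cat flatten_cat.
  - by rewrite /snd_word map_cat flatten_cat.
  apply: tracks_cat ft _; rewrite f1 f2.
  have [N [B [P [fp PV]]]] := fpV i ik2; have [N' [B' [P' [fp' PV']]]] := fpV' i ik2.
  rewrite (factor_path_eval ik2 fp) (factor_path_eval ik2 fp') PV PV' V'E //.
  suff -> : (phi i (V i))^-1 * y i * phi i (collect act j u V i) = y i.+1 by [].
  rewrite /y /collect; case: ssrnat.ltngtP => ij.
  - by rewrite mulg1 mulVg.
  - apply: (@mulgI _ (phi i (V i))); rewrite xE -!mulgA mulVKg.
    by rewrite tw_phi_act // ij.
  - by rewrite mulg1 ij phiD // mulKg xE.
have := main k.+1 0%N (add0n _); rewrite /y leq0n.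
by [].
Qed.

Lemma tower_bounded_combing : bounded_async_combing R tower_lang.
Proof.
split; first exact: tower_lang_represents.
have C0 : (0 < pair_ratio)%N.
  by rewrite muln_gt0 andbT /ratio /size_ratio addn_gt0 orbT.
exists (pair_radius%:R + 2)%R, (3 * pair_ratio%:R)%R; split.
  by rewrite mulr_gt0 // ltr0n.
move=> v w /combing_pair_tracks[zs [<- <- t]]; exact: tracks_fellow_travel.
Qed.

Lemma tower_real_time_combing : real_time_combing R tower_lang.
Proof.
split; last by exists (@counter_machine G X m k phi live).
have [rep [K [M [_ h]]]] := tower_bounded_combing; split=> //.
by exists K => v w /h[f [ft _]]; exists f.
Qed.

Definition length_const := (k.+1 * (4 * (2 * (growth_const T).+1 ^ d + 7)))%N.

(** A word of at most n letters for the same element bounds the coordinates by [word_growth]. Each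
    line has a number of blocks linear in its endpoint and at most four letters per block on
    average. *)
Lemma tower_lang_length w n : tower_lang w -> (geodesic_length w <= n)%N ->
  (size w <= length_const * n.+1 ^ d)%N.
Proof.
move=> /tower_lang_factors[ws [V [wE mV vE fpV]]].
rewrite /geodesic_length; case: ex_minnP => l /asboolP[v' v'E <-] _ v'n.
have [V2 mV2 [V2E V2g]] := word_growth v'.
have VV i : (i <= k)%N -> V i = V2 i.
  by apply: (@tw_inj _ _ _ _ T V V2 mV mV2); rewrite -/(normal_form k phi V) -vE -v'E V2E.
have n1 : (0 < n.+1 ^ d)%N by rewrite expn_gt0.
have bound i : (i <= k)%N ->
    (size (ws i) <= 4 * (2 * (growth_const T).+1 ^ d + 7) * n.+1 ^ d)%N.
  move=> ik; have [N [B [P [fp PV]]]] := fpV i ik.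
  apply: leq_trans (fp_total fp) _; rewrite -mulnA leq_mul2l /=.
  case: (fp_lower fp) => [->|[a la Na]]; first by rewrite mulnDl; nia.
  apply: leq_trans Na _; rewrite PV VV //.
  have g1 := V2g i a ik la; have /andP[w0 wd] := tw_wt_itv ik la.
  have : (`|(V2 i 0 a)%R| <= (growth_const T).+1 ^ d * n.+1 ^ d)%N.
    apply: leq_trans g1 _; rewrite -expnMn.
    apply: (@leq_trans (((growth_const T).+1 * n.+1) ^ tw_wt T i a)).
      by apply: leq_exp_base; apply: leq_mul; rewrite // ltnW.
    by rewrite leq_pexp2l.
  by rewrite mulnDl; nia.
rewrite wE (big_morph size (@size_cat _) (erefl _)).
apply: (@leq_trans (\sum_(0 <= i < k.+1) 4 * (2 * (growth_const T).+1 ^ d + 7) * n.+1 ^ d)).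
  rewrite !big_nat; apply: leq_sum => i /andP[_ ik]; exact: bound.
by rewrite sum_nat_const_nat subn0 /length_const !mulnA.
Qed.

Theorem tower_combing : has_bounded_real_time_combing_of_degree R G d.
Proof.
exists X, tower_lang; split.
- exact: tower_gens_generating.
- exact: tower_real_time_combing.
- exact: tower_bounded_combing.
have fex n : exists l, (exists w, [/\ tower_lang w, (geodesic_length w <= n)%N & size w = l]) /\
    (forall w, tower_lang w -> (geodesic_length w <= n)%N -> (size w <= l)%N).
  pose Q l := `[< exists w, [/\ tower_lang w, (geodesic_length w <= n)%N & size w = l] >].
  have Qex : exists l, Q l.
    have [w Lw w1] := tower_lang_represents 1; exists (size w).
    apply/asboolP; exists w; split=> //.
    rewrite /geodesic_length; case: ex_minnP => l _ /(_ 0%N) h.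
    apply: leq_trans (h _) _ => //; apply/asboolP; exists [::] => //.
    by rewrite w1 word_eval_nil.
  have Qb l : Q l -> (l <= length_const * n.+1 ^ d)%N.
    by move=> /asboolP[w [Lw gw <-]]; exact: tower_lang_length.
  have [l /asboolP Ql lmax] := ex_maxnP Qex Qb.
  exists l; split=> // w Lw gw; apply: lmax; apply/asboolP; exists w => //.
have [f hf] := choice fex; exists f; first exact: hf.
(* With n + 1 in place of n the bound stays positive at 0, and the degree is exactly d. *)
exists (length_const%:R *: ('X - (-1)%:P) ^+ d)%R; split.
  rewrite size_scale ?size_exp_XsubC // pnatr_eq0 -lt0n /length_const.
  by rewrite !muln_gt0 /= addn_gt0 orbT.
move=> n; have [[w [Lw gw <-]] _] := hf n.
rewrite hornerZ horner_exp !hornerE opprK natr1 -natrX -natrM ler_nat.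
exact: tower_lang_length.
Qed.

End TowerCombing.

(** * The three families of groups *)

Section UnitriangularTower.
Local Open Scope ring_scope.
Variable n : nat.
Implicit Types (v u : 'rV[int]_n.+1) (c : nat).

Definition col_part c v : 'M[int]_n.+1 :=
  \matrix_(a, b) (if (b == c :> nat) && (a < c)%N then v 0 a else 0).

Lemma col_partE c v (a b : 'I_n.+1) :
  col_part c v a b = if (b == c :> nat) && (a < c)%N then v 0 a else 0.
Proof. by rewrite mxE. Qed.

Lemma col_unitriangular c v : unitriangular (1%:M + col_part c v).
Proof.
apply/unitriangularP => a b ba; rewrite !mxE.
have [bc|_] := eqVneq (b : nat) c; last by rewrite addr0.
by rewrite -bc ltnNge ba /= addr0.
Qed.

Definition ut_col c v : UT n.+1 := MkUT (col_unitriangular c v).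

Lemma col_part_mul0 c c' v u : (c' <= c)%N -> col_part c v *m col_part c' u = 0.
Proof.
move=> cc; apply/matrixP => a b; rewrite mxE big1 ?mxE // => l _; rewrite !col_partE.
case: eqP => [lc|_]; last by rewrite mul0r.
by rewrite [(l < c')%N]ltnNge lc cc andbF mulr0.
Qed.

Lemma col_part_mul c' c v u (j : 'I_n.+1) : j = c' :> nat -> (c' < c)%N ->
  col_part c' u *m col_part c v = v 0 j *: col_part c u - v 0 j *:
    \matrix_(a, b) (if (b == c :> nat) && (c' <= a < c)%N then u 0 a else 0).
Proof.
move=> jc cc; apply/matrixP => a b; rewrite mxE (bigD1 j) //= big1; last first.
  move=> l lj; rewrite !col_partE -jc.
  by rewrite (_ : (l == j :> nat) = false) ?mul0r //; apply/negbTE.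
rewrite !col_partE !mxE jc eqxx /= cc andbT addr0.
case: eqP => _ /=; last by rewrite !mulr0 subrr.
have [ac|ca] := ltnP a c'; first by rewrite (ltn_trans ac cc) mulrC mulr0 subr0.
by case: ltnP => _; rewrite !mul0r ?mulr0 subrr.
Qed.

Lemma ut_colD c v u : ut_col c (v + u) = (ut_col c v * ut_col c u)%g.
Proof.
apply: val_inj => /=; rewrite mulmxDl !mulmxDr !mulmx1 !mul1mx col_part_mul0 // addr0.
rewrite -addrA; congr (_ + _); rewrite addrC; apply/matrixP => a b.
by rewrite !mxE; case: ifP; rewrite ?addr0.
Qed.

Definition ut_live c : pred 'I_n.+1 := fun a => (a < c)%N.
(** Transposed because coordinates are rows: v is sent to v minus its entry at c' times the part of
    u above row c'. *)
Definition ut_act c' u (c : nat) : 'M[int]_n.+1 := (1%:M - col_part c' u)^T.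
(** The distance of the entry (a, c) from the diagonal, that is, the depth of its elementary matrix
    in the lower central series. *)
Definition ut_wt c (a : 'I_n.+1) : nat := (c - a)%N.

(** With V and U the column parts, V U = 0, whereas U V is a multiple of u moved to column c; the
    action subtracts that multiple. *)
Lemma ut_col_act c c' u v : (c' < c <= n)%N ->
  (ut_col c v * ut_col c' u = ut_col c' u * ut_col c (v *m ut_act c' u c))%g.
Proof.
case/andP=> cc cn; apply: val_inj => /=.
have c'n : (c' < n.+1)%N by apply: leq_trans cc (leqW cn).
pose j := Ordinal c'n; set w := v *m _.
have wE a : w 0 a = v 0 a - (if (a < c')%N then u 0 a * v 0 j else 0).
  rewrite /w /ut_act linearB /= trmx1 mulmxBr mulmx1 2!mxE; congr (_ - _).
  rewrite mxE (bigD1 j) //= big1; last first.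
    move=> l lj; rewrite mxE col_partE.
    by rewrite (_ : (l == c' :> nat) = false) ?mulr0 //; apply/negbTE.
  by rewrite mxE col_partE eqxx /= addr0; case: ifP => _; rewrite ?mulr0 // mulrC.
clearbody w; rewrite !mulmxDl !mulmxDr !mulmx1 !mul1mx (col_part_mul0 _ _ (ltnW cc)) addr0.
rewrite (col_part_mul _ _ (erefl : j = c' :> nat) cc).
rewrite -!addrA; congr (_ + _).
apply/matrixP => a b; rewrite !mxE !wE ltnn subr0.
have [bc|bc] := eqVneq (b : nat) c; last first.
  by rewrite /= !mulr0 subrr !addr0 add0r.
rewrite bc gtn_eqF //= !add0r.
have [ac|ca] := ltnP a c; last by rewrite andbF !mulr0 subr0 ?addr0.
rewrite andbT; case: ltnP => _; rewrite ?mulr0 ?subr0.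
  by rewrite (mulrC (v 0 j)) subrK.
by rewrite subrr addr0.
Qed.

Lemma truncation_unitriangular c (g : UT n.+1) :
  unitriangular (\matrix_(a, b) if (b < c)%N then g a b else (a == b)%:R).
Proof.
apply/unitriangularP => a b ba; rewrite mxE; case: ifP => // _.
by have /unitriangularP -> := utP g.
Qed.

(** Multiplying by a column factor on the right changes only that column, so this is the product of
    the first c factors of g. *)
Definition truncation c (g : UT n.+1) : UT n.+1 := MkUT (truncation_unitriangular c g).

Lemma truncationE c g a b :
  truncation c g a b = if (b < c)%N then g a b else (a == b)%:R.
Proof. by rewrite mxE. Qed.

Lemma truncation0 g : truncation 0 g = 1%g.
Proof. by apply: val_inj; apply/matrixP => a b; rewrite /= !mxE. Qed.

Lemma truncation_full g : truncation n.+1 g = g.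
Proof. by apply: val_inj; apply/matrixP => a b; rewrite /= mxE ltn_ord. Qed.

Lemma mul_ut_colE (g : UT n.+1) c v (a b : 'I_n.+1) :
  (g * ut_col c v)%g a b = g a b + (if b == c :> nat then (g *m col_part c v) a b else 0).
Proof.
rewrite /= mulmxDr mulmx1 mxE; congr (_ + _); case: eqP => // bc.
rewrite mxE big1 // => l _; rewrite col_partE.
by case: eqP bc => //= _ _; rewrite mulr0.
Qed.

Lemma truncation_mul_ge c i g v : (c <= i)%N -> truncation c (g * ut_col i v)%g = truncation c g.
Proof.
move=> ci; apply: val_inj; apply/matrixP => a b.
rewrite [LHS]truncationE [RHS]truncationE; case: ifP => // bc.
by rewrite mul_ut_colE ltn_eqF ?addr0 // (leq_trans bc).
Qed.

Lemma truncation_prod_ge c N (v : nat -> 'rV[int]_n.+1) : (c <= N)%N ->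
  truncation c (\prod_(0 <= i < N) ut_col i (v i))%g =
  truncation c (\prod_(0 <= i < c) ut_col i (v i))%g.
Proof.
elim: N => [|N IH]; first by rewrite leqn0 => /eqP ->.
rewrite leq_eqVlt => /orP[/eqP -> //|cN].
by rewrite big_nat_recr //= truncation_mul_ge // IH.
Qed.

Lemma truncation_prod c (v : nat -> 'rV[int]_n.+1) :
  truncation c (\prod_(0 <= i < c) ut_col i (v i))%g = (\prod_(0 <= i < c) ut_col i (v i))%g.
Proof.
elim: c => [|c IH]; first by rewrite truncation0 big_geq.
rewrite big_nat_recr //=; set g := (\prod_(0 <= i < c) _)%g in IH *.
apply: val_inj; apply/matrixP => a b; rewrite [LHS]truncationE; case: ltnP => // cb.
by rewrite mul_ut_colE gtn_eqF // addr0 -IH truncationE ltnNge ltnW.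
Qed.

Definition ut_coord (g : UT n.+1) c : 'rV[int]_n.+1 :=
  \row_a if (a < c <= n)%N then
    ((truncation c g)^-1 * truncation c.+1 g)%g a (inord c) else 0.

(** Two consecutive truncations agree outside column c, so their quotient is the identity there. *)
Lemma truncationS c g : (c <= n)%N ->
  truncation c.+1 g = (truncation c g * ut_col c (ut_coord g c))%g.
Proof.
move=> cn; apply: (@mulgI _ (truncation c g)^-1%g); rewrite mulKg.
set h := (_ * _)%g; apply: val_inj; apply/matrixP => a b.
rewrite [RHS]mxE col_partE [1%:M a b]mxE [ut_coord g c 0 a]mxE -/h.
have [bc|bc] := eqVneq (b : nat) c.
  have bE : b = inord c by apply: val_inj; rewrite /= inordK.
  have [ac|ca] := ltnP a c.
    rewrite cn /= (_ : a == b = false) ?add0r -?bE //.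
    by apply/negbTE; rewrite -val_eqE /= bc ltn_eqF.
  rewrite addr0; have /unitriangularP -> // := utP h.
  by rewrite bc.
rewrite addr0; have <- : ((truncation c g)^-1 * truncation c g)%g a b = (a == b)%:R.
  by rewrite mulVg [LHS]mxE.
rewrite [LHS]mxE [RHS]mxE; apply: eq_bigr => l _; congr (_ * _).
by rewrite [LHS]mxE [RHS]mxE ltnS leq_eqVlt (negPf bc).
Qed.

Lemma ut_prod g c : (c <= n.+1)%N ->
  truncation c g = (\prod_(0 <= i < c) ut_col i (ut_coord g i))%g.
Proof.
elim: c => [|c IH] cn; first by rewrite truncation0 big_geq.
by rewrite big_nat_recr //= -IH ?(ltnW cn) // truncationS.
Qed.

Lemma ut_col_inj c u v : (c <= n)%N -> masked (ut_live c) u -> masked (ut_live c) v ->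
  ut_col c u = ut_col c v -> u = v.
Proof.
move=> cn /maskedP mu /maskedP mv e; apply/rowP => a.
have [ac|ca] := ltnP a c; last by rewrite mu ?mv // /ut_live -leqNgt.
have := congr1 (fun g : UT n.+1 => g a (inord c)) e.
by rewrite /= !mxE inordK // eqxx ac /= => /addrI.
Qed.

Definition unitriangular_tower : abelian_tower (UT n.+1) n.+1 n n.
Proof.
refine (@AbelianTower _ _ _ _ ut_col ut_live ut_act ut_wt _ _ _ _ _ _ _).
- by move=> i u v _; exact: ut_colD.
- by move=> i j u v ji _ _; exact: ut_col_act.
- move=> i j u a b /andP[ji _]; rewrite /ut_live /ut_wt => h.
  rewrite /ut_act !mxE [b == a]eq_sym; case: ifP => [/andP[/eqP aj bj]|_]; last by rewrite subr0.
  have bi := ltn_trans bj ji; move: h; rewrite bi aj /= ltn_sub2lE ?bj //.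
  exact: ltnW.
- move=> i a ik; rewrite /ut_live /ut_wt => ai; rewrite subn_gt0 ai /=.
  by apply: leq_trans ik; exact: leq_subr.
- by move=> i /andP[i0 _]; exists ord0.
- move=> g; exists (ut_coord g).
    move=> i; apply/maskedP => a; rewrite /ut_live /ut_coord mxE => /negPf ->.
    by [].
  by rewrite -ut_prod // truncation_full.
- move=> v v' mv mv' e i ik; apply: (ut_col_inj ik (mv i) (mv' i)).
  have trunc c : (c <= n.+1)%N -> (\prod_(0 <= l < c) ut_col l (v l))%g =
      (\prod_(0 <= l < c) ut_col l (v' l))%g.
    by move=> cn; rewrite -truncation_prod -(truncation_prod_ge v cn) e
      truncation_prod_ge // truncation_prod.
  have := trunc i.+1 ik; rewrite !big_nat_recr //= trunc; last exact: leqW.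
  exact: mulgI.
Defined.

End UnitriangularTower.

(** * Integer powers and commutation up to a central element *)

Section IntegerPowers.
Local Open Scope group_scope.
Variable G : groupType.
Implicit Types (x y z g h : G) (a b : int).

Definition zpow x a : G := match a with Posz n => x ^+ n | Negz n => x ^- n.+1 end.

Lemma zpow0 x : zpow x 0%R = 1. Proof. by []. Qed.

Lemma zpowS x a : zpow x (a + 1)%R = zpow x a * x.
Proof.
case: a => [n|[|n]].
- by rewrite -PoszD addn1 /= expgSr.
- by rewrite /= mulVg.
- have -> : (Negz n.+1 + 1)%R = Negz n by rewrite !NegzE; lia.
  by rewrite /= [in RHS]expgS invgM mulgVK.
Qed.

Lemma zpowB1 x a : zpow x (a - 1)%R = zpow x a * x^-1.
Proof. by have := zpowS x (a - 1)%R; rewrite subrK => ->; rewrite mulgK. Qed.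

Lemma int_step_ind (P : int -> Prop) : P 0%R -> (forall a, P a -> P (a + 1)%R) ->
  (forall a, P a -> P (a - 1)%R) -> forall a, P a.
Proof.
move=> P0 PS PB; elim/int_ind => [//|n /PS|n /PB].
  by rewrite -PoszD addn1.
by have -> : (- n%:Z - 1 = - n.+1%:Z)%R by lia.
Qed.

Lemma zpowD x a b : zpow x (a + b)%R = zpow x a * zpow x b.
Proof.
elim/int_step_ind: b => [|b IH|b IH]; first by rewrite addr0 mulg1.
  by rewrite addrA !zpowS IH mulgA.
by rewrite addrA !zpowB1 IH mulgA.
Qed.

Lemma zpowN x a : zpow x (- a)%R = (zpow x a)^-1.
Proof. by apply: (@mulgI _ (zpow x a)); rewrite -zpowD subrr mulgV. Qed.

Lemma zpowM x a b : zpow x (a * b)%R = zpow (zpow x a) b.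
Proof.
elim/int_step_ind: b => [|b IH|b IH]; first by rewrite mulr0.
  by rewrite zpowS -IH mulrDr mulr1 zpowD.
by rewrite zpowB1 -IH mulrBr mulr1 zpowD zpowN.
Qed.

Lemma zpowVg x a : zpow x^-1 a = zpow x (- a)%R.
Proof. by rewrite -mulN1r zpowM. Qed.

Lemma commute_zpow x y a : commute x y -> commute x (zpow y a).
Proof.
move=> xy; elim/int_step_ind: a => [|a IH|a IH]; first exact: commute1.
  by rewrite zpowS; exact: commuteM.
by rewrite zpowB1; apply: commuteM => //; exact: commuteV.
Qed.

Lemma zpowMg x y a : commute x y -> zpow (x * y) a = zpow x a * zpow y a.
Proof.
move=> xy; have yx b : y * zpow x b = zpow x b * y.
  exact/commute_zpow/commute_sym.
elim/int_step_ind: a => [|a IH|a IH]; first by rewrite mulg1.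
  by rewrite !zpowS IH -!mulgA; congr (_ * _); rewrite !mulgA; congr (_ * _);
    rewrite (commute_zpow a xy).
rewrite !zpowB1 IH xy invgM -!mulgA; congr (_ * _); rewrite !mulgA; congr (_ * _).
apply/commute_sym; apply: commute_zpow; apply/commute_sym; apply: commuteV.
exact: commute_sym.
Qed.

Lemma conj_zpow x y a : (zpow x a) ^ y = zpow (x ^ y) a.
Proof.
elim/int_step_ind: a => [|a IH|a IH]; first by rewrite conj1g.
  by rewrite !zpowS conjMg IH.
by rewrite !zpowB1 conjMg conjVg IH.
Qed.

(** Stated so that exponents add when g or h is multiplied by a further element commuting with z. *)
Definition twisted z g h a : Prop := g * h = h * g * zpow z a.

Lemma twistedMl z g g' h a b : commute z g' ->
  twisted z g h a -> twisted z g' h b -> twisted z (g * g') h (a + b)%R.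
Proof.
rewrite /twisted => zg gh gh'.
have gz : g' * zpow z a = zpow z a * g' by apply/commute_zpow/commute_sym.
rewrite -mulgA gh' !mulgA gh zpowD -!mulgA; congr (_ * (_ * _)).
by rewrite !mulgA gz.
Qed.

Lemma twistedMr z g h h' a b : commute z h' ->
  twisted z g h a -> twisted z g h' b -> twisted z g (h * h') (a + b)%R.
Proof.
rewrite /twisted => zh gh gh'.
have hz : h' * zpow z a = zpow z a * h' by apply/commute_zpow/commute_sym.
by rewrite mulgA gh -!mulgA -hz !(mulgA g) gh' addrC zpowD !mulgA.
Qed.

Lemma twisted_prodl z h (I : Type) (r : seq I) (F : I -> G) (a : I -> int) :
  (forall i, commute z (F i)) -> (forall i, twisted z (F i) h (a i)) ->
  twisted z (\prod_(i <- r) F i) h (\sum_(i <- r) a i)%R.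
Proof.
move=> zF t; suff [] : twisted z (\prod_(i <- r) F i) h (\sum_(i <- r) a i)%R /\
    commute z (\prod_(i <- r) F i) by [].
elim: r => [|i r [IH c]].
  by rewrite !big_nil /twisted zpow0 !mulg1 mul1g; split=> //; exact: commute1.
by rewrite !big_cons; split; [exact: twistedMl|exact: commuteM].
Qed.

Lemma twisted_prodr z g (I : Type) (r : seq I) (F : I -> G) (a : I -> int) :
  (forall i, commute z (F i)) -> (forall i, twisted z g (F i) (a i)) ->
  twisted z g (\prod_(i <- r) F i) (\sum_(i <- r) a i)%R.
Proof.
move=> zF t; suff [] : twisted z g (\prod_(i <- r) F i) (\sum_(i <- r) a i)%R /\
    commute z (\prod_(i <- r) F i) by [].
elim: r => [|i r [IH c]].
  by rewrite !big_nil /twisted zpow0 !mulg1 mul1g; split=> //; exact: commute1.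
by rewrite !big_cons; split; [exact: twistedMr|exact: commuteM].
Qed.

(** Conjugation by y sends x^a to x^a z^a; hence conjugation by x^a sends y to y z^(-a), and its
    b-th power gives z^(-ab). *)
Lemma twisted_zpow x y a b : let z := [~ x, y] in commute z x -> commute z y ->
  twisted z (zpow x a) (zpow y b) (a * b)%R.
Proof.
move=> z zx zy; rewrite /twisted zpowM; set X := zpow x a; set Z := zpow z a.
have ZX : commute Z X by apply: commute_sym; apply/commute_zpow/commute_sym/commute_zpow.
have Zy : commute Z y by apply/commute_sym/commute_zpow/commute_sym.
have xy : x ^ y = x * z by rewrite /z commgEl mulVKg.
have Xy : X ^ y = X * Z by rewrite conj_zpow xy zpowMg //; exact: commute_sym.
have yX : y ^ X = y * Z^-1.
  apply: (@mulgI _ X); rewrite -conjgC; apply: (@mulIg _ Z).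
  by rewrite !mulgA mulgVK [RHS]conjgC Xy mulgA.
have YX : (zpow y b) ^ X = zpow y b * (zpow Z b)^-1.
  rewrite conj_zpow yX zpowMg ?zpowVg ?zpowN //.
  exact/commuteV/commute_sym.
have := conjgC (zpow y b) X; rewrite YX => e; rewrite e !mulgA mulgVK //.
Qed.

End IntegerPowers.

(** * Homomorphisms out of quotients and free groups *)

Section QuotientMaps.
Local Open Scope group_scope.
Variables (G : groupType) (N : normal_subgroup G).

Lemma quo_morph x y : quo_class N (x * y) = quo_class N x * quo_class N y.
Proof. by rewrite -quo_classM. Qed.

Lemma quo_class1 : quo_class N 1 = 1. Proof. by []. Qed.

Lemma quo_morphV x : quo_class N x^-1 = (quo_class N x)^-1.
Proof. by apply: (@mulgI _ (quo_class N x)); rewrite -quo_morph !mulgV. Qed.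

Lemma quo_morphR x y : quo_class N [~ x, y] = [~ quo_class N x, quo_class N y].
Proof. by rewrite /commg /conjg !quo_morph !quo_morphV. Qed.

Lemma quo_trivial x : N x -> quo_class N x = 1.
Proof.
move=> Nx; rewrite -quo_class1; apply: quo_classP; rewrite mulg1.
by have [[_ _ NV] _] := normal_setP N; exact: NV.
Qed.

Variables (M : groupType) (f : G -> M).
Hypothesis fM : forall x y, f (x * y) = f x * f y.
Hypothesis fN : forall x, N x -> f x = 1.

Definition quo_map (q : quotient_group N) : M := f (repr q).

Lemma quo_map_class x : quo_map (quo_class N x) = f x.
Proof.
rewrite /quo_map -[in RHS](mulVKg (repr (quo_class N x)) x) fM.
by rewrite (fN (quo_repr N x)) mulg1.
Qed.

Lemma quo_mapM p q : quo_map (p * q) = quo_map p * quo_map q.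
Proof.
by rewrite -[p]quo_classK -[q]quo_classK -quo_morph !quo_map_class fM.
Qed.

End QuotientMaps.

Section Morphisms.
Local Open Scope group_scope.
Variables (G M : groupType) (f : G -> M).
Hypothesis fM : forall x y, f (x * y) = f x * f y.

Lemma mul_morph1 : f 1 = 1.
Proof. by apply: (@mulgI _ (f 1)); rewrite -fM !mulg1. Qed.

Lemma mul_morphV x : f x^-1 = (f x)^-1.
Proof. by apply: (@mulgI _ (f x)); rewrite -fM !mulgV mul_morph1. Qed.

Lemma mul_morphR x y : f [~ x, y] = [~ f x, f y].
Proof. by rewrite /commg /conjg !fM !mul_morphV. Qed.

Lemma mul_morph_zpow x a : f (zpow x a) = zpow (f x) a.
Proof.
elim/int_step_ind: a => [|a IH|a IH]; first exact: mul_morph1.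
  by rewrite !zpowS fM IH.
by rewrite !zpowB1 fM mul_morphV IH.
Qed.

Lemma mul_morph_prod (I : Type) (r : seq I) (P : pred I) (F : I -> G) :
  f (\prod_(i <- r | P i) F i) = \prod_(i <- r | P i) f (F i).
Proof. by apply: (big_morph f fM); exact: mul_morph1. Qed.

Lemma kernel_normal : is_normal [set x | f x = 1]%classic.
Proof.
split; first split=> /= [|x y fx fy|x fx]; first exact: mul_morph1.
- by rewrite fM fx fy mulg1.
- by rewrite mul_morphV fx invg1.
- by move=> x y /= fx; rewrite /conjg !fM mul_morphV fx mul1g mulVg.
Qed.

End Morphisms.

Section FreeGroupMaps.
Local Open Scope group_scope.
Variable I : choiceType.

Lemma free_group_ind (P : free_group I -> Prop) :
  P 1 -> (forall u v, P u -> P v -> P (u * v)) -> (forall u, P u -> P u^-1) ->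
  (forall i, P (free_gen i)) -> forall u, P u.
Proof.
move=> P1 PM PV Pg [s rs]; elim: s rs => [|[i b] s IH] rs.
  by rewrite (_ : FreeGroup rs = 1) //; apply: val_inj.
have rs' := reduced_behead rs.
pose x : free_group I := if b then (free_gen i)^-1 else free_gen i.
have -> : FreeGroup rs = x * FreeGroup rs'.
  apply: val_inj; rewrite /= /x.
  have -> : free_word (if b then (free_gen i)^-1 else free_gen i) = [:: (i, b)].
    by case: b {x rs}.
  rewrite /= /Defs.free_cons; case: s {IH rs'} rs => //= c s /andP[/negPf ->].
  by [].
by apply: PM (IH rs'); rewrite /x; case: b {rs x} => //; exact: PV.
Qed.

Variables (M : groupType) (f : I -> M).

Definition letter_map (a : letter I) : M := if a.2 then (f a.1)^-1 else f a.1.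

Definition free_map (u : free_group I) : M := \prod_(a <- free_word u) letter_map a.

Lemma free_map_gen i : free_map (free_gen i) = f i.
Proof. by rewrite /free_map /= big_seq1. Qed.

Lemma free_mapM u v : free_map (u * v) = free_map u * free_map v.
Proof.
rewrite /free_map; case: u v => [u ru] [v rv] /=.
elim: u {ru} => [|a u IH] /=; first by rewrite big_nil mul1g.
rewrite big_cons -mulgA -IH; move: (foldr _ _ _) => s.
case: s => [|b s]; first by rewrite /= big_seq1 big_nil mulg1.
rewrite /Defs.free_cons; case: (eqVneq b (linv a)) => [->|_]; last by rewrite /= !big_cons.
rewrite big_cons mulgA /letter_map /=.
by case: (a.2); rewrite /= ?mulgV ?mulVg mul1g.
Qed.

End FreeGroupMaps.

(** * Central extensions defined by a bilinear cocycle *)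

Record bilinear_map (V W : zmodType) := BilinearMap {
  bil_fun :> V -> V -> W;
  bilDl : forall x y z, bil_fun (x + y)%R z = (bil_fun x z + bil_fun y z)%R;
  bilDr : forall x y z, bil_fun x (y + z)%R = (bil_fun x y + bil_fun x z)%R }.

(** The argument [b] selects the group law that is put on these pairs. *)
Definition central_ext (V W : zmodType) (b : bilinear_map V W) : Type := (V * W)%type.

Section CentralExtension.
Variables (V W : zmodType) (b : bilinear_map V W).
Local Open Scope ring_scope.
Local Notation central_ext := (central_ext b).

HB.instance Definition _ := Choice.on central_ext.

Lemma bil0l x : b 0 x = 0.
Proof. by apply: (@addrI _ (b 0 x)); rewrite -bilDl !addr0. Qed.
Lemma bil0r x : b x 0 = 0.
Proof. by apply: (@addrI _ (b x 0)); rewrite -bilDr !addr0. Qed.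
Lemma bilNl x y : b (- x) y = - b x y.
Proof. by apply: (@addrI _ (b x y)); rewrite -bilDl !subrr bil0l. Qed.
Lemma bilNr x y : b x (- y) = - b x y.
Proof. by apply: (@addrI _ (b x y)); rewrite -bilDr !subrr bil0r. Qed.

Definition ext_one : central_ext := (0, 0).
Definition ext_mul (x y : central_ext) : central_ext :=
  (x.1 + y.1, x.2 + y.2 + b x.1 y.1).
Definition ext_inv (x : central_ext) : central_ext := (- x.1, - x.2 + b x.1 x.1).

Lemma ext_mulA : associative ext_mul.
Proof.
move=> x y z; rewrite /ext_mul /=; congr pair; first by rewrite addrA.
rewrite bilDl bilDr !addrA [RHS]addrAC; congr (_ + _).
by rewrite [LHS]addrAC; congr (_ + _); rewrite addrAC.
Qed.
Lemma ext_mul1 : left_id ext_one ext_mul.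
Proof. by case=> x s; rewrite /ext_mul /= !add0r bil0l addr0. Qed.
Lemma ext_1mul : right_id ext_one ext_mul.
Proof. by case=> x s; rewrite /ext_mul /= !addr0 bil0r addr0. Qed.
Lemma ext_mulV : left_inverse ext_one ext_inv ext_mul.
Proof.
case=> x s; rewrite /ext_mul /= addNr bilNl; congr pair.
by rewrite addrAC addrK addNr.
Qed.
Lemma ext_Vmul : right_inverse ext_one ext_inv ext_mul.
Proof.
case=> x s; rewrite /ext_mul /= subrr bilNr; congr pair.
by rewrite addrA subrr add0r subrr.
Qed.

HB.instance Definition _ := isGroup.Build central_ext
  ext_mulA ext_mul1 ext_1mul ext_mulV ext_Vmul.

Implicit Types x y : central_ext.

Lemma extM x y : (x * y)%g = (x.1 + y.1, x.2 + y.2 + b x.1 y.1).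
Proof. by []. Qed.

Lemma ext_zpow (v : V) (s : W) a : b v v = 0 ->
  zpow ((v, s) : central_ext) a = (v *~ a, s *~ a).
Proof.
move=> bv; have bva c : b (v *~ c) v = 0.
  elim/int_step_ind: c => [|c IH|c IH]; first by rewrite mulr0z bil0l.
    by rewrite mulrzDr mulr1z bilDl IH bv addr0.
  by rewrite mulrzBr mulr1z bilDl bilNl IH bv subrr.
elim/int_step_ind: a => [|a IH|a IH]; first by rewrite !mulr0z.
  by rewrite zpowS IH extM /= bva addr0 !mulrzDr !mulr1z.
by rewrite zpowB1 IH extM /= bilNr bva bv !mulrzBr !mulr1z subr0 addr0.
Qed.

Lemma ext_commute x y : b x.1 y.1 = b y.1 x.1 -> commute x y.
Proof. by move=> e; rewrite /commute !extM e addrC (addrC x.2). Qed.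

Lemma ext_commutator x y :
  [~ x, y]%g = (0, b x.1 y.1 - b y.1 x.1) :> central_ext.
Proof.
apply: (@mulgI _ (y * x)%g); rewrite -commgC !extM /= bil0r !addr0.
rewrite (addrC x.1) (addrC x.2) -!addrA; congr (_, _ + (_ + _)).
by rewrite addrC subrK.
Qed.

End CentralExtension.

Section Products.
Local Open Scope group_scope.

Lemma prod_zpowD (G : groupType) (I : Type) (r : seq I) (g : I -> G) (a b : I -> int) :
  (forall i j, commute (g i) (g j)) ->
  \prod_(i <- r) zpow (g i) (a i + b i)%R =
  (\prod_(i <- r) zpow (g i) (a i)) * \prod_(i <- r) zpow (g i) (b i).
Proof.
move=> gC; elim: r => [|i r IH]; first by rewrite !big_nil mulg1.
rewrite !big_cons zpowD IH -!mulgA; congr (_ * _); rewrite !mulgA; congr (_ * _).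
apply: commute_prod => j _; apply: commute_zpow; apply/commute_sym/commute_zpow.
exact: gC.
Qed.

Lemma prod_if1 (G : groupType) (I : finType) (i : I) (F : I -> G) :
  (forall j, j != i -> F j = 1) -> \prod_j F j = F i.
Proof.
move=> F1; rewrite -(big_pred1_eq *%g i F) big_mkcond; apply: eq_bigr => j _.
by case: eqVneq => [->|/F1].
Qed.

Variables (V W : zmodType) (b : bilinear_map V W).

Lemma bil_sumr (I : Type) (r : seq I) (p : I -> V) x :
  (forall i, b x (p i) = 0%R) -> b x (\sum_(i <- r) p i)%R = 0%R.
Proof.
move=> h; elim: r => [|i r IH]; first by rewrite big_nil bil0r.
by rewrite big_cons bilDr h IH addr0.
Qed.

Lemma ext_prod (I : Type) (r : seq I) (p : I -> V) (s : I -> W) :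
  (forall i j, b (p i) (p j) = 0%R) ->
  \prod_(i <- r) ((p i, s i) : central_ext b) =
  ((\sum_(i <- r) p i)%R, (\sum_(i <- r) s i)%R).
Proof.
move=> h; elim: r => [|i r IH]; first by rewrite !big_nil.
by rewrite !big_cons IH extM /= bil_sumr ?addr0.
Qed.

(** In an increasing product the left argument of [b] always comes from earlier factors; this suits
    a one-sided cocycle such as [nil_cocycle]. *)
Lemma ext_prod_nat N (p : nat -> V) (s : nat -> W) :
  (forall i j, (i <= j < N)%N -> b (p i) (p j) = 0%R) ->
  \prod_(0 <= i < N) ((p i, s i) : central_ext b) =
  ((\sum_(0 <= i < N) p i)%R, (\sum_(0 <= i < N) s i)%R).
Proof.
move=> h; have hs M n : (M <= n < N)%N -> b (\sum_(0 <= i < M) p i)%R (p n) = 0%R.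
  elim: M => [|M IH] Mn; first by rewrite big_geq // bil0l.
  by rewrite big_nat_recr //= bilDl IH ?h ?addr0 //; lia.
elim: N h hs => [|N IH] h hs; first by rewrite !big_geq.
rewrite !big_nat_recr //= IH => [|i j ij|M n Mn]; [|apply: h; lia|apply: hs; lia].
by rewrite extM /= hs ?leqnn // addr0.
Qed.

End Products.

(** * The Heisenberg group *)

Section HeisenbergTower.
Local Open Scope group_scope.
Variable n : nat.

Notation hN := (NormalSubgroup (normal_closure_normal (@heis_rel n))).
Notation G := (Heisenberg n).

Definition hx (i : 'I_n) : G := quo_class hN (heis_x i).
Definition hy (i : 'I_n) : G := quo_class hN (heis_y i).
Definition hz : G := quo_class hN (heis_z n).

Lemma heis_rel_trivial r : heis_rel r -> quo_class hN r = 1.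
Proof. by move=> hr; apply: quo_trivial => H [_]; apply. Qed.

Lemma commutator_trivial (r s : free_group (heis_index n)) :
  heis_rel [~ r, s] -> commute (quo_class hN r) (quo_class hN s).
Proof.
move=> /heis_rel_trivial h; apply/commgP/eqP.
by rewrite -(quo_morphR hN) h.
Qed.

Lemma hzx i : commute hz (hx i). Proof. exact/commutator_trivial/heis_zx. Qed.
Lemma hzy i : commute hz (hy i). Proof. exact/commutator_trivial/heis_zy. Qed.

Lemma hxx i j : commute (hx i) (hx j).
Proof.
by have [->|ij] := eqVneq i j; [exact: commute_refl|exact/commutator_trivial/heis_xx].
Qed.

Lemma hyy i j : commute (hy i) (hy j).
Proof.
by have [->|ij] := eqVneq i j; [exact: commute_refl|exact/commutator_trivial/heis_yy].
Qed.

Lemma hxy i j : i != j -> commute (hx i) (hy j).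
Proof. by move=> ij; exact/commutator_trivial/heis_xy'. Qed.

Lemma hxyz i : [~ hx i, hy i] = hz.
Proof.
have := heis_rel_trivial (heis_xy i); rewrite quo_morph quo_morphV quo_morphR.
exact: divg1_eq.
Qed.

Definition lower_ord (i : 'I_n) : 'I_n.+1 := widen_ord (leqnSn n) i.

(** Factor 0 is generated by the x_i, factor 1 by the y_i and z. The last coordinate is the exponent
    of z and is dead in factor 0. *)
Definition heis_phi (c : nat) (v : 'rV[int]_n.+1) : G :=
  if c == 0%N then \prod_(i < n) zpow (hx i) (v 0%R (lower_ord i))
  else (\prod_(i < n) zpow (hy i) (v 0%R (lower_ord i))) * zpow hz (v 0%R ord_max).

Definition heis_live (c : nat) : pred 'I_n.+1 := fun a => (c == 0%N) ==> (a < n)%N.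

(** Moving the powers of the x_i across those of the y_i changes only the exponent of z, by minus
    the scalar product of the exponents. *)
Definition heis_act (c : nat) (u : 'rV[int]_n.+1) (c' : nat) : 'M[int]_n.+1 :=
  (1%:M - \matrix_(l, a) (if (a == ord_max) && (l < n)%N then u ord0 l else 0))%R.

Definition heis_wt (c : nat) (a : 'I_n.+1) : nat :=
  if (c == 0%N) || (a < n)%N then 1%N else 2%N.

Lemma heis_phiD c u v : heis_phi c (u + v)%R = heis_phi c u * heis_phi c v.
Proof.
have addE (j : 'I_n.+1) : (u + v)%R 0%R j = (u 0 j + v 0 j)%R by rewrite mxE.
rewrite /heis_phi; case: ifP => _.
  under eq_bigr do rewrite addE.
  by apply: prod_zpowD => i j; exact: hxx.
under eq_bigr do rewrite addE.
rewrite prod_zpowD ?addE ?zpowD; last by move=> i j; exact: hyy.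
rewrite -!mulgA; congr (_ * _); rewrite !mulgA; congr (_ * _).
apply: commute_sym; apply: commute_prod => i _; apply: commute_zpow.
by apply/commute_sym/commute_zpow/commute_sym/hzy.
Qed.

Lemma heis_twisted i j a b : twisted hz (zpow (hy i) a) (zpow (hx j) b)
  (if i == j then - (a * b) else 0)%R.
Proof.
have [->|ij] := eqVneq i j.
  have yx : [~ hy j, hx j] = hz^-1 by rewrite -invgR hxyz.
  have zV g : commute hz g -> commute hz^-1 g.
    by move=> zg; apply/commute_sym/commuteV/commute_sym.
  have := @twisted_zpow _ (hy j) (hx j) a b; rewrite yx /=.
  move=> /(_ (zV _ (hzy j)) (zV _ (hzx j))).
  by rewrite /twisted zpowVg.
rewrite /twisted zpow0 mulg1.
apply: commute_zpow; apply/commute_sym/commute_zpow.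
by apply: hxy; rewrite eq_sym.
Qed.

Lemma heis_mulmx_act c c' (u v : 'rV[int]_n.+1) (a : 'I_n.+1) :
  (v *m heis_act c u c')%R 0%R a =
  (v 0 a - if a == ord_max then \sum_(i < n) v 0 (lower_ord i) * u 0 (lower_ord i) else 0)%R.
Proof.
rewrite /heis_act mulmxBr mulmx1 2!mxE; congr (_ - _)%R; rewrite mxE.
case: eqP => [->|/eqP am].
  rewrite big_ord_recr /= [X in (_ + _ * X)%R]mxE eqxx ltnn mulr0 addr0.
  apply: eq_bigr => i _; rewrite mxE eqxx /= ltn_ord.
  by congr (_ * u _ _)%R; apply: val_inj.
by rewrite big1 // => l _; rewrite mxE (negPf am) mulr0.
Qed.

Lemma heis_phi_act (u v : 'rV[int]_n.+1) :
  heis_phi 1 v * heis_phi 0 u = heis_phi 0 u * heis_phi 1 (v *m heis_act 0 u 1)%R.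
Proof.
rewrite /heis_phi /=; set X := \prod_(i < n) zpow (hx i) _.
have -> : \prod_(i < n) zpow (hy i) ((v *m heis_act 0 u 1)%R 0%R (lower_ord i)) =
    \prod_(i < n) zpow (hy i) (v 0%R (lower_ord i)).
  apply: eq_bigr => i _; rewrite heis_mulmx_act.
  by rewrite (_ : lower_ord i == ord_max = false) ?subr0 // -val_eqE /= ltn_eqF.
set Y := \prod_(i < n) zpow (hy i) _; rewrite heis_mulmx_act eqxx.
have t : twisted hz Y X (- \sum_(i < n) v 0 (lower_ord i) * u 0 (lower_ord i))%R.
  rewrite -sumrN; rewrite (_ : (\sum_i - _)%R = (\sum_(i < n) \sum_(j < n)
      if i == j then - (v 0 (lower_ord i) * u 0 (lower_ord j)) else 0)%R).
    apply: twisted_prodl => i; first exact/commute_zpow/hzy.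
    apply: twisted_prodr => j; first exact/commute_zpow/hzx.
    exact: heis_twisted.
  apply: eq_bigr => i _; rewrite (bigD1 i) //= eqxx big1 ?addr0 // => j ji.
  by rewrite eq_sym (negPf ji).
have zX : commute X (zpow hz (v 0%R ord_max)).
  apply/commute_sym; apply: commute_prod => i _; apply: commute_zpow.
  by apply/commute_sym/commute_zpow/commute_sym/hzx.
rewrite -mulgA -zX !mulgA t -!mulgA; congr (_ * (_ * _)).
by rewrite -zpowD addrC.
Qed.

Lemma heis_generated : generated [set g : G | exists i u,
    [/\ (i <= 1)%N, masked (heis_live i) u & g = heis_phi i u]]%classic = [set: G]%classic.
Proof.
set S := [set g : G | _]%classic; apply/seteqP; split=> // g _.
have [g1 gM gV] := generated_subgroup S.
have gen s : S s -> generated S s by move=> Ss H [_]; apply.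
rewrite -[g]quo_classK; elim/free_group_ind: (repr g) => [|u v hu hv|u hu|[[i|i]|[]]].
- exact: g1.
- by rewrite quo_morph; exact: gM.
- by rewrite quo_morphV; exact: gV.
- apply: gen; exists 0%N, (delta_mx 0 (lower_ord i))%R; split=> //.
    apply/maskedP => j; rewrite /heis_live /= mxE eqxx /= => nj.
    by case: eqP => //= ji; rewrite ji /= ltn_ord in nj.
  rewrite /heis_phi /= (@prod_if1 _ _ i) => [|j ji]; first by rewrite mxE !eqxx.
  by rewrite mxE (_ : lower_ord j == lower_ord i = false) // -val_eqE /=; apply/negbTE.
- apply: gen; exists 1%N, (delta_mx 0 (lower_ord i))%R; split=> //.
    by apply/maskedP.
  rewrite /heis_phi /= (@prod_if1 _ _ i) => [|j ji].
    by rewrite !mxE !eqxx /= (_ : ord_max == lower_ord i = false) ?mulg1 // -val_eqE /= gtn_eqF.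
  by rewrite mxE (_ : lower_ord j == lower_ord i = false) // -val_eqE /=; apply/negbTE.
- apply: gen; exists 1%N, (delta_mx 0 ord_max)%R; split=> //.
    by apply/maskedP.
  rewrite /heis_phi /= big1 ?mul1g; last first.
    by move=> i _; rewrite mxE (_ : lower_ord i == ord_max = false) // -val_eqE /= ltn_eqF.
  by rewrite mxE !eqxx.
Qed.

Definition heis_vec : zmodType := ('rV[int]_n * 'rV[int]_n)%type.

(** The correction to the exponent of z when two normal forms x^a y^b z^c are multiplied. *)
Definition heis_cocycle (p q : heis_vec) : int := (- \sum_i p.2 0 i * q.1 0 i)%R.

Lemma heis_cocycleDl p q r :
  heis_cocycle (p + q)%R r = (heis_cocycle p r + heis_cocycle q r)%R.
Proof.
rewrite /heis_cocycle -opprD -big_split /=; congr (- _)%R; apply: eq_bigr => i _.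
by rewrite mxE mulrDl.
Qed.

Lemma heis_cocycleDr p q r :
  heis_cocycle p (q + r)%R = (heis_cocycle p q + heis_cocycle p r)%R.
Proof.
rewrite /heis_cocycle -opprD -big_split /=; congr (- _)%R; apply: eq_bigr => i _.
by rewrite mxE mulrDr.
Qed.

Definition heis_bilinear := BilinearMap heis_cocycleDl heis_cocycleDr.
Notation M := (central_ext heis_bilinear).

Definition heis_gen (i : heis_index n) : M :=
  match i with
  | inl (inl i) => ((delta_mx 0 i, 0), 0)%R
  | inl (inr i) => ((0, delta_mx 0 i), 0)%R
  | inr _ => (0, 1)%R
  end.

Lemma heis_cocycle_fst (a : 'rV[int]_n) q : heis_cocycle (a, 0)%R q = 0%R.
Proof. by rewrite /heis_cocycle big1 ?oppr0 // => i _; rewrite mxE mul0r. Qed.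

Lemma heis_cocycle_snd (b : 'rV[int]_n) p : heis_cocycle p (0, b)%R = 0%R.
Proof. by rewrite /heis_cocycle big1 ?oppr0 // => i _; rewrite mxE mulr0. Qed.

Lemma heis_cocycle_delta i j :
  heis_cocycle (0, delta_mx 0 i)%R (delta_mx 0 j, 0)%R = (- (i == j)%:R)%R.
Proof.
rewrite /heis_cocycle (bigD1 i) //= big1; last first.
  by move=> l li; rewrite mxE (negPf li) andbF mul0r.
by rewrite !mxE !eqxx mul1r addr0.
Qed.

Lemma heis_rel_kernel r : heis_rel r -> free_map heis_gen r = 1.
Proof.
have fM := free_mapM heis_gen; have fR := mul_morphR fM.
have comm (p q : free_group (heis_index n)) :
    heis_cocycle (free_map heis_gen p).1 (free_map heis_gen q).1 =
    heis_cocycle (free_map heis_gen q).1 (free_map heis_gen p).1 ->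
    free_map heis_gen [~ p, q] = 1.
  by move=> e; rewrite fR; apply/eqP/commgP/ext_commute.
have b0 p : heis_cocycle (0%R : heis_vec) p = heis_cocycle p (0%R : heis_vec).
  exact: (etrans (bil0l heis_bilinear p) (esym (bil0r heis_bilinear p))).
case=> [i|i|i|i j ij|i j ij|i j ij]; last 3 first.
- by apply: comm; rewrite !free_map_gen /= !heis_cocycle_fst.
- by apply: comm; rewrite !free_map_gen /= !heis_cocycle_snd.
- apply: comm; rewrite !free_map_gen /= heis_cocycle_fst heis_cocycle_delta.
  by rewrite eq_sym (negPf ij) oppr0.
- by apply: comm; rewrite !free_map_gen; exact: b0.
- by apply: comm; rewrite !free_map_gen; exact: b0.
rewrite fM (mul_morphV fM) fR !free_map_gen ext_commutator /=.
by rewrite heis_cocycle_fst heis_cocycle_delta eqxx sub0r opprK mulgV.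
Qed.

Lemma heis_kernel r : hN r -> free_map heis_gen r = 1.
Proof.
move=> hr; apply: (hr [set x | free_map heis_gen x = 1]%classic); split.
  exact/kernel_normal/free_mapM.
by move=> x; exact: heis_rel_kernel.
Qed.

Definition heis_model : G -> M := quo_map (free_map heis_gen).

Lemma heis_modelM p q : heis_model (p * q) = heis_model p * heis_model q.
Proof. exact: quo_mapM (free_mapM _) heis_kernel p q. Qed.

Lemma heis_model_class x : heis_model (quo_class hN x) = free_map heis_gen x.
Proof. exact: quo_map_class (free_mapM _) heis_kernel x. Qed.

Lemma pair_mulrz (a b : 'rV[int]_n) (c : int) :
  (((a, b) : heis_vec) *~ c = (c *: a, c *: b))%R.
Proof.
elim/int_step_ind: c => [|c IH|c IH]; first by rewrite mulr0z !scale0r.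
  by rewrite mulrzDr IH mulr1z !scalerDl !scale1r.
by rewrite mulrzBr IH mulr1z !scalerBl !scale1r.
Qed.

Lemma heis_model_phi0 v : heis_model (heis_phi 0 v) =
  ((\sum_(i < n) v 0 (lower_ord i) *: delta_mx 0 i, 0), 0)%R.
Proof.
rewrite /heis_phi /= (mul_morph_prod heis_modelM).
rewrite (eq_bigr (fun i => ((v 0 (lower_ord i) *: delta_mx 0 i, 0), 0)%R : M)); last first.
  move=> i _; rewrite (mul_morph_zpow heis_modelM) heis_model_class free_map_gen.
  rewrite ext_zpow; last exact: heis_cocycle_fst.
  by rewrite pair_mulrz scaler0 mul0rz.
rewrite ext_prod; last by move=> i j; exact: heis_cocycle_fst.
congr pair; last by rewrite big1.
by rewrite [LHS]surjective_pairing (raddf_sum fst) (raddf_sum snd) /= big1_eq.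
Qed.

Lemma heis_model_phi1 v : heis_model (heis_phi 1 v) =
  ((0, \sum_(i < n) v 0 (lower_ord i) *: delta_mx 0 i), v 0 ord_max)%R.
Proof.
rewrite /heis_phi /= heis_modelM (mul_morph_prod heis_modelM).
rewrite (eq_bigr (fun i => ((0, v 0 (lower_ord i) *: delta_mx 0 i), 0)%R : M)); last first.
  move=> i _; rewrite (mul_morph_zpow heis_modelM) heis_model_class free_map_gen.
  rewrite ext_zpow; last exact: heis_cocycle_snd.
  by rewrite pair_mulrz scaler0 mul0rz.
rewrite ext_prod; last by move=> i j; exact: heis_cocycle_snd.
rewrite (mul_morph_zpow heis_modelM) heis_model_class free_map_gen.
rewrite ext_zpow; last exact: (bil0l heis_bilinear).
rewrite mul0rz extM /= (bil0r heis_bilinear : forall p, heis_cocycle p 0%R = 0%R).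
rewrite addr0 big1_eq add0r intz addr0; congr pair.
by rewrite [LHS]surjective_pairing (raddf_sum fst) (raddf_sum snd) /= big1_eq.
Qed.

(** The cocycle vanishes when an x-part stands to the left of a y-part, so the image of a normal
    form in the model displays its coordinates. *)
Lemma heis_inj (v v' : nat -> 'rV[int]_n.+1) :
  (forall i, masked (heis_live i) (v i)) -> (forall i, masked (heis_live i) (v' i)) ->
  \prod_(0 <= i < 2) heis_phi i (v i) = \prod_(0 <= i < 2) heis_phi i (v' i) ->
  forall i, (i <= 1)%N -> v i = v' i.
Proof.
have split2 (w : nat -> 'rV[int]_n.+1) :
    heis_model (\prod_(0 <= i < 2) heis_phi i (w i)) =
    heis_model (heis_phi 0 (w 0%N)) * heis_model (heis_phi 1 (w 1%N)).
  by rewrite -heis_modelM !big_nat_recl // big_geq // mulg1.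
move=> mv mv' /(congr1 heis_model); rewrite !split2.
rewrite !heis_model_phi0 !heis_model_phi1 !extM /= !heis_cocycle_snd !addr0 !add0r.
case; rewrite !addr0 !add0r => e0 e1 e2.
have coef (u : 'rV[int]_n.+1) (j : 'I_n) :
    ((\sum_(i < n) u 0 (lower_ord i) *: (delta_mx 0 i : 'rV_n)) 0 j = u 0 (lower_ord j))%R.
  rewrite summxE (bigD1 j) //= big1 => [|l lj]; first by rewrite !mxE !eqxx mulr1 addr0.
  by rewrite !mxE eq_sym (negPf lj) mulr0.
have split_ord (a : 'I_n.+1) : a = ord_max \/ exists j, a = lower_ord j.
  have [an|na] := ltnP a n; first by right; exists (Ordinal an); apply: val_inj.
  by left; apply: val_inj => /=; apply/eqP; rewrite eqn_leq -ltnS ltn_ord.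
case=> [|[|//]] _; apply/rowP => a; have [->|[j ->]] := split_ord a.
- have /maskedP m := mv 0%N; have /maskedP m' := mv' 0%N.
  by rewrite m ?m' // /heis_live /= ltnn.
- by have := congr1 (fun w : 'rV_n => w 0%R j) e0; rewrite !coef.
- exact: e2.
- by have := congr1 (fun w : 'rV_n => w 0%R j) e1; rewrite !coef.
Qed.

Definition heisenberg_tower : abelian_tower G n.+1 1 2.
Proof.
have two i j : (j < i <= 1)%N -> i = 1%N /\ j = 0%N by lia.
have phiD i u v : (i <= 1)%N -> heis_phi i (u + v)%R = heis_phi i u * heis_phi i v.
  by move=> _; exact: heis_phiD.
have phi_act i j u v : (j < i <= 1)%N ->
    masked (heis_live j) u -> masked (heis_live i) v ->
    heis_phi i v * heis_phi j u = heis_phi j u * heis_phi i (v *m heis_act j u i)%R.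
  by move=> /two[-> ->] _ _; exact: heis_phi_act.
have act_unip i j u a b : (j < i <= 1)%N ->
    ~~ (heis_live i b && (heis_wt i a < heis_wt i b)%N) ->
    heis_act j u i a b = (a == b)%:R%R.
  move=> /two[-> ->]; rewrite /heis_live /heis_wt /= => h.
  rewrite /heis_act !mxE; case: ifP => [/andP[/eqP bm an]|_]; last by rewrite subr0.
  by move: h; rewrite an bm ltnn.
apply: (@AbelianTower _ _ _ _ heis_phi heis_live heis_act heis_wt) heis_inj => //.
- by move=> i a _; rewrite /heis_wt; case: ifP.
- by move=> i /andP[i0 _]; exists ord_max; rewrite /heis_live gtn_eqF.
- exact: normal_form_surj phi_act act_unip heis_generated.
Defined.

End HeisenbergTower.

(** * The free nilpotent group of class 2 *)

Section FreeNilpotentTower.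
Local Open Scope group_scope.
Variable n : nat.

Notation hN := (NormalSubgroup (@lower_central_normal (free_group 'I_n.+1) 3)).
Notation G := (free_nilpotent2 n.+1).

Definition nil_gen (i : 'I_n.+1) : G := quo_class hN (free_gen i).

Lemma nil_commutator_central (p q r : G) : commute [~ p, q] r.
Proof.
have lift (g : G) : exists x, g = quo_class hN x by exists (repr g); rewrite quo_classK.
have [[x ->] [y ->] [z ->]] := And3 (lift p) (lift q) (lift r).
apply/commgP/eqP; rewrite -(quo_morphR hN x y) -(quo_morphR hN [~ x, y] z).
apply: quo_trivial => H [_]; apply=> /=.
by exists [~ x, y]; [move=> K [_]; apply; exists x => //; exists y|exists z].
Qed.

Definition nil_coord (c : nat) (v : 'rV[int]_n.+1) (a : 'I_n.+1) : int :=
  if (a < c)%N then v ord0 a else 0%R.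

(** Factor c consists of the generator x_c and the commutators [x_a, x_c] with a < c. Entry c of v
    is the exponent of x_c; the entries below it are those of the commutators. *)
Definition nil_phi (c : nat) (v : 'rV[int]_n.+1) : G :=
  let i : 'I_n.+1 := inord c in
  zpow (nil_gen i) (v ord0 i) *
  \prod_a zpow [~ nil_gen a, nil_gen i] (nil_coord c v a).

Definition nil_live (c : nat) : pred 'I_n.+1 := fun a => (a <= c)%N.

(** Since x_i^s x_j^t = x_j^t x_i^s [x_j, x_i]^(-st), only the entry j of factor i changes. *)
Definition nil_act (j : nat) (u : 'rV[int]_n.+1) (i : nat) : 'M[int]_n.+1 :=
  (1%:M - \matrix_(l, a) (if (l == i :> nat) && (a == j :> nat) then u ord0 a else 0))%R.

Definition nil_wt (c : nat) (a : 'I_n.+1) : nat := if a == c :> nat then 1%N else 2%N.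

Lemma nil_phiD c u v : nil_phi c (u + v)%R = nil_phi c u * nil_phi c v.
Proof.
rewrite /nil_phi mxE; set i := inord c.
rewrite (eq_bigr (fun a => zpow [~ nil_gen a, nil_gen i]
    (nil_coord c u a + nil_coord c v a)%R)); last first.
  by move=> a _; rewrite /nil_coord mxE; case: ifP; rewrite ?addr0.
rewrite prod_zpowD => [|a b]; last exact: nil_commutator_central.
rewrite zpowD -!mulgA; congr (_ * _); rewrite !mulgA; congr (_ * _).
apply: commute_prod => a _; apply: commute_zpow; apply/commute_sym.
exact: nil_commutator_central.
Qed.

Lemma nil_mulmx_act i j (u v : 'rV[int]_n.+1) (a : 'I_n.+1) : (i <= n)%N ->
  (v *m nil_act j u i)%R ord0 a =
  (v ord0 a - if a == j :> nat then v ord0 (inord i) * u ord0 a else 0)%R.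
Proof.
move=> ilen; rewrite /nil_act mulmxBr mulmx1 2!mxE; congr (_ - _)%R; rewrite mxE.
rewrite (bigD1 (inord i)) //= mxE inordK ?ltnS // eqxx /= big1 ?addr0 => [|l li].
  by case: ifP => _; rewrite ?mulr0.
rewrite mxE (_ : (l == i :> nat) = false) ?mulr0 //.
by apply: contraNF li => /eqP <-; rewrite inord_val.
Qed.

Lemma nil_phi_act i j (u v : 'rV[int]_n.+1) : (j < i <= n)%N ->
  nil_phi i v * nil_phi j u = nil_phi j u * nil_phi i (v *m nil_act j u i)%R.
Proof.
move=> /andP[ji ilen]; have jlen : (j <= n)%N by lia.
rewrite /nil_phi nil_mulmx_act // inordK ?ltnS // gtn_eqF // subr0.
set x := nil_gen (inord i); set y := nil_gen (inord j).
set X := zpow x _; set Y := zpow y _; set D := \prod_a _ (_ j _ _).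
set C := \prod_a _ (_ i v _); set t := (v ord0 (inord i) * u ord0 (inord j))%R.
have -> : \prod_a zpow [~ nil_gen a, x] (nil_coord i (v *m nil_act j u i)%R a) =
    C * zpow [~ y, x] (- t)%R.
  rewrite (eq_bigr (fun a => zpow [~ nil_gen a, x] (nil_coord i v a +
      (if a == inord j then - t else 0))%R)); last first.
    move=> a _; rewrite /nil_coord nil_mulmx_act // -val_eqE /= inordK ?ltnS //.
    case: eqP => [aj|_]; last by rewrite subr0 addr0.
    by rewrite aj ji /t -aj inord_val.
  rewrite prod_zpowD => [|a b]; last exact: nil_commutator_central.
  congr (_ * _); rewrite (@prod_if1 _ _ (inord j)) ?eqxx // => a /negPf aj.
  by rewrite aj zpow0.
have prod_central c (w : 'rV[int]_n.+1) g :
    commute (\prod_a zpow [~ nil_gen a, nil_gen (inord c)] (nil_coord c w a)) g.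
  apply/commute_sym; apply: commute_prod => a _; apply: commute_zpow.
  exact/commute_sym/nil_commutator_central.
have XY : X * Y = Y * X * zpow [~ y, x] (- t)%R.
  rewrite -zpowVg invgR; apply: twisted_zpow; exact: nil_commutator_central.
have CC g : commute C g by exact: prod_central.
have DC g : commute D g by exact: prod_central.
rewrite -mulgA (CC (Y * D)) (CC (zpow _ _)) !mulgA; congr (_ * _).
by rewrite XY -!mulgA -(DC (zpow _ _)) !mulgA -(mulgA Y D X) (DC X) !mulgA.
Qed.

Lemma nil_phi_gen (i : 'I_n.+1) : nil_phi i (delta_mx 0 i)%R = nil_gen i.
Proof.
rewrite /nil_phi inord_val mxE !eqxx big1 ?mulg1 // => a _.
rewrite /nil_coord mxE /=; case: ifP => // ai.
by rewrite -val_eqE /= ltn_eqF.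
Qed.

Lemma nil_generated : generated [set g : G | exists i u,
    [/\ (i <= n)%N, masked (nil_live i) u & g = nil_phi i u]]%classic = [set: G]%classic.
Proof.
set S := [set g : G | _]%classic; apply/seteqP; split=> // g _.
have [g1 gM gV] := generated_subgroup S.
rewrite -[g]quo_classK; elim/free_group_ind: (repr g) => [|u v hu hv|u hu|i].
- exact: g1.
- by rewrite quo_morph; exact: gM.
- by rewrite quo_morphV; exact: gV.
- move=> H [_]; apply; exists (i : nat), (delta_mx 0 i)%R; split.
  + by rewrite -ltnS.
  + apply/maskedP => a; rewrite /nil_live mxE eqxx /= => ai.
    by case: eqP ai => // ->; rewrite leqnn.
  + by rewrite nil_phi_gen.
Qed.

(** Entry (c, l) counts the crossings of x_c over x_l when a product is sorted. It is the exponent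
    of [x_c, x_l], whence the minus signs for [x_l, x_c] below. *)
Definition nil_cocycle (p q : 'rV[int]_n.+1) : 'M[int]_n.+1 :=
  (\matrix_(c, l) if (l < c)%N then p ord0 c * q ord0 l else 0)%R.

Lemma nil_cocycleDl p q r : nil_cocycle (p + q)%R r = (nil_cocycle p r + nil_cocycle q r)%R.
Proof. by apply/matrixP => c l; rewrite !mxE; case: ifP => _; rewrite ?mulrDl ?addr0. Qed.

Lemma nil_cocycleDr p q r : nil_cocycle p (q + r)%R = (nil_cocycle p q + nil_cocycle p r)%R.
Proof. by apply/matrixP => c l; rewrite !mxE; case: ifP => _; rewrite ?mulrDr ?addr0. Qed.

Definition nil_bilinear := BilinearMap nil_cocycleDl nil_cocycleDr.
Notation M := (central_ext nil_bilinear).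

Lemma nil_cocycle_delta (i j : 'I_n.+1) (s t : int) :
  nil_cocycle (s *: delta_mx 0 i)%R (t *: delta_mx 0 j)%R =
  (if (j < i)%N then (s * t) *: delta_mx i j else 0)%R.
Proof.
apply/matrixP => c l; rewrite !mxE !eqxx /=; case: (ltnP j i) => ji; rewrite !mxE.
  by case: (eqVneq c i) => [->|_]; case: (eqVneq l j) => [->|_];
    rewrite /= ?ji ?mulr1 ?mulr0 ?mul0r ?if_same.
by case: (eqVneq c i) => [->|_]; case: (eqVneq l j) => [->|_];
  rewrite /= ?(ltnNge j) ?ji ?mulr0 ?mul0r ?if_same.
Qed.

Definition nil_letter (i : 'I_n.+1) : M := (delta_mx 0 i, 0)%R.

(** Commutators have first component 0 in the model, and such elements are central there. *)
Lemma nil_kernel r : hN r -> free_map nil_letter r = 1.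
Proof.
have fM := free_mapM nil_letter; have fR := mul_morphR fM.
have comm1 p q : (free_map nil_letter [~ p, q]).1 = 0%R.
  by rewrite fR ext_commutator.
have sub2 p : commutator_subgroup [set: free_group 'I_n.+1] [set: free_group 'I_n.+1] p ->
    (free_map nil_letter p).1 = 0%R.
  move=> hp; apply: (hp [set x | (free_map nil_letter x).1 = 0%R]%classic); split.
    split=> /= [|x y hx hy|x hx]; first by rewrite (mul_morph1 fM).
      by rewrite fM /= hx hy addr0.
    by rewrite (mul_morphV fM) /= hx oppr0.
  by move=> _ [a _ [b _ <-]] /=.
move=> hr; apply: (hr [set x | free_map nil_letter x = 1]%classic); split.
  by have [] := kernel_normal fM.
move=> _ [a ha [b _ <-]] /=; rewrite fR; apply/eqP/commgP/ext_commute.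
by rewrite (sub2 a ha) bil0l bil0r.
Qed.

Definition nil_model : G -> M := quo_map (free_map nil_letter).

Lemma nil_modelM p q : nil_model (p * q) = nil_model p * nil_model q.
Proof. exact: quo_mapM (free_mapM _) nil_kernel p q. Qed.

Lemma nil_model_gen i : nil_model (nil_gen i) = nil_letter i.
Proof.
by rewrite /nil_model (quo_map_class (free_mapM _) nil_kernel) free_map_gen.
Qed.

Lemma mulrz_scale (V : lmodType int) (v : V) (c : int) : (v *~ c = c *: v)%R.
Proof. by rewrite -scaler_int intz. Qed.

Lemma nil_model_phi c v : (c <= n)%N -> nil_model (nil_phi c v) =
  (v ord0 (inord c) *: delta_mx 0 (inord c),
   \matrix_(l, a) (if l == inord c then - nil_coord c v a else 0))%R.
Proof.
move=> cn; have ic : (inord c : 'I_n.+1) = c :> nat by rewrite inordK.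
have deltaE (i j : 'I_n.+1) : nil_cocycle (delta_mx ord0 i) (delta_mx ord0 j) =
    (if (j < i)%N then delta_mx i j else 0)%R.
  have := nil_cocycle_delta i j 1%R 1%R; rewrite mulr1 !scale1r; exact.
rewrite /nil_phi nil_modelM (mul_morph_prod nil_modelM) (mul_morph_zpow nil_modelM).
rewrite nil_model_gen ext_zpow; last by rewrite /= deltaE ltnn.
rewrite (eq_bigr (fun a => (0, - nil_coord c v a *: delta_mx (inord c) a)%R : M)); last first.
  move=> a _; rewrite (mul_morph_zpow nil_modelM) (mul_morphR nil_modelM) !nil_model_gen.
  rewrite ext_commutator ext_zpow ?bil0l // mul0rz mulrz_scale /= !deltaE ic.
  rewrite /nil_coord; case: ltnP => ac; last by rewrite oppr0 !scale0r.
  by rewrite ltnNge ltnW //= sub0r scaleNr scalerN.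
rewrite ext_prod; last by move=> *; exact: bil0l.
rewrite extM /= big1_eq addr0
  (bil0r nil_bilinear : forall p, nil_cocycle p 0%R = 0%R) mul0rz add0r addr0 mulrz_scale.
congr pair; apply/matrixP => l a; rewrite summxE mxE (bigD1 a) //= big1 => [|a' aa'].
  by rewrite !mxE eqxx andbT addr0; case: eqP; rewrite ?mulr1 ?mulr0.
by rewrite !mxE (eq_sym a) (negPf aa') andbF mulr0.
Qed.

(** The factors appear in increasing order, so the cocycle adds nothing: the first component
    displays the exponents of the generators, and row i of the second those of the commutators in
    factor i. *)
Lemma nil_inj (v v' : nat -> 'rV[int]_n.+1) :
  (forall i, masked (nil_live i) (v i)) -> (forall i, masked (nil_live i) (v' i)) ->
  \prod_(0 <= i < n.+1) nil_phi i (v i) = \prod_(0 <= i < n.+1) nil_phi i (v' i) ->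
  forall i, (i <= n)%N -> v i = v' i.
Proof.
move=> mv mv' /(congr1 nil_model).
pose p (w : nat -> 'rV[int]_n.+1) i : 'rV[int]_n.+1 :=
  (w i ord0 (inord i) *: delta_mx 0 (inord i))%R.
pose s (w : nat -> 'rV[int]_n.+1) i : 'M[int]_n.+1 :=
  (\matrix_(l, a) (if l == inord i then - nil_coord i (w i) a else 0))%R.
have modelE w : nil_model (\prod_(0 <= i < n.+1) nil_phi i (w i)) =
    ((\sum_(0 <= i < n.+1) p w i)%R, (\sum_(0 <= i < n.+1) s w i)%R).
  rewrite (mul_morph_prod nil_modelM) big_nat.
  rewrite (eq_bigr (fun i => (p w i, s w i) : M)); last first.
    by move=> i /andP[_ ilen]; rewrite nil_model_phi.
  rewrite -big_nat ext_prod_nat // => i j /andP[ij jn].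
  rewrite /= nil_cocycle_delta !inordK //; last exact: leq_ltn_trans jn.
  by rewrite ltnNge ij.
have coef w (i : 'I_n.+1) : (\sum_(0 <= j < n.+1) p w j)%R ord0 i = w i ord0 i.
  rewrite big_mkord summxE (bigD1 i) //= big1 => [|j ji].
    by rewrite !mxE inord_val !eqxx mulr1 addr0.
  by rewrite !mxE inord_val (eq_sym i) (negPf ji) ?andbF mulr0.
have coef2 w (i a : 'I_n.+1) : (a < i)%N ->
    (\sum_(0 <= j < n.+1) s w j)%R i a = (- w i ord0 a)%R.
  move=> ai; rewrite big_mkord summxE (bigD1 i) //= big1 => [|j ji].
    by rewrite !mxE inord_val !eqxx addr0 /nil_coord ai.
  by rewrite !mxE inord_val (eq_sym i) (negPf ji).
rewrite !modelE => -[e1 e2] i ilen; apply/rowP => a.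
have {ilen}[i' ->] : exists i' : 'I_n.+1, i = i' by exists (Ordinal (ilen : (i < n.+1)%N)).
case: (ssrnat.ltngtP a i') => ai.
- by apply: oppr_inj; rewrite -!coef2 // e2.
- have /maskedP m := mv i'; have /maskedP m' := mv' i'.
  by rewrite m ?m' // /nil_live -ltnNge.
- by rewrite (val_inj ai : a = i') -!coef e1.
Qed.

Definition free_nilpotent_tower : abelian_tower G n.+1 n 2.
Proof.
have phiD i u v : (i <= n)%N -> nil_phi i (u + v)%R = nil_phi i u * nil_phi i v.
  by move=> _; exact: nil_phiD.
have phi_act i j u v : (j < i <= n)%N ->
    masked (nil_live j) u -> masked (nil_live i) v ->
    nil_phi i v * nil_phi j u = nil_phi j u * nil_phi i (v *m nil_act j u i)%R.
  by move=> ji _ _; exact: nil_phi_act.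
have act_unip i j u a b : (j < i <= n)%N ->
    ~~ (nil_live i b && (nil_wt i a < nil_wt i b)%N) ->
    nil_act j u i a b = (a == b)%:R%R.
  move=> /andP[ji _] h; rewrite /nil_act !mxE.
  case: ifP => [/andP[/eqP ai /eqP bj]|_]; last by rewrite subr0.
  by move: h; rewrite /nil_live /nil_wt ai bj eqxx (ltnW ji) ltn_eqF.
apply: (@AbelianTower _ _ _ _ nil_phi nil_live nil_act nil_wt) nil_inj => //.
- by move=> i a _ _; rewrite /nil_wt; case: ifP.
- by move=> i _; exists ord0.
- exact: normal_form_surj phi_act act_unip nil_generated.
Defined.

End FreeNilpotentTower.

Theorem corollary4p6 (R : realType) (n : nat) (hn : (1 <= n)%N) :
  [/\ has_bounded_real_time_combing_of_degree R (UT n) n.-1,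
      has_bounded_real_time_combing_of_degree R (Heisenberg n) 2 &
      has_bounded_real_time_combing_of_degree R (free_nilpotent2 n) 2].
Proof.
case: n hn => // n _; split.
- exact/tower_combing/unitriangular_tower.
- exact/tower_combing/heisenberg_tower.
- exact/tower_combing/free_nilpotent_tower.
Qed.
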